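(* Let $m\ne0$ be real. Let $u_0\in H^{7/4}(\mathbb T^3)$ and $u_1\in H^{3/4}(\mathbb T^3)$ be real valued, let $T>0$, and let $z\in\mathcal C([0,T],H^{7/4}(\mathbb T^3))\cap\mathcal C^1([0,T],H^{3/4}(\mathbb T^3))$ be the unique real-valued solution of $$\partial_{tt}z-\Delta z+m^2z=z^2,\qquad z(0)=u_0,\quad\partial_tz(0)=u_1,$$ on the three-dimensional torus $\mathbb T^3$. For a step size $\tau>0$ let $u^n$ be the numerical solution defined by $u^0=u_0-i\langle\nabla\rangle_m^{-1}u_1$ and, for $\ell\ge0$, with $f^\ell=f(u^\ell,\overline{u^\ell})$, $$\begin{aligned}u^{\ell+1}={}&e^{\tau\mathcal L}u^\ell+\tau e^{\tau\mathcal L}\mathcal B\big(F(u^\ell)\cdot\varphi_1(\tau\mathcal A)G(\overline{u^\ell})\big)\\&+\tau e^{\tau\mathcal L}\mathcal B\big(F(u^\ell)\cdot\varphi_2(\tau\mathcal A)\big[e^{-\tau\mathcal A}G(e^{\tau\mathcal A}\overline{u^\ell})-G(\overline{u^\ell})\big]\big)\\&+\tau\Big[\mathcal B\big(F(e^{\tau\mathcal L}u^\ell)\cdot\varphi_2(\tau\mathcal A)G(e^{\tau\mathcal L}\overline{u^\ell})\big)-e^{\tau\mathcal L}\mathcal B\big(F(u^\ell)\cdot\varphi_2(\tau\mathcal A)G(\overline{u^\ell})\big)\Big]\\&+\tfrac{\tau^2}2e^{\tau\mathcal L}\Big(D_1f(u^\ell,\overline{u^\ell})\cdot f^\ell+D_2f(u^\ell,\overline{u^\ell})\cdot\overline{f^\ell}\Big).\end{aligned}$$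 Then there exists $C_T>0$ such that $$\|z(n\tau)-\operatorname{Re}u^n\|_{H^1}+\|\partial_tz(n\tau)-\operatorname{Im}u^n\|_{L^2}\le C_T\,\tau^2,\qquad0\le n\tau\le T.$$
   Context: $\langle\nabla\rangle_m=\sqrt{-\Delta+m^2}$ (Fourier multiplier on $\mathbb T^3$), $\mathcal L=i\langle\nabla\rangle_m$, $\overline{\mathcal L}u=\overline{\mathcal L\overline u}$, $\mathcal A=-\mathcal L+\overline{\mathcal L}=-2i\langle\nabla\rangle_m$, $\varphi_1(z)=(e^z-1)/z$, $\varphi_2(z)=(e^z-\varphi_1(z))/z$; functions of $\mathcal A$ are Fourier multipliers acting componentwise on vector-valued functions; $Y\cdot Z=\sum_kY_kZ_k$. With $u=z-i\langle\nabla\rangle_m^{-1}\partial_tz$, so that $z=\operatorname{Re}u$, the equation is rewritten as the first-order system $\partial_tu-\mathcal Lu=f(u,\overline u)$ with $f(v,w)=-\tfrac14i\langle\nabla\rangle_m^{-1}(v^2+w^2+2vw)=\mathcal B(F(v)\cdot G(w))$, where $\mathcal B=\langle\nabla\rangle_m^{-1}$, $F(v)=-\tfrac i4(v^2,1,2v)$, $G(w)=(1,w^2,w)$. $D_1f$, $D_2f$ are the partial differentials of $f$ in its two arguments.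
   Formalization: The velocity error is ‖∂_t z(nτ)+⟨∇⟩_m Im u^n‖_{L^2} instead of ‖∂_t z(nτ)−Im u^n‖_{L^2}: since u=z−i⟨∇⟩_m^{-1}∂_t z, one has ∂_t z=−⟨∇⟩_m Im u, and the printed bound fails at n=0 for u_1≠0 as τ→0. *)

(* Defs.v *)
From HB Require Import structures.
From mathcomp Require Import all_boot all_order all_algebra.
From mathcomp Require Import complex.
From mathcomp Require Import all_classical all_reals all_analysis.

Set Implicit Arguments.
Unset Strict Implicit.
Unset Printing Implicit Defensive.
Import Order.TTheory GRing.Theory Num.Theory.
Import numFieldNormedType.Exports.

Local Open Scope classical_set_scope.
Local Open Scope ring_scope.
Local Open Scope complex_scope.

(** Functions on T^3 = (R / 2 pi Z)^3 are functions on R^3 of which only the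
    restriction to the fundamental cell [0, 2 pi]^3 matters: [haar] below is
    the normalised Lebesgue measure of that cell.  Measurable
    functions that agree [haar]-almost everywhere stand for the same function
    on T^3. *)
Notation T3 R :=
  (measurableTypeR R * measurableTypeR R * measurableTypeR R)%type.

(** Frequencies: the dual group Z^3. *)
Notation Z3 := (int * int * int)%type.

Fact twopi_gt0 (R : realType) : (0 : R) < 2 * pi.
Proof. by rewrite mulr_gt0// pi_gt0. Qed.

Definition haar1 (R : realType) : probability (measurableTypeR R) R :=
  uniform_prob (twopi_gt0 R).

(** The product measure [haar1 \x haar1 \x haar1], packaged so that it is
    inferred to be finite. *)
Definition haar (R : realType) : subprobability (T3 R) R :=
  product_subprobability
    (product_subprobability (haar1 R : subprobability _ R,
                             haar1 R : subprobability _ R),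
     haar1 R : subprobability _ R).

Definition toC (R : realType) (f : T3 R -> R) : T3 R -> R[i] :=
  fun x => (f x)%:C.

Definition cbar (R : realType) (f : T3 R -> R[i]) : T3 R -> R[i] :=
  fun x => conjc (f x).

Definition L2norm (R : realType) (f : T3 R -> R[i]) : \bar R :=
  Lnorm (haar R) 2%:E (fun x => (Normc.normc (f x))%:E).

Definition L2 (R : realType) (f : T3 R -> R[i]) : Prop :=
  [/\ measurable_fun setT (fun x => complex.Re (f x)),
      measurable_fun setT (fun x => complex.Im (f x)) &
      (L2norm f < +oo)%E].

Definition integralC (R : realType) (f : T3 R -> R[i]) : R[i] :=
  Rintegral (haar R) setT (fun x => complex.Re (f x)) +i*
  Rintegral (haar R) setT (fun x => complex.Im (f x)).

Definition dot3 (R : realType) (k : Z3) (x : T3 R) : R :=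
  k.1.1%:~R * x.1.1 + k.1.2%:~R * x.1.2 + k.2%:~R * x.2.

Definition sqnorm3 (R : realType) (k : Z3) : R :=
  k.1.1%:~R ^+ 2 + k.1.2%:~R ^+ 2 + k.2%:~R ^+ 2.

(** [mathcomp-analysis] has no exponential on [R[i]]. *)
Definition expC (R : realType) (z : R[i]) : R[i] :=
  (expR (complex.Re z))%:C * (cos (complex.Im z) +i* sin (complex.Im z)).

Definition fourier (R : realType) (f : T3 R -> R[i]) (k : Z3) : R[i] :=
  integralC (fun x => f x * expC (- ('i * (dot3 k x)%:C))).

(** Only s >= 0 is used, so that H^s is contained in L^2; the norm is +oo
    outside L^2, hence [Hnorm s f < +oo] characterises H^s. *)
Definition Hnorm (R : realType) (s : R) (f : T3 R -> R[i]) : \bar R :=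
  if `[< L2 f >] then
    ((\esum_(k in [set: Z3])
        ((1 + sqnorm3 R k) `^ s * Normc.normc (fourier f k) ^+ 2)%:E)
      `^ (2^-1))%E
  else +oo%E.

Definition Hs (R : realType) (s : R) (f : T3 R -> R[i]) : Prop :=
  (Hnorm s f < +oo)%E.

(** The Fourier multiplier with symbol [sigma], on the domain of those f for
    which the multiplied coefficients are again those of an L^2 function: a
    representative of that (a.e. unique) function is picked; the value is 0
    outside the domain. *)
Definition Fmul (R : realType) (sigma : Z3 -> R[i]) (f : T3 R -> R[i])
    : T3 R -> R[i] :=
  xget (fun=> 0)
    [set g | L2 g /\ forall k, fourier g k = sigma k * fourier f k].

(** The symbol of <nabla>_m = (- Laplacian + m^2)^(1/2). *)
Definition jap (R : realType) (m : R) (k : Z3) : R :=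
  Num.sqrt (sqnorm3 R k + m ^+ 2).

Definition japD (R : realType) (m : R) : (T3 R -> R[i]) -> T3 R -> R[i] :=
  Fmul (fun k => (jap m k)%:C).

(** The symbol of L = i <nabla>_m. *)
Definition symL (R : realType) (m : R) (k : Z3) : R[i] := 'i * (jap m k)%:C.

(** The symbol of A = - L + Lbar = - 2 i <nabla>_m, where
    Lbar u = conj (L (conj u)) = - L u. *)
Definition symA (R : realType) (m : R) (k : Z3) : R[i] :=
  - (2 * 'i * (jap m k)%:C).

Definition phi1 (R : realType) (z : R[i]) : R[i] := (expC z - 1) / z.
Definition phi2 (R : realType) (z : R[i]) : R[i] := (expC z - phi1 z) / z.

(** [funL m tau psi] is psi(tau L), and [funA m tau psi] is psi(tau A). *)
Definition funL (R : realType) (m tau : R) (psi : R[i] -> R[i])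
    : (T3 R -> R[i]) -> T3 R -> R[i] :=
  Fmul (fun k => psi (tau%:C * symL m k)).

Definition funA (R : realType) (m tau : R) (psi : R[i] -> R[i])
    : (T3 R -> R[i]) -> T3 R -> R[i] :=
  Fmul (fun k => psi (tau%:C * symA m k)).

Definition opB (R : realType) (m : R) : (T3 R -> R[i]) -> T3 R -> R[i] :=
  Fmul (fun k => ((jap m k)^-1)%:C).

Definition vec (R : realType) : Type := 'I_3 -> T3 R -> R[i].

Definition vec3 (R : realType) (a b c : T3 R -> R[i]) : vec R :=
  fun j => tnth [tuple a; b; c] j.

Definition vdot (R : realType) (Y Z : vec R) : T3 R -> R[i] :=
  fun x => \sum_(j < 3) Y j x * Z j x.

Definition vmap (R : realType) (P : (T3 R -> R[i]) -> T3 R -> R[i])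
    (Y : vec R) : vec R := fun j => P (Y j).

Definition vsub (R : realType) (Y Z : vec R) : vec R := fun j => Y j \- Z j.

Definition nlF (R : realType) (v : T3 R -> R[i]) : vec R :=
  vec3 (fun x => - ('i / 4) * v x ^+ 2)
       (fun x => - ('i / 4))
       (fun x => - ('i / 4) * (2 * v x)).

Definition nlG (R : realType) (w : T3 R -> R[i]) : vec R :=
  vec3 (fun=> 1) (fun x => w x ^+ 2) w.

(** f(v, w) = - (i/4) <nabla>_m^(-1) (v^2 + w^2 + 2 v w) = B (F(v) . G(w)). *)
Definition nlf (R : realType) (m : R) (v w : T3 R -> R[i]) : T3 R -> R[i] :=
  (- ('i / 4)) \*o
    opB m (fun x => v x ^+ 2 + w x ^+ 2 + 2 * v x * w x).

(** [diff_at Phi v h] is the value at the increment h of the differential of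
    Phi at v, i.e. the limit (here taken in L^2) of
    (Phi(v + e h) - Phi(v)) / e as the real number e <> 0 tends to 0. *)
Definition diff_at (R : realType) (Phi : (T3 R -> R[i]) -> T3 R -> R[i])
    (v h : T3 R -> R[i]) : T3 R -> R[i] :=
  xget (fun=> 0)
    [set g | L2 g /\
      L2norm (fun x =>
          (e^-1)%:C * (Phi (fun y => v y + e%:C * h y) x - Phi v x) - g x)
        @[e --> (0 : R)^'] --> 0%E].

Definition D1f (R : realType) (m : R) (v w h : T3 R -> R[i]) :=
  diff_at (fun v' => nlf m v' w) v h.

Definition D2f (R : realType) (m : R) (v w h : T3 R -> R[i]) :=
  diff_at (fun w' => nlf m v w') w h.

Definition step (R : realType) (m tau : R) (u : T3 R -> R[i])
    : T3 R -> R[i] :=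
  let ub := cbar u in
  let eL := funL m tau (@expC R) in
  let eA := funA m tau (@expC R) in
  let emA := funA m (- tau) (@expC R) in
  let ph1 := vmap (funA m tau (@phi1 R)) in
  let ph2 := vmap (funA m tau (@phi2 R)) in
  let B := opB m in
  let F := @nlF R in
  let G := @nlG R in
  let fl := nlf m u ub in
  eL u
  \+ tau%:C \*o eL (B (vdot (F u) (ph1 (G ub))))
  \+ tau%:C \*o
       eL (B (vdot (F u) (ph2 (vsub (vmap emA (G (eA ub))) (G ub)))))
  \+ tau%:C \*o (B (vdot (F (eL u)) (ph2 (G (eL ub))))
                 \- eL (B (vdot (F u) (ph2 (G ub)))))
  \+ (tau ^+ 2 / 2)%:C \*o eL (D1f m u ub fl \+ D2f m u ub (cbar fl)).

Definition scheme (R : realType) (m tau : R) (u0 u1 : T3 R -> R) (n : nat)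
    : T3 R -> R[i] :=
  iter n (step m tau) (toC u0 \- 'i \*o opB m (toC u1)).

Definition posn (R : realType) (u : T3 R -> R[i]) : T3 R -> R[i] :=
  toC (fun x => complex.Re (u x)).

(** u = z - i <nabla>_m^(-1) z_t with z real means z = Re u and
    z_t = - <nabla>_m Im u. *)
Definition veloc (R : realType) (m : R) (u : T3 R -> R[i]) : T3 R -> R[i] :=
  \- japD m (toC (fun x => complex.Im (u x))).

(** z \in C([0, T], H^s). *)
Definition contH (R : realType) (T s : R) (z : R -> T3 R -> R) : Prop :=
  forall t, t \in `[0, T] ->
    Hs s (toC (z t)) /\
    Hnorm s (toC (z r \- z t)) @[r --> within `[0, T] (nbhs t)] --> 0%E.

(** z is differentiable from [0, T] to H^s with derivative zt (one-sided at
    the end points). *)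
Definition derivH (R : realType) (T s : R) (z zt : R -> T3 R -> R) : Prop :=
  forall t, t \in `[0, T] ->
    Hnorm s (toC (fun x => (r - t)^-1 * (z r x - z t x) - zt t x))
      @[r --> within `[0, T] t^'] --> 0%E.

(** z_tt - Laplacian z + m^2 z = z^2 on ]0, T[, where zt = z_t.  Since
    Laplacian z and z_tt are only in H^(-1/4), the equation is read in the
    sense of distributions on T^3, that is tested against the characters. *)
Definition wave_eq (R : realType) (m T : R) (z zt : R -> T3 R -> R) : Prop :=
  forall (k : Z3) (t : R), 0 < t < T ->
    let rhs : R[i] := fourier (toC (fun x => z t x ^+ 2)) k
                      - (sqnorm3 R k + m ^+ 2)%:C * fourier (toC (z t)) k in
    is_derive t (1 : R) (fun r : R => complex.Re (fourier (toC (zt r)) k))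
      (complex.Re rhs) /\
    is_derive t (1 : R) (fun r : R => complex.Im (fourier (toC (zt r)) k))
      (complex.Im rhs).

(* Main.v *)
From HB Require Import structures.
Require Import Defs.
From mathcomp Require Import all_boot all_order all_algebra.
From mathcomp Require Import complex.
From mathcomp Require Import all_classical all_reals all_analysis.
From mathcomp Require Import measurable_realfun.
From mathcomp Require Import ring lra.

(** On the Fourier side the system for u = z - i <nabla>^(-1) z_t reads
    p'(s) = T_chi(s)(p, p) for the variable p(s) = exp(- i s <nabla>) u(t + s),
    where T is the quadratic form of - (i/4) <nabla>^(-1) (u + conj u)^2 and
    chi(s) = exp(i s phase) collects the oscillations of the three interacting
    waves. On each of the products u^2, u conj(u) and conj(u)^2 the phase is the
    sum of a part domf, on which the functions phi1 and phi2 of the operator A act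
    and which the scheme integrates exactly, and of two slow parts bet and gam,
    which are multiples of the resonance function <j> + <l> - <j + l> or
    constants. In the scheme the slow oscillations are replaced by linear
    interpolations in s, and the dependence of p on s by its first order Taylor
    polynomial.

    The resonance function is at most twice the lower frequency, so that its square
    is at most 4 <j> <l> (resonance_sqr). The second differences of the slow
    oscillations are therefore bounded by tau^2 <j> <l> (chiY_bound): second order
    consistency costs one derivative on each factor, not two on one of them. With
    u bounded in H^(7/4) the derived factors are in H^(3/4), the product of two
    such functions is in L^2 in dimension three (l2_conv_fin, by comparison of the
    two input frequencies), and <nabla>^(-1) leads back to H^1. So the local error
    is of order tau^3 in H^1 (local_error). The symbol of the scheme itself is
    bounded by a multiple of tau, hence the scheme is stable in H^1 (stepS_lip), and
    the local errors add up to tau^2 (global_error). The error of z in H^1 and the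
    error of z_t in L^2 are both controlled by the error of u in H^1
    (error_bound).

    All estimates are made on sequences of Fourier coefficients. To transfer them
    to functions one needs that an integrable function is determined by its
    coefficients (fourier_uniqueness), the theorem of Riesz and Fischer
    (riesz_fischer), and the convolution theorem for products of square integrable
    functions (fourierM). Then each operation of the scheme, including the
    differentials of the nonlinearity, which are limits of difference quotients in
    L^2 (diff_at_coefs), is followed on coefficients (step_coefs). *)

Set Implicit Arguments.
Unset Strict Implicit.
Unset Printing Implicit Defensive.
Import Order.TTheory GRing.Theory Num.Theory.
Import numFieldNormedType.Exports.

Local Open Scope classical_set_scope.
Local Open Scope ring_scope.
Local Open Scope complex_scope.

Notation normc := Normc.normc.
Notation Re := complex.Re.
Notation Im := complex.Im.

(** * Complex numbers and finite sums *)

Section ComplexNorm.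
Context {R : realType}.
Implicit Types (x y : R[i]) (a b : R).

Lemma cReD x y : Re (x + y) = Re x + Re y. Proof. by case: x; case: y. Qed.
Lemma cImD x y : Im (x + y) = Im x + Im y. Proof. by case: x; case: y. Qed.
Lemma cReN x : Re (- x) = - Re x. Proof. by case: x. Qed.
Lemma cImN x : Im (- x) = - Im x. Proof. by case: x. Qed.
Lemma cReM x y : Re (x * y) = Re x * Re y - Im x * Im y.
Proof. by case: x; case: y. Qed.
Lemma cImM x y : Im (x * y) = Re x * Im y + Im x * Re y.
Proof. by case: x; case: y. Qed.
Lemma cRe_conj x : Re (conjc x) = Re x. Proof. by case: x. Qed.
Lemma cIm_conj x : Im (conjc x) = - Im x. Proof. by case: x. Qed.

Lemma complexP x y : Re x = Re y -> Im x = Im y -> x = y.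
Proof. by case: x => a b; case: y => c d /= -> ->. Qed.

Lemma cRe_sum T (s : seq T) (F : T -> R[i]) :
  Re (\sum_(j <- s) F j) = \sum_(j <- s) Re (F j).
Proof.
by elim: s => [|a s IH]; rewrite ?big_nil// !big_cons cReD IH.
Qed.

Lemma cIm_sum T (s : seq T) (F : T -> R[i]) :
  Im (\sum_(j <- s) F j) = \sum_(j <- s) Im (F j).
Proof.
by elim: s => [|a s IH]; rewrite ?big_nil// !big_cons cImD IH.
Qed.

Lemma normcE x : `|x| = (normc x)%:C. Proof. by []. Qed.

Lemma normc_ge0 x : 0 <= normc x. Proof. by case: x => a b; exact: sqrtr_ge0. Qed.

Lemma ler_normcD x y : normc (x + y) <= normc x + normc y.
Proof. by have := ler_normD x y; rewrite !normcE -rmorphD lecR. Qed.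

Lemma normcN x : normc (- x) = normc x.
Proof. by case: x => a b; rewrite /= !sqrrN. Qed.

Lemma ler_normcB x y : normc (x - y) <= normc x + normc y.
Proof. by rewrite -[normc y]normcN ler_normcD. Qed.

Lemma ler_dist_normc x y : `|normc x - normc y| <= normc (x - y).
Proof.
rewrite ler_norml; apply/andP; split.
  rewrite lerNl opprB lerBlDl -[normc (x - y)]normcN opprB.
  by apply: le_trans (ler_normcD _ _); rewrite subrKC.
by rewrite lerBlDl; apply: le_trans (ler_normcD _ _); rewrite subrKC.
Qed.

Lemma normc_conj x : normc (conjc x) = normc x.
Proof. by case: x => a b; rewrite /= sqrrN. Qed.

Lemma normcR a : normc a%:C = `|a|.
Proof. by rewrite /= expr0n /= addr0 sqrtr_sqr. Qed.

Lemma normci : normc ('i : R[i]) = 1.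
Proof. by rewrite /= expr0n expr1n add0r sqrtr1. Qed.

Lemma normc_sqrE x : normc x ^+ 2 = Re x ^+ 2 + Im x ^+ 2.
Proof. by case: x => a b; rewrite /= sqr_sqrtr// addr_ge0 ?sqr_ge0. Qed.

Lemma Re_le_normc x : `|Re x| <= normc x.
Proof.
by rewrite -(ler_pXn2r (ltn0Sn 1)) ?nnegrE ?normc_ge0// normc_sqrE real_normK
  ?num_real// lerDl sqr_ge0.
Qed.

Lemma Im_le_normc x : `|Im x| <= normc x.
Proof.
by rewrite -(ler_pXn2r (ltn0Sn 1)) ?nnegrE ?normc_ge0// normc_sqrE real_normK
  ?num_real// lerDr sqr_ge0.
Qed.

Lemma normc_le_ReIm x : normc x <= `|Re x| + `|Im x|.
Proof.
rewrite -(ler_pXn2r (ltn0Sn 1)) ?nnegrE ?normc_ge0 ?addr_ge0// normc_sqrE.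
rewrite sqrrD !real_normK ?num_real// lerD2r lerDl.
by rewrite mulrn_wge0// mulr_ge0.
Qed.

Lemma ler_normc_sum T (s : seq T) (F : T -> R[i]) :
  normc (\sum_(j <- s) F j) <= \sum_(j <- s) normc (F j).
Proof.
elim: s => [|a s IH]; rewrite ?big_nil ?Normc.normc0// !big_cons.
by rewrite (le_trans (ler_normcD _ _))// lerD2l.
Qed.

Lemma normc_eq0P x : (normc x == 0) = (x == 0).
Proof.
by apply/eqP/eqP => [/Normc.eq0_normc//|->]; rewrite Normc.normc0.
Qed.

Lemma conjcM x y : conjc (x * y) = conjc x * conjc y.
Proof. by case: x => a b; case: y => c d; apply: complexP => /=; ring. Qed.

Lemma conjcD x y : conjc (x + y) = conjc x + conjc y.
Proof. by case: x => a b; case: y => c d; apply: complexP => /=; ring. Qed.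

Lemma conjcB x y : conjc (x - y) = conjc x - conjc y.
Proof. by case: x => a b; case: y => c d; apply: complexP => /=; ring. Qed.

Lemma conjc_real a : conjc a%:C = a%:C.
Proof. by apply: complexP => //=; rewrite oppr0. Qed.

Lemma conjcM_normc x : x * conjc x = (normc x ^+ 2)%:C.
Proof.
by rewrite normc_sqrE; case: x => a b; apply: complexP => /=; ring.
Qed.

End ComplexNorm.

Section FiniteSums.
Context {R : realType}.

Lemma ler_sum_uniq_sub (T : eqType) (J B : seq T) (f : T -> R) :
  uniq J -> uniq B -> {subset J <= B} -> (forall j, 0 <= f j) ->
  \sum_(j <- J) f j <= \sum_(j <- B) f j.
Proof.
move=> uJ uB JB f0.
have -> : \sum_(j <- J) f j = \sum_(j <- B | j \in J) f j.
  rewrite -[RHS]big_filter; apply: perm_big; apply: uniq_perm => //.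
    by rewrite filter_uniq.
  move=> x; rewrite mem_filter; case: (boolP (x \in J)) => // /JB.
  by rewrite andTb => ->.
rewrite [leRHS](bigID (fun j => j \in J))/= lerDl.
by apply: sumr_ge0.
Qed.

Lemma sum_CauchySchwarz T (s : seq T) (x y : T -> R) :
  (\sum_(j <- s) x j * y j) ^+ 2 <=
  (\sum_(j <- s) x j ^+ 2) * (\sum_(j <- s) y j ^+ 2).
Proof.
elim: s => [|a s IH]; first by rewrite !big_nil mul0r expr2 mul0r.
rewrite !big_cons; set S := \sum_(j <- s) _ in IH *.
set X := \sum_(j <- s) _ ^+ 2 in IH *.
set Y := \sum_(j <- s) _ ^+ 2 in IH *.
have X0 : 0 <= X by apply: sumr_ge0 => i _; rewrite sqr_ge0.
have Y0 : 0 <= Y by apply: sumr_ge0 => i _; rewrite sqr_ge0.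
suff : 2 * (S * (x a * y a)) <= X * y a ^+ 2 + Y * x a ^+ 2 by lra.
set u := x a; set v := y a.
have sXY : (2 * (S * (u * v))) ^+ 2 <= (X * v ^+ 2 + Y * u ^+ 2) ^+ 2.
  have -> : (2 * (S * (u * v))) ^+ 2 = 4 * (u ^+ 2 * v ^+ 2) * S ^+ 2 by ring.
  apply: (@le_trans _ _ (4 * (u ^+ 2 * v ^+ 2) * (X * Y))).
    by apply: ler_wpM2l => //; rewrite mulr_ge0// mulr_ge0 ?sqr_ge0.
  have := sqr_ge0 (X * v ^+ 2 - Y * u ^+ 2); lra.
rewrite leNgt; apply/negP => h.
have h0 : 0 <= X * v ^+ 2 + Y * u ^+ 2 by rewrite addr_ge0// mulr_ge0// sqr_ge0.
move: sXY; rewrite leNgt => /negP; apply.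
by rewrite ltr_pXn2r// nnegrE// ltW// (le_lt_trans h0).
Qed.

End FiniteSums.

(** * Absolutely convergent sums and weighted l2 bounds *)

Section AbsoluteSums.
Context {R : realType} {T : countType}.
Implicit Types (F G : T -> R[i]) (M : R).

(** The countable index type is exhausted by finite lists without repetition, so
    that sums over it are limits of finite sums. *)
Definition fenum n : seq T := pmap (@pickle_inv T) (iota 0 n).

Lemma fenum_uniq n : uniq (fenum n).
Proof. by apply: (pmap_uniq (@pickle_invK T)); exact: iota_uniq. Qed.

Lemma fenum_sub n p : (n <= p)%N -> {subset fenum n <= fenum p}.
Proof.
move=> np x; rewrite !mem_pmap => H.
have [i + ->] := @mapP _ _ _ _ _ H; rewrite mem_iota add0n => /andP[_ iN].
by apply: map_f; rewrite mem_iota add0n (leq_trans iN).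
Qed.

Lemma fenum_exhaust (s : seq T) : exists n, {subset s <= fenum n}.
Proof.
elim: s => [|a s [n Hn]]; first by exists 0%N.
exists (maxn n (pickle a).+1) => x; rewrite inE => /orP[/eqP ->|/Hn].
  rewrite mem_pmap; apply/mapP; exists (pickle a); last by rewrite pickleK_inv.
  by rewrite mem_iota add0n leq_maxr.
by apply: fenum_sub; exact: leq_maxl.
Qed.

Lemma big_fenum (V : zmodType) (F : T -> V) n :
  \sum_(j <- fenum n) F j =
  \sum_(0 <= i < n) oapp F 0 (@pickle_inv T i).
Proof.
rewrite /fenum; elim: n => [|n IH]; first by rewrite big_nil big_geq.
rewrite big_nat_recr// -IH -[in iota 0 _]addn1 iotaD pmap_cat big_cat add0n.
rewrite [iota n 1]/= [pmap _ [:: n]]/=; case: (pickle_inv n) => [a|]; rewrite ?big_seq1 ?big_nil; reflexivity.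
Qed.

(** Absolute summability with an explicit bound, stated on finite sums so that
    bounds can be added and multiplied without discussing limits. *)
Definition absum F M := forall s, uniq s -> \sum_(j <- s) normc (F j) <= M.

Definition csum F : R[i] :=
  limn (fun n => \sum_(j <- fenum n) Re (F j)) +i*
  limn (fun n => \sum_(j <- fenum n) Im (F j)).

Lemma cvg_dominated_sum (f : T -> R) M :
  (forall s, uniq s -> \sum_(j <- s) `|f j| <= M) ->
  cvgn (fun n => \sum_(j <- fenum n) f j).
Proof.
move=> fM; under eq_fun do rewrite big_fenum.
apply: (@normed_cvg R R^o (fun i => oapp f 0 (@pickle_inv T i))).
apply: nondecreasing_is_cvgn.
  by apply: nondecreasing_series => i _ _; exact: normr_ge0.
exists M => _ [n _ <-] /=; rewrite /series/=.
apply: le_trans (fM _ (fenum_uniq n)); rewrite big_fenum.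
by apply: ler_sum => i _; case: (pickle_inv i) => //=; rewrite normr0.
Qed.

Lemma absum_cvg F M : absum F M ->
  (fun n => \sum_(j <- fenum n) Re (F j)) @ \oo --> Re (csum F) /\
  (fun n => \sum_(j <- fenum n) Im (F j)) @ \oo --> Im (csum F).
Proof.
move=> FM; split.
  apply: (@cvg_dominated_sum _ M) => s us; apply: le_trans (FM _ us).
  by apply: ler_sum => i _; exact: Re_le_normc.
apply: (@cvg_dominated_sum _ M) => s us; apply: le_trans (FM _ us).
by apply: ler_sum => i _; exact: Im_le_normc.
Qed.

(** Partial sums over the exhaustion approximate the sum: the tool by which
    every identity between sums below is reduced to finite sums. *)
Lemma csum_close F M e : absum F M -> 0 < e ->
  exists n0, forall n, (n0 <= n)%N ->
    normc (csum F - \sum_(j <- fenum n) F j) <= e.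
Proof.
move=> /absum_cvg[/cvgrPdist_le rF /cvgrPdist_le iF] e0.
have e2 : 0 < e / 2 by rewrite divr_gt0.
have [N1 _ H1] := rF _ e2; have [N2 _ H2] := iF _ e2.
exists (maxn N1 N2) => n; rewrite geq_max => /andP[n1 n2].
rewrite (le_trans (normc_le_ReIm _))// [leRHS](splitr e) lerD//.
  by rewrite cReD cReN cRe_sum; exact: H1.
by rewrite cImD cImN cIm_sum; exact: H2.
Qed.

Lemma csum_uniq F M l : absum F M ->
  (forall e, 0 < e -> exists n, forall p, (n <= p)%N ->
    normc (l - \sum_(j <- fenum p) F j) <= e) -> csum F = l.
Proof.
move=> FM H; apply/eqP; rewrite -subr_eq0 -normc_eq0P; apply/eqP/le_anti.
rewrite normc_ge0 andbT; apply/ler_addgt0Pr => e e0; rewrite add0r.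
have e2 : 0 < e / 2 by rewrite divr_gt0.
have [n1 H1] := csum_close FM e2; have [n2 H2] := H _ e2.
pose n := maxn n1 n2.
have -> : csum F - l = (csum F - \sum_(j <- fenum n) F j) -
  (l - \sum_(j <- fenum n) F j) by ring.
rewrite (le_trans (ler_normcB _ _))// [leRHS](splitr e) lerD//.
  by apply: H1; exact: leq_maxl.
by apply: H2; exact: leq_maxr.
Qed.

Lemma absumD F G M N : absum F M -> absum G N -> absum (fun j => F j + G j) (M + N).
Proof.
move=> FM GN s us; apply: le_trans (lerD (FM s us) (GN s us)).
by rewrite -big_split/=; apply: ler_sum => i _; exact: ler_normcD.
Qed.

Lemma absumZ F M (c : R[i]) : absum F M -> absum (fun j => c * F j) (normc c * M).
Proof.
move=> FM s us; under eq_bigr do rewrite Normc.normcM.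
by rewrite -mulr_sumr ler_wpM2l ?normc_ge0// FM.
Qed.

Lemma absum_le F G M : absum G M -> (forall j, normc (F j) <= normc (G j)) ->
  absum F M.
Proof.
move=> GM FG s us; apply: le_trans (GM s us).
by apply: ler_sum => i _; exact: FG.
Qed.

Lemma csumD F G M N : absum F M -> absum G N ->
  csum (fun j => F j + G j) = csum F + csum G.
Proof.
move=> FM GN; apply: (csum_uniq (absumD FM GN)) => e e0.
have e2 : 0 < e / 2 by rewrite divr_gt0.
have [n1 H1] := csum_close FM e2; have [n2 H2] := csum_close GN e2.
exists (maxn n1 n2) => p; rewrite geq_max => /andP[p1 p2].
rewrite big_split/=.
have -> : csum F + csum G -
   (\sum_(i <- fenum p) F i + \sum_(i <- fenum p) G i) =
   (csum F - \sum_(i <- fenum p) F i) + (csum G - \sum_(i <- fenum p) G i) by ring.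
rewrite (le_trans (ler_normcD _ _))// [leRHS](splitr e) lerD//.
  exact: H1.
exact: H2.
Qed.

Lemma csumZ F M (c : R[i]) : absum F M -> csum (fun j => c * F j) = c * csum F.
Proof.
move=> FM; apply: (csum_uniq (absumZ c FM)) => e e0.
have c0 : 0 < normc c + 1 by rewrite ltr_wpDl// normc_ge0.
have [n H] := csum_close FM (divr_gt0 e0 c0).
exists n => p np; rewrite -mulr_sumr -mulrBr Normc.normcM.
apply: (@le_trans _ _ ((normc c + 1) * (e / (normc c + 1)))).
  by apply: ler_pM; rewrite ?normc_ge0// ?lerDl// H.
by rewrite mulrCA divff ?mulr1// gt_eqF.
Qed.

Lemma csum_le F M : absum F M -> normc (csum F) <= M.
Proof.
move=> FM; apply/ler_addgt0Pr => e e0.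
have [n H] := csum_close FM e0.
have -> : csum F = \sum_(j <- fenum n) F j + (csum F - \sum_(j <- fenum n) F j) by ring.
rewrite (le_trans (ler_normcD _ _))// lerD ?H//.
by rewrite (le_trans (ler_normc_sum _ _))// FM// fenum_uniq.
Qed.

Lemma csum_ext F G : F =1 G -> csum F = csum G.
Proof. by move=> /funext ->. Qed.

(** A weighted l2 bound that holds for all finite inner sums passes to the limit,
    since only finitely many outer indices occur. *)
Lemma l2_csum (I : Type) (K : seq I) (w : I -> R) (F : I -> T -> R[i]) M :
  (forall k, exists B, absum (F k) B) -> (forall k, 0 <= w k) ->
  (forall J, uniq J ->
    \sum_(k <- K) w k * (\sum_(j <- J) normc (F k j)) ^+ 2 <= M) ->
  \sum_(k <- K) w k * normc (csum (F k)) ^+ 2 <= M.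
Proof.
move=> FB w0 H.
have cv k : (fun n => normc (\sum_(j <- fenum n) F k j)) @ \oo --> normc (csum (F k)).
  apply/cvgrPdist_le => e e0; have [B FkB] := FB k.
  have [n0 Hn] := csum_close FkB e0; exists n0 => // n /Hn h.
  by apply: le_trans h; exact: ler_dist_normc.
have cvs : (fun n => \sum_(k <- K) w k * normc (\sum_(j <- fenum n) F k j) ^+ 2) @ \oo
    --> \sum_(k <- K) w k * normc (csum (F k)) ^+ 2.
  elim: K {H} => [|a K IH].
    by under eq_fun do rewrite big_nil; rewrite big_nil; exact: cvg_cst.
  under eq_fun do rewrite big_cons; rewrite big_cons; apply: cvgD => //.
  by apply: cvgM; [exact: cvg_cst|apply: cvgM].
rewrite -(cvg_lim _ cvs)//; apply: limr_le; first exact: cvgP cvs.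
near=> n; apply: le_trans (H _ (fenum_uniq n)).
apply: ler_sum => k _; rewrite ler_wpM2l// lerXn2r ?nnegrE ?normc_ge0//.
  by apply: sumr_ge0 => j _; exact: normc_ge0.
exact: ler_normc_sum.
Unshelve. all: by end_near. Qed.

End AbsoluteSums.

Section WeightedNorms.
Context {R : realType} {T : countType}.
Implicit Types (w : T -> R) (a b : T -> R[i]) (A B M N : R).

(** A bound A on the weighted l2 norm of a, tested on finite sums: the norms of
    Sobolev spaces are handled only through such bounds, and no sum of squares
    has to be shown to converge. *)
Definition l2_le w a A :=
  0 <= A /\ forall K, uniq K -> \sum_(k <- K) w k * normc (a k) ^+ 2 <= A ^+ 2.

Lemma l2_le_ge0 w a A : l2_le w a A -> 0 <= A. Proof. by case. Qed.

Lemma l2_le_ext w a b A : a =1 b -> l2_le w a A -> l2_le w b A.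
Proof. by move=> /funext ->. Qed.

Lemma l2_le_monoM w a A B : A <= B -> l2_le w a A -> l2_le w a B.
Proof.
move=> AB [A0 aA]; split=> [|K uK]; first exact: le_trans AB.
by rewrite (le_trans (aA _ uK))// lerXn2r ?nnegrE// (le_trans A0).
Qed.

Lemma l2_le0 w : l2_le w (fun=> 0) 0.
Proof.
split=> // K _; rewrite big1 ?sqr_ge0// => k _.
by rewrite Normc.normc0 expr0n mulr0.
Qed.

(** Changes of weight and multiplications by bounded sequences are the two
    instances of use. *)
Lemma l2_le_weight w w' a b A c : 0 <= c -> (forall k, 0 <= w k) ->
  (forall k, w' k * normc (b k) ^+ 2 <= c ^+ 2 * (w k * normc (a k) ^+ 2)) ->
  l2_le w a A -> l2_le w' b (c * A).
Proof.
move=> c0 w0 ba [A0 aA]; split=> [|K uK]; first exact: mulr_ge0.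
rewrite exprMn; apply: le_trans (ler_wpM2l (sqr_ge0 c) (aA _ uK)).
by rewrite mulr_sumr; apply: ler_sum.
Qed.

Lemma l2_le_mul w a A c (d : T -> R[i]) : (forall k, 0 <= w k) ->
  (forall k, normc (d k) <= c) -> 0 <= c ->
  l2_le w a A -> l2_le w (fun k => d k * a k) (c * A).
Proof.
move=> w0 dc c0; apply: l2_le_weight => // k.
rewrite Normc.normcM exprMn mulrCA; apply: ler_wpM2r.
  by rewrite mulr_ge0// sqr_ge0.
by rewrite lerXn2r ?nnegrE ?normc_ge0.
Qed.

Lemma l2_leZ w a A (d : R[i]) : (forall k, 0 <= w k) ->
  l2_le w a A -> l2_le w (fun k => d * a k) (normc d * A).
Proof. by move=> w0; apply: l2_le_mul => //; exact: normc_ge0. Qed.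

Lemma l2_le_CS w a b A B K : (forall k, 0 <= w k) -> uniq K ->
  l2_le w a A -> l2_le w b B ->
  \sum_(k <- K) w k * (normc (a k) * normc (b k)) <= A * B.
Proof.
move=> w0 uK [A0 aA] [B0 bB].
have S0 : 0 <= \sum_(k <- K) w k * (normc (a k) * normc (b k)).
  by apply: sumr_ge0 => k _; rewrite !mulr_ge0 ?normc_ge0.
rewrite -(ler_pXn2r (ltn0Sn 1)) ?nnegrE ?mulr_ge0//.
under eq_bigr => k _ do
  rewrite -[w k]sqr_sqrtr// expr2 mulrACA.
apply: le_trans (sum_CauchySchwarz _ _ _) _.
rewrite exprMn; apply: ler_pM.
- by apply: sumr_ge0 => k _; exact: sqr_ge0.
- by apply: sumr_ge0 => k _; exact: sqr_ge0.
- by under eq_bigr do rewrite exprMn sqr_sqrtr//; exact: aA.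
- by under eq_bigr do rewrite exprMn sqr_sqrtr//; exact: bB.
Qed.

Lemma l2_leD w a b A B : (forall k, 0 <= w k) ->
  l2_le w a A -> l2_le w b B -> l2_le w (fun k => a k + b k) (A + B).
Proof.
move=> w0 aA bB; have [A0 HA] := aA; have [B0 HB] := bB.
split=> [|K uK]; first exact: addr_ge0.
apply: (@le_trans _ _ (\sum_(k <- K) (w k * normc (a k) ^+ 2 +
   2 * (w k * (normc (a k) * normc (b k))) + w k * normc (b k) ^+ 2))).
  apply: ler_sum => k _.
  have -> : w k * normc (a k) ^+ 2 + 2 * (w k * (normc (a k) * normc (b k))) +
    w k * normc (b k) ^+ 2 = w k * (normc (a k) + normc (b k)) ^+ 2 by ring.
  by rewrite ler_wpM2l// lerXn2r ?nnegrE ?addr_ge0 ?normc_ge0// ler_normcD.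
rewrite !big_split/= -mulr_sumr sqrrD mulr2n -mulr2n -mulr_natl.
by rewrite !lerD ?HA ?HB// ler_pM2l// l2_le_CS.
Qed.

Lemma l2_leB w a b A B : (forall k, 0 <= w k) ->
  l2_le w a A -> l2_le w b B -> l2_le w (fun k => a k - b k) (A + B).
Proof.
move=> w0 aA bB; apply: l2_leD => //.
have := l2_leZ (-1) w0 bB; rewrite normcN Normc.normc1 mul1r.
by apply: l2_le_ext => k; rewrite mulN1r.
Qed.

End WeightedNorms.

(** * The symbol of <nabla> and the lattice sum *)

Section Symbol.
Context {R : realType} (m : R).
Hypothesis m0 : m != 0.
Implicit Types j k l : Z3.

Local Notation w := (jap m).

Lemma sqnorm3_ge0 k : 0 <= sqnorm3 R k.
Proof. by rewrite !addr_ge0 ?sqr_ge0. Qed.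

Lemma jap_ge0 k : 0 <= w k. Proof. exact: sqrtr_ge0. Qed.

Lemma sqr_jap k : w k ^+ 2 = sqnorm3 R k + m ^+ 2.
Proof. by rewrite sqr_sqrtr// addr_ge0 ?sqr_ge0 ?sqnorm3_ge0. Qed.

Lemma jap_ge_mass k : `|m| <= w k.
Proof.
by rewrite -sqrtr_sqr ler_wsqrtr// lerDr sqnorm3_ge0.
Qed.

Lemma jap_gt0 k : 0 < w k.
Proof. by apply: lt_le_trans (jap_ge_mass k); rewrite normr_gt0. Qed.

Lemma jap0 : w 0 = `|m|.
Proof. by rewrite /jap /sqnorm3 /= !mulr0z !expr0n/= !add0r sqrtr_sqr. Qed.

Lemma japN k : w (- k) = w k.
Proof. by rewrite /jap /sqnorm3 /= !mulrNz !sqrrN. Qed.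

(** The inner product of j and l is at most <j> <l>, by Lagrange's identity. *)
Lemma jap_triangle j l : w (j + l) <= w j + w l.
Proof.
have wj := jap_ge0 j; have wl := jap_ge0 l.
rewrite -(ler_pXn2r (ltn0Sn 1)) ?nnegrE ?jap_ge0 ?addr_ge0//.
suff H : j.1.1%:~R * l.1.1%:~R + j.1.2%:~R * l.1.2%:~R +
    j.2%:~R * l.2%:~R <= w j * w l.
  rewrite sqrrD !sqr_jap /sqnorm3 /= !intrD.
  by have := sqr_ge0 m; nra.
set d := _ + _ + _; have [d0|d0] := leP d 0; first by rewrite (le_trans d0) ?mulr_ge0.
rewrite -(ler_pXn2r (ltn0Sn 1)) ?nnegrE ?mulr_ge0 ?(ltW d0)//.
rewrite exprMn !sqr_jap.
apply: (@le_trans _ _ (sqnorm3 R j * sqnorm3 R l)); last first.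
  by apply: ler_pM; rewrite ?sqnorm3_ge0 ?lerDl ?sqr_ge0.
rewrite /d /sqnorm3.
move: (j.1.1%:~R) (j.1.2%:~R) (j.2%:~R) (l.1.1%:~R) (l.1.2%:~R) (l.2%:~R).
move=> a b c a' b' c'.
have := sqr_ge0 (a * b' - b * a'); have := sqr_ge0 (a * c' - c * a').
have := sqr_ge0 (b * c' - c * b'); lra.
Qed.

(** The three-wave resonance function lies between 0 and twice the lower of the
    two input frequencies, by the triangle inequality. Its square is therefore
    shared equally between the two inputs: this is where the second order local
    error costs only one derivative on each factor. *)
Lemma resonance_sqr j l : (w j + w l - w (j + l)) ^+ 2 <= 4 * (w j * w l).
Proof.
have wj := jap_gt0 j; have wl := jap_gt0 l.
have h0 : 0 <= w j + w l - w (j + l) by rewrite subr_ge0 jap_triangle.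
have h1 : w j + w l - w (j + l) <= 2 * w l.
  suff : w j <= w (j + l) + w l by lra.
  by have := jap_triangle (j + l) (- l); rewrite japN addrK.
have h2 : w j + w l - w (j + l) <= 2 * w j.
  suff : w l <= w (j + l) + w j by lra.
  by have := jap_triangle (j + l) (- j); rewrite japN addrAC subrr add0r.
by rewrite expr2; nra.
Qed.

Definition linf k : nat := maxn (maxn `|k.1.1|%N `|k.1.2|%N) `|k.2|%N.

Lemma absz_jap (c : int) k : (c%:~R ^+ 2 : R) <= sqnorm3 R k ->
  `|c|%N%:R <= w k.
Proof.
move=> ck; rewrite -(ler_pXn2r (ltn0Sn 1)) ?nnegrE ?jap_ge0//.
rewrite sqr_jap; apply: le_trans (_ : (c%:~R) ^+ 2 <= _).
  by rewrite natr_absz intr_norm real_normK// num_real.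
by apply: le_trans ck _; rewrite lerDl sqr_ge0.
Qed.

Lemma linf_jap k : (linf k)%:R <= w k.
Proof.
have h1 := sqr_ge0 (k.1.1%:~R : R); have h2 := sqr_ge0 (k.1.2%:~R : R).
have h3 := sqr_ge0 (k.2%:~R : R).
by rewrite /linf /maxn; do 2?case: ifP => _; apply: absz_jap; rewrite /sqnorm3; lra.
Qed.

(** A constant below <k> / (1 + |k|), where |k| is the maximum norm. *)
Definition jap_lb : R := Num.min `|m| 1 / 2.

Lemma jap_lb_gt0 : 0 < jap_lb.
Proof. by rewrite divr_gt0// lt_min normr_gt0 m0 ltr01. Qed.

Lemma linf_jap1 k : jap_lb * (1 + (linf k)%:R) <= w k.
Proof.
have h1 := linf_jap k; have h2 := jap_ge_mass k.
have h3 : Num.min `|m| 1 <= `|m| by rewrite ge_min lexx.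
have h4 : Num.min `|m| 1 <= 1 by rewrite ge_min lexx orbT.
have h5 : 0 <= Num.min `|m| 1 by rewrite le_min normr_ge0 ler01.
rewrite /jap_lb; have h6 : 0 <= (linf k)%:R :> R by [].
have h7 : 0 <= (1 - Num.min `|m| 1) * (linf k)%:R by rewrite mulr_ge0// subr_ge0.
by lra.
Qed.

(** The weight <k>^(3/2) of the squared norm of H^(3/4), written with a square
    root. *)
Definition w34 k : R := Num.sqrt (w k) ^+ 3.

Lemma w34_gt0 k : 0 < w34 k.
Proof. by rewrite exprn_gt0// sqrtr_gt0 jap_gt0. Qed.

Lemma w34_ge0 k : 0 <= w34 k. Proof. exact/ltW/w34_gt0. Qed.

Lemma w34N k : w34 (- k) = w34 k. Proof. by rewrite /w34 japN. Qed.

Let h (i : nat) : R := (Num.sqrt (1 + i%:R))^-1.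

Let h_ge0 i : 0 <= h i. Proof. by rewrite invr_ge0 sqrtr_ge0. Qed.

Let hS i : h i.+1 <= h i.
Proof.
rewrite /h lef_pV2 ?posrE ?sqrtr_gt0 ?ltr_wpDr//.
by rewrite ler_wsqrtr// lerD2l ler_nat.
Qed.

Let sum_h r : \sum_(0 <= i < r) h i <= 2 * Num.sqrt r%:R.
Proof.
elim: r => [|r IH]; first by rewrite big_geq// sqrtr0 mulr0.
rewrite big_nat_recr//=; rewrite (le_trans (lerD IH (lexx _)))// /h.
rewrite -[r.+1%:R]natr1 [1 + _]addrC; set a := Num.sqrt r%:R; set b := Num.sqrt _.
have a0 : 0 <= a by exact: sqrtr_ge0.
have b0 : 0 < b by rewrite sqrtr_gt0 ltr_wpDl.
have ab : b ^+ 2 = a ^+ 2 + 1 by rewrite !sqr_sqrtr ?addr_ge0.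
rewrite -(ler_pM2r b0) mulrDl mulVf ?gt_eqF//.
have H : 0 <= (a - b) ^+ 2 by exact: sqr_ge0.
lra.
Qed.

(** The integers of absolute value at most r. *)
Definition ibox r : seq int := [seq Posz i | i <- iota 0 r.+1] ++ [seq Negz i | i <- iota 0 r].

Let ibox_uniq r : uniq (ibox r).
Proof.
rewrite cat_uniq !map_inj_uniq ?iota_uniq//=; first last.
- by move=> ? ? [].
- by move=> ? ? [].
by rewrite andbT; apply/hasPn => x /mapP[i _ ->]; apply/negP => /mapP[].
Qed.

Let mem_ibox r (c : int) : (`|c| <= r)%N -> c \in ibox r.
Proof.
rewrite mem_cat; case: c => n nr; apply/orP; [left|right];
by apply/mapP; exists n; rewrite ?mem_iota ?add0n.
Qed.

Let sum_ibox r : \sum_(c <- ibox r) h `|c|%N <= 4 * Num.sqrt (1 + r%:R).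
Proof.
rewrite big_cat !big_map.
have -> : iota 0 r = index_iota 0 r by rewrite /index_iota subn0.
have -> : iota 0 r.+1 = index_iota 0 r.+1 by rewrite /index_iota subn0.
have s1 := sum_h r.+1; have s2 := sum_h r.
rewrite addrC natr1.
have s3 : \sum_(0 <= i < r) h i.+1 <= \sum_(0 <= i < r) h i by apply: ler_sum.
have s4 : Num.sqrt r%:R <= Num.sqrt r.+1%:R :> R by rewrite ler_wsqrtr// ler_nat.
rewrite (le_trans (lerD s1 s3))//; lra.
Qed.

Let wprod k : (w34 k)^-1 <= (Num.sqrt jap_lb ^+ 3)^-1 *
  (h `|k.1.1|%N * h `|k.1.2|%N * h `|k.2|%N).
Proof.
have c0 := jap_lb_gt0.
have H c : (c <= linf k)%N -> Num.sqrt jap_lb * Num.sqrt (1 + c%:R) <= Num.sqrt (w k).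
  move=> ck; rewrite -sqrtrM ?(ltW c0)// ler_wsqrtr//.
  by apply: le_trans (linf_jap1 k); rewrite ler_pM2l// lerD2l ler_nat.
have P c : 0 < Num.sqrt (1 + c%:R) :> R by rewrite sqrtr_gt0 ltr_wpDr.
have s0 : 0 < Num.sqrt jap_lb by rewrite sqrtr_gt0.
rewrite /h -!invfM lef_pV2 ?posrE ?w34_gt0 ?mulr_gt0 ?exprn_gt0//.
set x := Num.sqrt jap_lb.
have -> : x ^+ 3 * (Num.sqrt (1 + `|k.1.1|%:R) * Num.sqrt (1 + `|k.1.2|%:R) *
   Num.sqrt (1 + `|k.2|%:R)) = (x * Num.sqrt (1 + `|k.1.1|%:R)) *
   ((x * Num.sqrt (1 + `|k.1.2|%:R)) * (x * Num.sqrt (1 + `|k.2|%:R))) by ring.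
have l1 : (`|k.1.1| <= linf k)%N by rewrite /linf !leq_max leqnn.
have l2 : (`|k.1.2| <= linf k)%N by rewrite /linf !leq_max leqnn orbT.
have l3 : (`|k.2| <= linf k)%N by rewrite /linf !leq_max leqnn !orbT.
have p c : 0 <= x * Num.sqrt (1 + c%:R) by rewrite mulr_ge0 ?sqrtr_ge0.
rewrite /w34 !exprS expr0 mulr1; apply: ler_pM => //; first exact: mulr_ge0.
  exact: H.
by apply: ler_pM => //; exact: H.
Qed.

Definition lattice_cst : R := (Num.sqrt jap_lb ^+ 3)^-1 * 64 * (Num.sqrt jap_lb ^+ 3)^-1.

(** The summand is bounded by a product of one dimensional summands
    (1 + i)^(-1/2), each of which sums to the square root of the radius; in
    dimension three this gives the order <l>^(3/2). *)
Lemma lattice_sum (J : seq Z3) l : uniq J -> (forall j, j \in J -> (linf j <= linf l)%N) ->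
  \sum_(j <- J) (w34 j)^-1 <= lattice_cst * w34 l.
Proof.
move=> uJ Jl; set r := linf l in Jl *; set c := (Num.sqrt jap_lb ^+ 3)^-1.
have c0 : 0 < c by rewrite invr_gt0 exprn_gt0// sqrtr_gt0 jap_lb_gt0.
pose f j := c * (h `|j.1.1|%N * h `|j.1.2|%N * h `|j.2|%N).
pose B := [seq (ab, d) | ab <- [seq (a, b) | a <- ibox r, b <- ibox r], d <- ibox r].
apply: (@le_trans _ _ (\sum_(j <- B) f j)).
  apply: le_trans (_ : \sum_(j <- J) f j <= _); first by apply: ler_sum => j _; exact: wprod.
  apply: ler_sum_uniq_sub => //.
  - by rewrite /B !allpairs_uniq ?ibox_uniq// => -[? ?] [? ?] _ _ [] -> ->.
  - move=> [[a b] d] /Jl; rewrite /linf !geq_max/= => /andP[/andP[ar br] dr].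
    by apply: allpairs_f; [apply: allpairs_f|]; exact: mem_ibox.
  - by move=> j; rewrite !mulr_ge0 ?(ltW c0).
rewrite /B big_allpairs_dep big_allpairs_dep/=.
set S := \sum_(i <- ibox r) h `|i|%N.
have -> : \sum_(i <- ibox r) \sum_(i0 <- ibox r) \sum_(j <- ibox r) f (i, i0, j)
  = c * S ^+ 3.
  rewrite /f /=; under eq_bigr do under eq_bigr do rewrite -!mulr_sumr.
  under eq_bigr do rewrite -mulr_sumr -mulr_suml -mulr_sumr.
  by rewrite -mulr_sumr -!mulr_suml !exprS expr0 mulr1 -/S; ring.
have S0 : 0 <= S by apply: sumr_ge0 => i _.
have sS : S <= 4 * Num.sqrt (1 + r%:R) := sum_ibox r.
rewrite /lattice_cst -/c -!mulrA ler_pM2l//.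
apply: (@le_trans _ _ ((4 * Num.sqrt (1 + r%:R)) ^+ 3)); first by rewrite lerXn2r ?nnegrE// mulr_ge0 ?sqrtr_ge0.
rewrite exprMn; have -> : 4 ^+ 3 = 64 :> R by ring.
rewrite ler_pM2l// -ler_pdivrMl ?invr_gt0 ?exprn_gt0 ?sqrtr_gt0 ?jap_lb_gt0//.
rewrite invrK -exprMn lerXn2r ?nnegrE ?mulr_ge0 ?sqrtr_ge0//.
rewrite -sqrtrM; last exact/ltW/jap_lb_gt0.
by rewrite ler_wsqrtr// linf_jap1.
Qed.

End Symbol.

(** * Convolution estimates *)

Section Convolution.
Context {R : realType} (m : R).
Hypothesis m0 : m != 0.
Implicit Types (a b : Z3 -> R[i]) (mu : Z3 -> Z3 -> R[i]) (A B c : R) (J K : seq Z3).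

Local Notation w34 := (w34 m).

(** The half of the product estimate where the first factor has the lower
    frequency. The sum over the lower frequency of the inverse weight is of the
    order of the weight of the higher frequency. *)
Lemma l2_low_high a b A B J K : uniq J -> uniq K ->
  l2_le w34 a A -> l2_le w34 b B ->
  \sum_(k <- K) (\sum_(j <- J | (linf j <= linf (k - j)%R)%N)
     normc (a j) * normc (b (k - j))) ^+ 2 <= lattice_cst m * (A * B) ^+ 2.
Proof.
move=> uJ uK [A0 aA] [B0 bB].
have w0 := w34_gt0 m0.
have c0 : 0 <= lattice_cst m.
  by rewrite !mulr_ge0 ?invr_ge0 ?exprn_ge0 ?sqrtr_ge0.
pose g j l := (linf j <= linf l)%:R * (normc (b l) ^+ 2 * (w34 j)^-1).
have g0 j l : 0 <= g j l.
  by apply: mulr_ge0 => //; apply: mulr_ge0; rewrite ?sqr_ge0 // invr_ge0 ltW.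
(* Cauchy-Schwarz, with the whole weight on the lower frequency *)
have CS k : (\sum_(j <- J | (linf j <= linf (k - j)%R)%N)
     normc (a j) * normc (b (k - j))) ^+ 2 <= A ^+ 2 * \sum_(j <- J) g j (k - j).
  rewrite big_mkcond/=.
  have -> : \sum_(j <- J) (if (linf j <= linf (k - j)%R)%N then
     normc (a j) * normc (b (k - j)) else 0) =
    \sum_(j <- J) (Num.sqrt (w34 j) * normc (a j)) *
      ((linf j <= linf (k - j)%R)%:R * (normc (b (k - j)) * (Num.sqrt (w34 j))^-1)).
    apply: eq_bigr => j _; case: ifP => _; rewrite ?mul0r ?mulr0// mul1r.
    by field; rewrite gt_eqF// sqrtr_gt0.
  apply: le_trans (sum_CauchySchwarz _ _ _) _; apply: ler_pM.
  - by apply: sumr_ge0 => j _; exact: sqr_ge0.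
  - by apply: sumr_ge0 => j _; exact: sqr_ge0.
  - by under eq_bigr => j _ do rewrite exprMn sqr_sqrtr ?(ltW (w0 _))//; exact: aA.
  - apply: ler_sum => j _; rewrite /g !exprMn exprVn sqr_sqrtr ?(ltW (w0 _))//.
    by case: (_ <= _)%N; rewrite ?expr1n// expr0n.
apply: (@le_trans _ _ (\sum_(k <- K) A ^+ 2 * \sum_(j <- J) g j (k - j))).
  by apply: ler_sum => k _; exact: CS.
rewrite -mulr_sumr exprMn mulrCA ler_wpM2l ?sqr_ge0// exchange_big/=.
pose L := undup [seq k - j | k <- K, j <- J].
apply: (@le_trans _ _ (\sum_(j <- J) \sum_(l <- L) g j l)).
  rewrite !big_seq; apply: ler_sum => j jJ.
  have -> : \sum_(k <- K) g j (k - j) = \sum_(l <- [seq k - j | k <- K]) g j l by rewrite big_map.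
  apply: ler_sum_uniq_sub; rewrite ?undup_uniq ?map_inj_uniq//; first exact: addIr.
  by move=> l /mapP[k kK ->]; rewrite mem_undup; apply: allpairs_f.
rewrite exchange_big/=; apply: (@le_trans _ _ (\sum_(l <- L)
   lattice_cst m * (w34 l * normc (b l) ^+ 2))); last first.
  by rewrite -mulr_sumr ler_wpM2l// bB// undup_uniq.
apply: ler_sum => l _; rewrite /g.
under eq_bigr do rewrite mulrCA; rewrite -mulr_sumr mulrA [leRHS]mulrC.
rewrite ler_wpM2l ?sqr_ge0//.
have -> : \sum_(j <- J) (linf j <= linf l)%:R * (w34 j)^-1 =
   \sum_(j <- [seq j <- J | (linf j <= linf l)%N]) (w34 j)^-1.
  rewrite big_filter [RHS]big_mkcond/=; apply: eq_bigr => j _.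
  by case: (_ <= _)%N; rewrite ?mul1r ?mul0r.
apply: lattice_sum => //; first by rewrite filter_uniq.
by move=> j; rewrite mem_filter => /andP[].
Qed.

Definition bil_cst : R := 2 * Num.sqrt (lattice_cst m).

Lemma lattice_cst_ge0 : 0 <= lattice_cst m.
Proof. by rewrite !mulr_ge0 ?invr_ge0 ?exprn_ge0 ?sqrtr_ge0. Qed.

Lemma bil_cst_ge0 : 0 <= bil_cst. Proof. by rewrite mulr_ge0 ?sqrtr_ge0. Qed.

(** The product estimate H^(3/4) x H^(3/4) -> L^2 on Fourier coefficients. The
    exponent is the endpoint one: a plain Cauchy-Schwarz inequality would lose a
    logarithm, so the pairs are first split according to which frequency is
    lower. *)
Lemma l2_conv_fin a b A B J K : uniq J -> uniq K ->
  l2_le w34 a A -> l2_le w34 b B ->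
  \sum_(k <- K) (\sum_(j <- J) normc (a j) * normc (b (k - j))) ^+ 2
    <= (bil_cst * (A * B)) ^+ 2.
Proof.
move=> uJ uK aA bB.
pose L := undup [seq k - j | k <- K, j <- J].
have H1 := l2_low_high uJ uK aA bB.
have H2 := @l2_low_high b a B A L K (undup_uniq _) uK bB aA.
rewrite /bil_cst !exprMn sqr_sqrtr ?lattice_cst_ge0//.
apply: (@le_trans _ _ (\sum_(k <- K)
  (2 * (\sum_(j <- J | (linf j <= linf (k - j)%R)%N)
     normc (a j) * normc (b (k - j))) ^+ 2 +
   2 * (\sum_(l <- L | (linf l <= linf (k - l)%R)%N)
     normc (b l) * normc (a (k - l))) ^+ 2))); last first.
  by rewrite big_split/= -!mulr_sumr -!exprMn; rewrite [B * A]mulrC in H2; lra.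
rewrite !big_seq; apply: ler_sum => k kK.
rewrite (bigID (fun j => (linf j <= linf (k - j)%R)%N))/=.
set S1 := \sum_(j <- J | _) _; set S2 := \sum_(j <- J | _) _.
set S3 := \sum_(l <- L | _) _.
have nn u v : 0 <= normc (a u) * normc (b v) by rewrite mulr_ge0 ?normc_ge0.
have S20 : 0 <= S2 by apply: sumr_ge0.
have S23 : S2 <= S3.
  rewrite /S2 /S3.
  have -> : \sum_(j <- J | ~~ (linf j <= linf (k - j)%R)%N) normc (a j) * normc (b (k - j)) =
     \sum_(l <- [seq k - j | j <- J] | (linf l < linf (k - l)%R)%N) normc (b l) * normc (a (k - l)).
    rewrite big_map; apply: eq_big => j; rewrite subKr; first by rewrite ltnNge.
    by rewrite mulrC.
  apply: (@le_trans _ _ (\sum_(l <- [seq k - j | j <- J] | (linf l <= linf (k - l)%R)%N)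
     normc (b l) * normc (a (k - l)))).
    rewrite big_mkcond [leRHS]big_mkcond/=; apply: ler_sum => l _.
    case: ltnP => [/ltnW -> //|_]; case: ifP => // _.
    by rewrite mulr_ge0 ?normc_ge0.
  rewrite -big_filter -[leRHS]big_filter; apply: ler_sum_uniq_sub.
  - rewrite filter_uniq// map_inj_uniq//; exact: subrI.
  - by rewrite filter_uniq// undup_uniq.
  - move=> l; rewrite !mem_filter => /andP[-> /mapP[j jJ ->]].
    by rewrite mem_undup; apply: allpairs_f.
  - by move=> l; rewrite mulr_ge0 ?normc_ge0.
have : S2 ^+ 2 <= S3 ^+ 2 by rewrite lerXn2r ?nnegrE// (le_trans S20).
by have := sqr_ge0 (S1 - S2); lra.
Qed.

(** The bilinear Fourier multiplier with symbol mu, on coefficients; mu = 1 is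
    the convolution, that is the product of functions. *)
Definition fconv mu a b k := csum (fun j => mu j (k - j) * (a j * b (k - j))).

Lemma conv_absum mu a b A B c k : l2_le w34 a A -> l2_le w34 b B ->
  (forall j l, normc (mu j l) <= c) ->
  absum (fun j => mu j (k - j) * (a j * b (k - j))) (c * (bil_cst * (A * B))).
Proof.
move=> aA bB muc J uJ; have c0 : 0 <= c by apply: le_trans (muc 0 0); exact: normc_ge0.
have AB0 : 0 <= bil_cst * (A * B) by rewrite !mulr_ge0 ?bil_cst_ge0 ?(l2_le_ge0 aA) ?(l2_le_ge0 bB).
apply: (@le_trans _ _ (c * \sum_(j <- J) normc (a j) * normc (b (k - j)))).
  rewrite mulr_sumr; apply: ler_sum => j _; rewrite !Normc.normcM.
  by rewrite ler_wpM2r ?mulr_ge0 ?normc_ge0.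
rewrite ler_wpM2l//.
have S0 : 0 <= \sum_(j <- J) normc (a j) * normc (b (k - j)).
  by apply: sumr_ge0 => j _; rewrite mulr_ge0 ?normc_ge0.
rewrite -(ler_pXn2r (ltn0Sn 1)) ?nnegrE//.
by have := @l2_conv_fin a b A B J [:: k] uJ isT aA bB; rewrite big_seq1.
Qed.

Lemma conv_bound mu a b A B c : l2_le w34 a A -> l2_le w34 b B ->
  (forall j l, normc (mu j l) <= c) ->
  l2_le (fun=> 1) (fconv mu a b) (c * (bil_cst * (A * B))).
Proof.
move=> aA bB muc; have c0 : 0 <= c by apply: le_trans (muc 0 0); exact: normc_ge0.
have AB0 : 0 <= bil_cst * (A * B) by rewrite !mulr_ge0 ?bil_cst_ge0 ?(l2_le_ge0 aA) ?(l2_le_ge0 bB).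
split; first exact: mulr_ge0.
move=> K uK; apply: (@l2_csum _ _ _ _ (fun=> 1)
  (fun k j => mu j (k - j) * (a j * b (k - j)))) => //.
  by move=> k; exists (c * (bil_cst * (A * B))); exact: conv_absum.
move=> J uJ.
apply: (@le_trans _ _ (\sum_(k <- K) c ^+ 2 *
   (\sum_(j <- J) normc (a j) * normc (b (k - j))) ^+ 2)); last first.
  rewrite -mulr_sumr [leRHS]exprMn ler_wpM2l ?sqr_ge0//.
  exact: (l2_conv_fin uJ uK aA bB).
apply: ler_sum => k _; rewrite mul1r -exprMn.
have le : \sum_(j <- J) normc (mu j (k - j) * (a j * b (k - j))) <=
    c * \sum_(j <- J) normc (a j) * normc (b (k - j)).
  rewrite mulr_sumr; apply: ler_sum => j _; rewrite !Normc.normcM.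
  by rewrite ler_wpM2r ?mulr_ge0 ?normc_ge0.
have h0 : 0 <= \sum_(j <- J) normc (mu j (k - j) * (a j * b (k - j))).
  by apply: sumr_ge0 => j _; exact: normc_ge0.
by rewrite lerXn2r ?nnegrE ?(le_trans h0 le).
Qed.

Lemma convDl mu a a' b A A' B c k :
  l2_le w34 a A -> l2_le w34 a' A' -> l2_le w34 b B -> (forall j l, normc (mu j l) <= c) ->
  fconv mu (fun k => a k + a' k) b k = fconv mu a b k + fconv mu a' b k.
Proof.
move=> aA aA' bB muc; rewrite /fconv -(csumD (conv_absum k aA bB muc) (conv_absum k aA' bB muc)).
by apply: csum_ext => j; rewrite mulrDl mulrDr.
Qed.

Lemma convDr mu a b b' A B B' c k :
  l2_le w34 a A -> l2_le w34 b B -> l2_le w34 b' B' -> (forall j l, normc (mu j l) <= c) ->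
  fconv mu a (fun k => b k + b' k) k = fconv mu a b k + fconv mu a b' k.
Proof.
move=> aA bB bB' muc; rewrite /fconv -(csumD (conv_absum k aA bB muc) (conv_absum k aA bB' muc)).
by apply: csum_ext => j; rewrite !mulrDr.
Qed.

Lemma convZ mu d a b A B c k :
  l2_le w34 a A -> l2_le w34 b B -> (forall j l, normc (mu j l) <= c) ->
  fconv (fun j l => d * mu j l) a b k = d * fconv mu a b k.
Proof.
move=> aA bB muc; rewrite /fconv -(csumZ d (conv_absum k aA bB muc)).
by apply: csum_ext => j; rewrite -mulrA.
Qed.

Lemma convDm mu mu' a b A B c c' k :
  l2_le w34 a A -> l2_le w34 b B -> (forall j l, normc (mu j l) <= c) ->
  (forall j l, normc (mu' j l) <= c') ->
  fconv (fun j l => mu j l + mu' j l) a b k = fconv mu a b k + fconv mu' a b k.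
Proof.
move=> aA bB muc muc'; rewrite /fconv -(csumD (conv_absum k aA bB muc) (conv_absum k aA bB muc')).
by apply: csum_ext => j; rewrite mulrDl.
Qed.

End Convolution.

(** * Derivatives of complex valued functions, phi-functions *)

Section ComplexDerivative.
Context {R : realType}.

(** Complex valued functions of a real variable are differentiated through their
    real and imaginary parts. *)
Definition cder (f : R -> R[i]) (s : R) (d : R[i]) : Prop :=
  is_derive s (1 : R) (fun r => Re (f r)) (Re d) /\
  is_derive s (1 : R) (fun r => Im (f r)) (Im d).

(** A function with a quadratic Taylor remainder is differentiable. All curves
    of multipliers below are differentiated in this way, because a remainder
    bound can be summed over frequencies. *)
Lemma is_derive_quad (f : R -> R) (x a C : R) :
  (forall z, `|f z - f x - (z - x) * a| <= C * (z - x) ^+ 2) ->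
  is_derive x (1 : R) f a.
Proof.
move=> H; apply/is_derive1_caratheodory.
exists (fun z => if z == x then a else (f z - f x) / (z - x)); split.
- move=> z; case: eqP => [->|/eqP zx]; first by rewrite !subrr mulr0.
  by rewrite -mulrA mulVf ?mulr1// subr_eq0.
- apply/cvgrPdist_le => e e0; rewrite eqxx.
  have C0 : 0 < `|C| + 1 by rewrite ltr_wpDl.
  near=> z; case: eqP => [_|/eqP zx]; first by rewrite subrr normr0 ltW.
  have zx0 : z - x != 0 by rewrite subr_eq0.
  have -> : a - (f z - f x) / (z - x) = - ((f z - f x - (z - x) * a) / (z - x)) by field.
  rewrite normrN normrM normfV ler_pdivrMr ?normr_gt0//.
  apply: (le_trans (H z)); apply: (@le_trans _ _ ((`|C| + 1) * `|z - x| ^+ 2)).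
    rewrite real_normK ?num_real// ler_wpM2r ?sqr_ge0//.
    by rewrite (le_trans (ler_norm _))// lerDl.
  rewrite expr2 mulrA ler_wpM2r// -ler_pdivlMl// distrC mulrC.
  near: z; apply: (@cvgr_dist_le _ _ _ _ _ (fun z : R => z)); first exact: cvg_id.
  by rewrite divr_gt0.
- by rewrite eqxx.
Unshelve. all: by end_near. Qed.

Lemma cder_quad (f : R -> R[i]) (s : R) (d : R[i]) (C : R) :
  (forall h, normc (f (s + h) - f s - h%:C * d) <= C * h ^+ 2) -> cder f s d.
Proof.
move=> H; split; apply: (@is_derive_quad _ _ _ C) => z.
  have := H (z - s); rewrite subrKC; apply: le_trans.
  apply: le_trans (Re_le_normc _).
  by rewrite !(cReD, cReN) cReM /= mul0r subr0.
have := H (z - s); rewrite subrKC; apply: le_trans.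
apply: le_trans (Im_le_normc _).
by rewrite !(cImD, cImN) cImM /= mul0r addr0.
Qed.

Lemma is_derive_eqf (f g : R -> R) (x a b : R) : f =1 g -> a = b ->
  is_derive x (1 : R) f a -> is_derive x (1 : R) g b.
Proof. by move=> /funext -> ->. Qed.

Lemma cderD f g s d e : cder f s d -> cder g s e ->
  cder (fun r => f r + g r) s (d + e).
Proof.
move=> [f1 f2] [g1 g2]; split.
  by apply: (is_derive_eqf _ _ (is_deriveD f1 g1)) => [r|]; rewrite cReD.
by apply: (is_derive_eqf _ _ (is_deriveD f2 g2)) => [r|]; rewrite cImD.
Qed.

Lemma cderM f g s d e : cder f s d -> cder g s e ->
  cder (fun r => f r * g r) s (d * g s + f s * e).
Proof.
move=> [f1 f2] [g1 g2]; split.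
  apply: (is_derive_eqf _ _ (is_deriveB (is_deriveM f1 g1) (is_deriveM f2 g2))) => [r|].
    by rewrite cReM.
  by rewrite cReD !cReM /GRing.scale/=; ring.
apply: (is_derive_eqf _ _ (is_deriveD (is_deriveM f1 g2) (is_deriveM f2 g1))) => [r|].
  by rewrite cImM.
by rewrite cImD !cImM /GRing.scale/=; ring.
Qed.

Lemma cder_cst (c : R[i]) s : cder (fun=> c) s 0.
Proof. by split; exact: is_derive_cst. Qed.

Lemma cderZ f s d (c : R[i]) : cder f s d -> cder (fun r => c * f r) s (c * d).
Proof. by move=> fd; have := cderM (cder_cst c s) fd; rewrite mul0r add0r. Qed.

Lemma cderB f g s d e : cder f s d -> cder g s e ->
  cder (fun r => f r - g r) s (d - e).
Proof.
move=> fd ge; have := cderD fd (cderZ (-1) ge); rewrite mulN1r.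
by congr (cder _ _ _); apply/funext => r; rewrite mulN1r.
Qed.

Lemma cder_ext f g s d : f =1 g -> cder f s d -> cder g s d.
Proof. by move=> /funext ->. Qed.

Lemma cder_shift f t s d : cder f (t + s) d -> cder (fun r => f (t + r)) s d.
Proof.
have sh : is_derive s (1 : R) (fun r => t + r) (1 : R).
  by apply: (is_derive_eqf _ _ (is_deriveD (is_derive_cst t s 1) (is_derive_id s 1))) => //;
    rewrite add0r.
move=> [f1 f2]; split.
  by apply: (is_derive_eqf _ _ (is_derive1_comp f1 sh)) => //; rewrite mulr1.
by apply: (is_derive_eqf _ _ (is_derive1_comp f2 sh)) => //; rewrite mulr1.
Qed.

Definition ccont (T : R) (f : R -> R[i]) : Prop :=
  {within `[0, T], continuous (fun r => Re (f r))} /\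
  {within `[0, T], continuous (fun r => Im (f r))}.

Lemma is_derive_bigsum (I : Type) (K : seq I) (f : I -> R -> R) (d : I -> R) s :
  (forall k, is_derive s (1 : R) (f k) (d k)) ->
  is_derive s (1 : R) (fun r => \sum_(k <- K) f k r) (\sum_(k <- K) d k).
Proof.
move=> H; elim: K => [|a K IH].
  by apply: (is_derive_eqf _ _ (is_derive_cst 0 s 1)) => [r|]; rewrite big_nil.
by apply: (is_derive_eqf _ _ (is_deriveD (H a) IH)) => [r|]; rewrite big_cons.
Qed.

Lemma continuous_bigsum (I : Type) (K : seq I) (f : I -> R -> R) T :
  (forall k, {within `[0, T], continuous (f k)}) ->
  {within `[0, T], continuous (fun r => \sum_(k <- K) f k r)}.
Proof.
move=> H; elim: K => [|a K IH].
  have -> : (fun r => \sum_(k <- [::]) f k r) = fun=> 0.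
    by apply/funext => r; rewrite big_nil.
  by move=> x; exact: cvg_cst.
have -> : (fun r => \sum_(k <- a :: K) f k r) = fun r => f a r + \sum_(k <- K) f k r.
  by apply/funext => r; rewrite big_cons.
by move=> x; apply: cvgD; [exact: H|exact: IH].
Qed.

(** The mean value inequality in a weighted l2 space. The scalar mean value
    theorem is applied to the pairing of g with its own increment. *)
Lemma l2_mvt (T : countType) (w : T -> R) (g g' : R -> T -> R[i]) (tau D : R) :
  (forall k, 0 <= w k) -> 0 <= tau -> 0 <= D ->
  (forall k, ccont tau (fun s => g s k)) ->
  (forall s k, 0 < s < tau -> cder (fun r => g r k) s (g' s k)) ->
  (forall s, 0 < s < tau -> l2_le w (g' s) D) ->
  l2_le w (fun k => g tau k - g 0 k) (tau * D).
Proof.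
move=> w0 tau0 D0 gc gd gD; split=> [|K uK]; first exact: mulr_ge0.
have [tau_gt0|] := ltP 0 tau; last first.
  move=> tn; have -> : tau = 0 by apply/le_anti; rewrite tn.
  rewrite big1 ?mul0r ?sqr_ge0// => k _.
  by rewrite subrr Normc.normc0 expr0n mulr0.
pose c k := g tau k - g 0 k.
pose phi s := \sum_(k <- K) w k * (Re (c k) * Re (g s k) + Im (c k) * Im (g s k)).
pose dphi s := \sum_(k <- K) w k * (Re (c k) * Re (g' s k) + Im (c k) * Im (g' s k)).
set X := \sum_(k <- K) _.
have X0 : 0 <= X by apply: sumr_ge0 => k _; rewrite mulr_ge0 ?sqr_ge0.
have phiX : phi tau - phi 0 = X.
  rewrite /phi /X -sumrB; apply: eq_bigr => k _.
  have rc : Re (c k) = Re (g tau k) - Re (g 0 k) by rewrite cReD cReN.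
  have ic : Im (c k) = Im (g tau k) - Im (g 0 k) by rewrite cImD cImN.
  by rewrite -/(c k) normc_sqrE rc ic; ring.
have [|s + |s s0 E] := @MVT R phi dphi 0 tau tau_gt0.
- move=> s; rewrite in_itv/= => s0; apply: is_derive_bigsum => k.
  have [r1 i1] := gd s k s0.
  have := is_deriveZ (w k) (is_deriveD (is_deriveZ (Re (c k)) r1) (is_deriveZ (Im (c k)) i1)).
  by apply: is_derive_eqf.
- move: s; apply: continuous_bigsum => k x; have [r1 i1] := gc k.
  apply: cvgM; first exact: cvg_cst.
  by apply: cvgD; apply: cvgM; try exact: cvg_cst; [exact: r1|exact: i1].
move: s0; rewrite in_itv/= => s0.
rewrite phiX subr0 in E.
have le : dphi s <= \sum_(k <- K) w k * (normc (c k) * normc (g' s k)).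
  apply: ler_sum => k _; rewrite ler_wpM2l// -normc_conj -Normc.normcM.
  apply: le_trans (Re_le_normc _); apply: le_trans (ler_norm _).
  by rewrite cReM cRe_conj cIm_conj mulNr opprK.
have [_ gDK] := gD s s0.
have cs : (\sum_(k <- K) w k * (normc (c k) * normc (g' s k))) ^+ 2 <= X * D ^+ 2.
  under eq_bigr => k _ do rewrite -[w k]sqr_sqrtr// expr2 mulrACA.
  apply: le_trans (sum_CauchySchwarz _ _ _) _.
  under eq_bigr => k _ do rewrite exprMn sqr_sqrtr//.
  rewrite -/X ler_wpM2l//.
  by under eq_bigr => k _ do rewrite exprMn sqr_sqrtr//; exact: gDK.
have [Xp|] := ltP 0 X; last by move=> ?; apply: le_trans (sqr_ge0 _).
have S0 : 0 <= \sum_(k <- K) w k * (normc (c k) * normc (g' s k)).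
  by apply: sumr_ge0 => k _; rewrite !mulr_ge0 ?normc_ge0.
have h : X ^+ 2 <= tau ^+ 2 * (X * D ^+ 2).
  apply: (@le_trans _ _ (((\sum_(k <- K) w k * (normc (c k) * normc (g' s k))) * tau) ^+ 2)).
    rewrite lerXn2r ?nnegrE ?mulr_ge0//.
    by rewrite E ler_wpM2r.
  by rewrite exprMn mulrC ler_wpM2l ?sqr_ge0.
rewrite -(ler_pM2l Xp) -expr2; apply: le_trans h _.
by rewrite exprMn mulrCA.
Qed.

(** Termwise differentiation: the quadratic remainders are summable. *)
Lemma cder_csum (T : countType) (F : R -> T -> R[i]) (F' W : T -> R[i]) s M N :
  (forall r, exists B, absum (F r) B) -> absum F' N -> absum W M ->
  (forall h j, normc (F (s + h) j - F s j - h%:C * F' j) <= h ^+ 2 * normc (W j)) ->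
  cder (fun r => csum (F r)) s (csum F').
Proof.
move=> FB F'N WM H; apply: (@cder_quad _ _ _ M) => h.
have [B1 FB1] := FB (s + h); have [B2 FB2] := FB s.
have A2 := absumZ (-1) FB2; have A3 := absumZ (- h%:C) F'N.
have -> : csum (F (s + h)) - csum (F s) - h%:C * csum F' =
  csum (fun j => (F (s + h) j + (-1) * F s j) + - h%:C * F' j).
  rewrite (csumD (absumD FB1 A2) A3) (csumD FB1 A2) (csumZ _ FB2) (csumZ _ F'N).
  by rewrite mulN1r mulNr.
have -> : M * h ^+ 2 = normc (h ^+ 2)%:C * M.
  by rewrite normcR ger0_norm ?sqr_ge0// mulrC.
apply: csum_le; apply: (absum_le (absumZ (h ^+ 2)%:C WM)) => j.
rewrite Normc.normcM normcR ger0_norm ?sqr_ge0//.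
by have := H h j; rewrite mulN1r mulNr.
Qed.

End ComplexDerivative.

Section UnitCircle.
Context {R : realType}.
Implicit Types x y A s h : R.

(** The exponential of i x, as the point of the unit circle. *)
Definition cis x : R[i] := cos x +i* sin x.

Lemma expC_im x : expC ('i * x%:C) = cis x.
Proof.
rewrite /expC; have -> : Re ('i * x%:C) = 0 by rewrite /=; ring.
have -> : Im ('i * x%:C) = x by rewrite /=; ring.
by rewrite expR0; apply: complexP => /=; ring.
Qed.

Lemma cis0 : cis 0 = 1.
Proof. by rewrite /cis cos0 sin0. Qed.

Lemma cisD x y : cis (x + y) = cis x * cis y.
Proof. by apply: complexP => /=; rewrite ?cosD ?sinD; ring. Qed.

Lemma cisN x : cis (- x) = conjc (cis x).
Proof. by apply: complexP => /=; rewrite ?cosN ?sinN. Qed.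

Lemma normc_cis x : normc (cis x) = 1.
Proof. by rewrite /= cos2Dsin2 sqrtr1. Qed.

Lemma cis_neq0 x : cis x != 0.
Proof. by rewrite -normc_eq0P normc_cis oner_eq0. Qed.

Lemma cisNV x : cis (- x) = (cis x)^-1.
Proof.
apply: (mulfI (cis_neq0 x)); rewrite -cisD subrr cis0 divff//; exact: cis_neq0.
Qed.

Let mvt_bound (f f' : R -> R) n : f 0 = 0 ->
  (forall x, is_derive x (1 : R) f (f' x)) ->
  (forall x, `|f' x| <= `|x| ^+ n) -> forall x, `|f x| <= `|x| ^+ n.+1.
Proof.
move=> f0 fd fb x.
have cf a b : {within `[a, b], continuous f}.
  apply: derivable_within_continuous => z _.
  exact: (@ex_derive _ _ _ _ _ _ _ (fd z)).
have [x0|x0] := leP 0 x.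
  have [y] := @MVT_segment R f f' 0 x x0 (fun z _ => fd z) (cf 0 x).
  rewrite in_itv/= => /andP[y0 yx]; rewrite f0 !subr0 => ->.
  rewrite normrM exprSr ler_wpM2r// (le_trans (fb y))// lerXn2r ?nnegrE//.
  by rewrite !ger0_norm.
have [y] := @MVT_segment R f f' x 0 (ltW x0) (fun z _ => fd z) (cf x 0).
rewrite in_itv/= => /andP[xy y0]; rewrite f0 !sub0r => /eqP.
rewrite eqr_oppLR => /eqP ->.
rewrite normrN normrM normrN exprSr ler_wpM2r// (le_trans (fb y))// lerXn2r ?nnegrE//.
by rewrite !ler0_norm ?lerN2// ltW.
Qed.

Let sin_bound x : `|sin x| <= `|x|.
Proof.
have := @mvt_bound sin cos 0 (sin0 _) (@is_derive_sin R) _ x; rewrite expr1; apply.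
by move=> y; rewrite expr0 ler_norml cos_geN1 cos_le1.
Qed.

Let cosB1_bound n x : (forall y, `|sin y| <= `|y| ^+ n) -> `|cos x - 1| <= `|x| ^+ n.+1.
Proof.
move=> sb; apply: (@mvt_bound (fun x => cos x - 1) (fun x => - sin x) n).
- by rewrite cos0 subrr.
- move=> y; have := is_deriveB (is_derive_cos y) (is_derive_cst (1 : R) y 1).
  by apply: is_derive_eqf; rewrite ?subr0.
- by move=> y; rewrite normrN.
Qed.

Lemma cisB1_bound x : normc (cis x - 1) <= 2 * `|x|.
Proof.
apply: le_trans (normc_le_ReIm _) _; rewrite /= subr0 mulr_natl mulr2n lerD//.
have := @cosB1_bound 0 x; rewrite expr1; apply.
by move=> y; rewrite expr0 ler_norml sin_geN1 sin_le1.
Qed.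

(** The second order Taylor bound behind every estimate of consistency below. *)
Lemma cisB1i_bound x : normc (cis x - 1 - 'i * x%:C) <= 2 * x ^+ 2.
Proof.
have -> : x ^+ 2 = `|x| ^+ 2 by rewrite real_normK// num_real.
apply: le_trans (normc_le_ReIm _) _; rewrite mulr_natl mulr2n.
have -> : Re (cis x - 1 - 'i * x%:C) = cos x - 1.
  by rewrite !(cReD, cReN) cReM /=; ring.
have -> : Im (cis x - 1 - 'i * x%:C) = sin x - x.
  by rewrite !(cImD, cImN) cImM /=; ring.
rewrite lerD//; first by apply: cosB1_bound => y; rewrite expr1 sin_bound.
apply: (@mvt_bound (fun x => sin x - x) (fun x => cos x - 1) 1).
- by rewrite sin0 subrr.
- move=> y; have := @cosB1_bound 0 y; rewrite expr1; apply.
  by move=> z; rewrite expr0 ler_norml sin_geN1 sin_le1.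
Qed.

Lemma cder_cis A s : cder (fun r => cis (r * A)) s ('i * A%:C * cis (s * A)).
Proof.
apply: (@cder_quad _ _ _ _ (2 * A ^+ 2)) => h; rewrite mulrDl cisD.
have -> : cis (s * A) * cis (h * A) - cis (s * A) - h%:C * ('i * A%:C * cis (s * A)) =
  cis (s * A) * (cis (h * A) - 1 - 'i * (h * A)%:C) by rewrite rmorphM/=; ring.
by rewrite Normc.normcM normc_cis mul1r -mulrA -exprMn [A * h]mulrC cisB1i_bound.
Qed.

(** Antiderivatives of r |-> exp(i r A) and of r |-> r exp(i r A) that vanish
    at 0; these are s phi1(i s A) and s^2 phi2(i s A). *)
Definition prim1 A s : R[i] := (cis (s * A) - 1) / ('i * A%:C).
Definition prim2 A s : R[i] := (s%:C * cis (s * A) - prim1 A s) / ('i * A%:C).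

Let iA_neq0 A : A != 0 -> 'i * A%:C != 0.
Proof.
move=> A0; rewrite -normc_eq0P Normc.normcM normci mul1r normcR normr_eq0//.
Qed.

Let normc_iA A : normc ('i * A%:C) = `|A|.
Proof. by rewrite Normc.normcM normci mul1r normcR. Qed.

Lemma prim10 A : prim1 A 0 = 0.
Proof. by rewrite /prim1 mul0r cis0 subrr mul0r. Qed.

Lemma prim20 A : prim2 A 0 = 0.
Proof. by rewrite /prim2 prim10 mul0r subr0 mul0r. Qed.

Lemma prim1_quad A s h : A != 0 ->
  normc (prim1 A (s + h) - prim1 A s - h%:C * cis (s * A)) <= h ^+ 2 * (2 * `|A|).
Proof.
move=> A0; have := iA_neq0 A0; rewrite mulf_eq0 negb_or => /andP[i0 AC].
have -> : prim1 A (s + h) - prim1 A s - h%:C * cis (s * A) =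
   cis (s * A) * ((cis (h * A) - 1 - 'i * (h * A)%:C) / ('i * A%:C)).
  by rewrite /prim1 [(s + h) * A]mulrDl cisD rmorphM/=; field; rewrite AC i0.
rewrite Normc.normcM normc_cis mul1r Normc.normcM Normc.normcV normc_iA.
rewrite ler_pdivrMr ?normr_gt0//; apply: le_trans (cisB1i_bound _) _.
rewrite exprMn -[A ^+ 2]real_normK ?num_real// expr2 -!mulrA.
by rewrite le_eqVlt; apply/orP; left; apply/eqP; ring.
Qed.

Lemma prim2_quad A s h : A != 0 ->
  normc (prim2 A (s + h) - prim2 A s - h%:C * (s%:C * cis (s * A)))
   <= h ^+ 2 * (2 * `|s| * `|A| + 4).
Proof.
move=> A0; have := iA_neq0 A0; rewrite mulf_eq0 negb_or => /andP[i0 AC].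
have -> : prim2 A (s + h) - prim2 A s - h%:C * (s%:C * cis (s * A)) =
   s%:C * (cis (s * A) * ((cis (h * A) - 1 - 'i * (h * A)%:C) / ('i * A%:C))) -
   cis (s * A) * cis (h * A) * ((cis (- (h * A)) - 1 - 'i * (- (h * A))%:C) * - 1
     / ('i * A%:C) ^+ 2).
  rewrite /prim2 /prim1 [(s + h) * A]mulrDl cisD rmorphN cisNV !rmorphD rmorphM/=; field.
  by rewrite cis_neq0 AC i0.
apply: le_trans (ler_normcB _ _) _; rewrite mulrDr; apply: lerD.
  rewrite !Normc.normcM normc_cis mul1r normcR Normc.normcV normc_iA.
  rewrite mulrA ler_pdivrMr ?normr_gt0//.
  apply: le_trans (ler_wpM2l (normr_ge0 _) (cisB1i_bound _)) _.
  rewrite exprMn -[A ^+ 2]real_normK ?num_real// expr2.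
  by rewrite le_eqVlt; apply/orP; left; apply/eqP; ring.
rewrite !Normc.normcM !normc_cis !mul1r normcN Normc.normc1 mulr1.
rewrite Normc.normcV expr2 Normc.normcM normc_iA.
rewrite ler_pdivrMr ?mulr_gt0 ?normr_gt0//; apply: le_trans (cisB1i_bound _) _.
rewrite sqrrN exprMn -[A ^+ 2]real_normK ?num_real// -expr2.
have := sqr_ge0 (h * `|A|); rewrite exprMn; lra.
Qed.

Lemma prim1_phi1 A s : s != 0 -> A != 0 -> prim1 A s = s%:C * phi1 ('i * (s * A)%:C).
Proof.
move=> s0 A0; have iA := iA_neq0 A0; rewrite /phi1 expC_im /prim1 rmorphM/=.
move: iA; rewrite mulf_eq0 negb_or => /andP[i0 AC].
have sC : s%:C != 0 :> R[i] by rewrite -normc_eq0P normcR normr_eq0.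
by field; rewrite sC AC i0.
Qed.

Lemma prim2_phi2 A s : s != 0 -> A != 0 ->
  prim2 A s = s%:C ^+ 2 * phi2 ('i * (s * A)%:C).
Proof.
move=> s0 A0; have iA := iA_neq0 A0; rewrite /phi2 /prim2 prim1_phi1// expC_im.
rewrite (_ : (s * A)%:C = s%:C * A%:C) ?rmorphM//.
have sC : s%:C != 0 :> R[i] by rewrite -normc_eq0P normcR normr_eq0.
move: iA; rewrite mulf_eq0 negb_or => /andP[i0 AC].
by field; rewrite sC AC i0.
Qed.

Lemma phi1_bound x : x != 0 -> normc (phi1 ('i * x%:C)) <= 2.
Proof.
move=> x0; rewrite /phi1 expC_im Normc.normcM Normc.normcV normc_iA.
by rewrite ler_pdivrMr ?normr_gt0// cisB1_bound.
Qed.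

Lemma phi2_bound x : x != 0 -> normc (phi2 ('i * x%:C)) <= 2.
Proof.
move=> x0; have ix := iA_neq0 x0; rewrite /phi2 /phi1 expC_im.
have -> : (cis x - (cis x - 1) / ('i * x%:C)) / ('i * x%:C) =
   cis x * ((cis (- x) - 1 - 'i * (- x)%:C) / ('i * x%:C) ^+ 2).
  move: ix; rewrite mulf_eq0 negb_or => /andP[i0 AC].
  by rewrite cisNV rmorphN/=; field; rewrite cis_neq0 AC i0.
rewrite Normc.normcM normc_cis mul1r Normc.normcM Normc.normcV expr2 Normc.normcM.
rewrite normc_iA ler_pdivrMr ?mulr_gt0 ?normr_gt0//.
apply: le_trans (cisB1i_bound _) _.
by rewrite sqrrN -[x ^+ 2]real_normK ?num_real// expr2.
Qed.

End UnitCircle.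

(** * Quadratic forms on Fourier coefficients *)

Section QuadraticForm.
Context {R : realType} (m : R).
Hypothesis m0 : m != 0.
Implicit Types (a b u v : Z3 -> R[i]) (A B c s : R) (K : seq Z3).

Local Notation w := (jap m).
Local Notation N0 := (l2_le (fun=> 1)).
Local Notation N34 := (l2_le (w34 m)).

Definition w1 k : R := jap m k ^+ 2.
Definition w74 k : R := w34 m k * jap m k ^+ 2.

Local Notation N1 := (l2_le w1).
Local Notation N74 := (l2_le w74).

Lemma w1_ge0 k : 0 <= w1 k. Proof. exact: sqr_ge0. Qed.
Lemma w74_ge0 k : 0 <= w74 k.
Proof. by rewrite mulr_ge0 ?sqr_ge0// w34_ge0. Qed.

(** A constant for all the embeddings between the weighted spaces. The mass m
    may be small, which is why negative powers of m appear. *)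
Definition emb : R := 1 + (Num.sqrt (Num.sqrt `|m|))^-1 + `|m|^-1 + (Num.sqrt (Num.sqrt `|m|) ^+ 3)^-1.

Let q := Num.sqrt (Num.sqrt `|m|).

Let q_gt0 : 0 < q.
Proof. by rewrite !sqrtr_gt0 normr_gt0. Qed.

Lemma emb_ge1 : 1 <= emb.
Proof.
rewrite /emb -!addrA lerDl !addr_ge0 ?invr_ge0 ?exprn_ge0 ?sqrtr_ge0//.
Qed.

Lemma emb_ge0 : 0 <= emb. Proof. exact: le_trans ler01 emb_ge1. Qed.

Lemma emb_m : `|m|^-1 <= emb.
Proof.
have := q_gt0; rewrite -invr_gt0 => h1.
have h2 : 0 < (q ^+ 3)^-1 by rewrite invr_gt0 exprn_gt0.
by rewrite /emb -/q; lra.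
Qed.

Lemma jap_mass k : 1 <= emb * w k.
Proof.
have mp : 0 < `|m| by rewrite normr_gt0.
apply: (@le_trans _ _ (`|m|^-1 * `|m|)); first by rewrite mulVf// gt_eqF.
by apply: ler_pM; rewrite ?invr_ge0 ?emb_m ?jap_ge_mass.
Qed.

(** The quotient of the weights is <k>^(-1/2), and <k> is bounded below by the
    mass. *)
Lemma w34_w1 k : w34 m k <= emb ^+ 2 * w1 k.
Proof.
have wk := jap_gt0 m0 k.
have e : q^-1 <= emb.
  have h1 : 0 <= `|m|^-1 by rewrite invr_ge0.
  have h2 : 0 < (q ^+ 3)^-1 by rewrite invr_gt0 exprn_gt0.
  by rewrite /emb -/q; lra.
have s1 : q ^+ 2 <= Num.sqrt (w k).
  by rewrite sqr_sqrtr ?sqrtr_ge0// ler_wsqrtr// jap_ge_mass.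
have s2 : q ^- 2 <= emb ^+ 2.
  by rewrite -exprVn lerXn2r ?nnegrE ?emb_ge0// invr_ge0 ltW.
have s3 : 1 <= emb ^+ 2 * Num.sqrt (w k).
  apply: (@le_trans _ _ (q ^- 2 * q ^+ 2)); first by rewrite mulVf// expf_neq0// gt_eqF.
  by apply: ler_pM; rewrite ?invr_ge0 ?exprn_ge0 ?(ltW q_gt0).
have -> : w1 k = Num.sqrt (w k) ^+ 4.
  by rewrite /w1 -{1}[w k]sqr_sqrtr ?(ltW wk)// -exprM.
rewrite /w34; set x := Num.sqrt (w k) in s3 *.
have -> : emb ^+ 2 * x ^+ 4 = (emb ^+ 2 * x) * x ^+ 3 by ring.
by rewrite -{1}[x ^+ 3]mul1r ler_wpM2r// exprn_ge0// sqrtr_ge0.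
Qed.

Lemma w1_w74 k : w1 k <= emb ^+ 2 * w74 k.
Proof.
have wk := jap_gt0 m0 k.
have e : (q ^+ 3)^-1 <= emb.
  have h1 : 0 <= `|m|^-1 by rewrite invr_ge0.
  have h2 : 0 < q^-1 by rewrite invr_gt0.
  by rewrite /emb -/q; lra.
have s1 : q ^+ 2 <= Num.sqrt (w k).
  by rewrite sqr_sqrtr ?sqrtr_ge0// ler_wsqrtr// jap_ge_mass.
have s2 : q ^+ 6 <= w34 m k.
  have -> : q ^+ 6 = (q ^+ 2) ^+ 3 by rewrite -exprM.
  by rewrite lerXn2r ?nnegrE ?exprn_ge0 ?sqrtr_ge0// ltW.
have s3 : (q ^+ 6)^-1 <= emb ^+ 2.
  have -> : (q ^+ 6)^-1 = ((q ^+ 3)^-1) ^+ 2 by rewrite exprVn -exprM.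
  by rewrite lerXn2r ?nnegrE ?emb_ge0// invr_ge0 exprn_ge0// ltW.
have s4 : 1 <= emb ^+ 2 * w34 m k.
  apply: (@le_trans _ _ ((q ^+ 6)^-1 * q ^+ 6)); first by rewrite mulVf// expf_neq0// gt_eqF.
  by apply: ler_pM; rewrite ?invr_ge0 ?exprn_ge0 ?(ltW q_gt0).
rewrite /w74 /w1 mulrA; apply: (@le_trans _ _ (1 * w k ^+ 2)); first by rewrite mul1r.
by apply: ler_wpM2r => //; exact: sqr_ge0.
Qed.

Lemma l2_le_34_1 a A : N1 a A -> N34 a (emb * A).
Proof.
apply: l2_le_weight; [exact: emb_ge0|exact: w1_ge0|move=> k].
by rewrite [leRHS]mulrA ler_wpM2r ?sqr_ge0// w34_w1.
Qed.

Lemma l2_le_1_74 a A : N74 a A -> N1 a (emb * A).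
Proof.
apply: l2_le_weight; [exact: emb_ge0|exact: w74_ge0|move=> k].
by rewrite [leRHS]mulrA ler_wpM2r ?sqr_ge0// w1_w74.
Qed.

Lemma l2_le_34_74w a A : N74 a A -> N34 (fun k => (w k)%:C * a k) A.
Proof.
move=> [A0 H]; split=> // K uK; apply: le_trans (H _ uK).
apply: ler_sum => k _; rewrite Normc.normcM normcR ger0_norm ?jap_ge0//.
by rewrite exprMn mulrA.
Qed.

(** The coefficients of the complex conjugate of a function. *)
Definition star a : Z3 -> R[i] := fun k => conjc (a (- k)).

Lemma l2_le_star (wt : Z3 -> R) a A : (forall k, wt (- k) = wt k) -> l2_le wt a A -> l2_le wt (star a) A.
Proof.
move=> wN [A0 H]; split=> // K uK.
have -> : \sum_(k <- K) wt k * normc (star a k) ^+ 2 =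
    \sum_(k <- [seq - k | k <- K]) wt k * normc (a k) ^+ 2.
  by rewrite big_map; apply: eq_bigr => k _; rewrite /star normc_conj wN.
by apply: H; rewrite map_inj_uniq//; exact: oppr_inj.
Qed.

Lemma w1N k : w1 (- k) = w1 k. Proof. by rewrite /w1 japN. Qed.

Lemma starD a b k : star (fun k => a k + b k) k = star a k + star b k.
Proof. by rewrite /star conjcD. Qed.

Lemma starZ (s : R) a k : star (fun k => s%:C * a k) k = s%:C * star a k.
Proof. by rewrite /star conjcM conjc_real. Qed.

Lemma l2_le_34_star a A : N34 a A -> N34 (star a) A.
Proof. by apply: l2_le_star; exact: w34N. Qed.

(** One symbol for each of the products u u, u conj(u) and conj(u) conj(u): the
    booleans tell which factors are conjugated. *)
Definition mult := bool -> bool -> Z3 -> Z3 -> R[i].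
Implicit Type mu nu : mult.

Definition cstm (x : R[i]) : mult := fun _ _ _ _ => x.

Definition bddm mu c := forall x y j l, normc (mu x y j l) <= c.
Definition wbddm mu c := forall x y j l, normc (mu x y j l) <= c * (w j * w l).

(** The polarisation of u^2 + 2 u conj(u) + conj(u)^2 with a multiplier on
    each product. *)
Definition Qm mu a b k : R[i] :=
  fconv (mu false false) a b k + 2 * fconv (mu false true) a (star b) k
  + fconv (mu true true) (star a) (star b) k.

(** The symbol of - (i/4) <nabla>^(-1). *)
Definition beta k : R[i] := - ('i / 4) / (w k)%:C.

Definition quad_form mu a b k : R[i] := beta k * Qm mu a b k.

Lemma normc2 : normc (2 : R[i]) = 2.
Proof. by rewrite -(rmorph_nat (real_complex R)) normcR ger0_norm. Qed.

Lemma normc_beta k : normc (beta k) = 4^-1 / w k.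
Proof.
rewrite /beta !Normc.normcM normcN Normc.normcM normci mul1r !Normc.normcV.
rewrite normcR [`|w k|]ger0_norm ?jap_ge0//; congr (_^-1 * _).
by rewrite -(rmorph_nat (real_complex R)) normcR ger0_norm.
Qed.

Lemma Qm_bound mu a b A B c : N34 a A -> N34 b B -> bddm mu c ->
  N0 (Qm mu a b) (4 * (c * (bil_cst m * (A * B)))).
Proof.
move=> aA bB muc; have sa := l2_le_34_star aA; have sb := l2_le_34_star bB.
have g0 (k : Z3) : 0 <= (1 : R) by [].
have h1 := conv_bound m0 aA bB (muc false false).
have h2 := l2_leZ 2 g0 (conv_bound m0 aA sb (muc false true)).
have h3 := conv_bound m0 sa sb (muc true true).
have := l2_leD g0 (l2_leD g0 h1 h2) h3; rewrite normc2.
by apply: l2_le_monoM; rewrite le_eqVlt; apply/orP; left; apply/eqP; ring.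
Qed.

(** The gain of one derivative by <nabla>^(-1) turns L^2 into H^1. *)
Lemma l2_le_beta a A : N0 a A -> N1 (fun k => beta k * a k) A.
Proof.
move=> [A0 H]; split=> // K uK; apply: le_trans (H _ uK).
apply: ler_sum => k _; rewrite Normc.normcM normc_beta mul1r exprMn.
rewrite mulrA -[leRHS]mul1r ler_wpM2r ?sqr_ge0// /w1 -exprMn.
rewrite mulrCA divff ?mulr1 ?gt_eqF ?jap_gt0//.
by rewrite exprn_ile1// ?invr_ge0// invf_le1//; lra.
Qed.

Definition Tcst : R := 4 * bil_cst m * emb ^+ 2.

Lemma Tcst_ge0 : 0 <= Tcst.
Proof. by rewrite !mulr_ge0 ?bil_cst_ge0 ?emb_ge0. Qed.

(** H^1 is contained in H^(3/4), where the product estimate applies; the operator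
    <nabla>^(-1) then leads back from L^2 to H^1. *)
Lemma Tm_bound mu a b A B c : N1 a A -> N1 b B -> bddm mu c ->
  N1 (quad_form mu a b) (c * (Tcst * (A * B))).
Proof.
move=> aA bB muc.
have := l2_le_beta (Qm_bound (l2_le_34_1 aA) (l2_le_34_1 bB) muc).
by apply: l2_le_monoM; rewrite /Tcst le_eqVlt; apply/orP; left; apply/eqP; ring.
Qed.

Let unw mu : mult := fun x y j l => mu x y j l / (w j * w l)%:C.

Let conv_unw (mu : Z3 -> Z3 -> R[i]) a b k :
  fconv mu a b k = fconv (fun j l => mu j l / (w j * w l)%:C)
    (fun k => (w k)%:C * a k) (fun k => (w k)%:C * b k) k.
Proof.
apply: csum_ext => j; rewrite rmorphM/=.
have n0 i : (w i)%:C != 0 :> R[i].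
  by rewrite -normc_eq0P normcR normr_eq0 gt_eqF// jap_gt0.
by field; rewrite !n0.
Qed.

Let star_w a : star (fun k => (w k)%:C * a k) = fun k => (w k)%:C * star a k.
Proof. by apply/funext => k; rewrite /star conjcM conjc_real japN. Qed.

Let Qm_unw mu a b k : Qm mu a b k =
  Qm (unw mu) (fun k => (w k)%:C * a k) (fun k => (w k)%:C * b k) k.
Proof. by rewrite /Qm !star_w -!conv_unw. Qed.

Let unw_bdd mu c : wbddm mu c -> bddm (unw mu) c.
Proof.
move=> H x y j l; rewrite /unw Normc.normcM Normc.normcV normcR.
have jl : 0 < w j * w l by rewrite mulr_gt0// jap_gt0.
by rewrite ger0_norm ?(ltW jl)// ler_pdivrMr.
Qed.

Lemma Qm_bound_w mu a b A B c : N74 a A -> N74 b B -> wbddm mu c ->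
  N0 (Qm mu a b) (4 * (c * (bil_cst m * (A * B)))).
Proof.
move=> aA bB muc.
apply: (l2_le_ext (fun k => esym (Qm_unw mu a b k))).
exact: Qm_bound (l2_le_34_74w aA) (l2_le_34_74w bB) (unw_bdd muc).
Qed.

(** A symbol may grow like the product of the two input frequencies if the
    factors are in H^(7/4): one derivative moved to each factor leaves
    H^(3/4). *)
Lemma Tm_bound_w mu a b A B c : 0 <= c -> N74 a A -> N74 b B -> wbddm mu c ->
  N1 (quad_form mu a b) (c * (Tcst * (A * B))).
Proof.
move=> c0 aA bB muc; have := l2_le_beta (Qm_bound_w aA bB muc).
apply: l2_le_monoM.
have AB : 0 <= c * (bil_cst m * (A * B)) * 4.
  by rewrite !mulr_ge0 ?bil_cst_ge0 ?(l2_le_ge0 aA) ?(l2_le_ge0 bB).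
have e1 : 1 <= emb ^+ 2 by rewrite exprn_ege1// emb_ge1.
have -> : c * (Tcst * (A * B)) = emb ^+ 2 * (c * (bil_cst m * (A * B)) * 4).
  by rewrite /Tcst; ring.
by rewrite mulrC -{1}[_ * 4]mul1r ler_wpM2r.
Qed.

Lemma absum_w (mu : Z3 -> Z3 -> R[i]) a b A B c k : N74 a A -> N74 b B ->
  (forall j l, normc (mu j l) <= c * (w j * w l)) ->
  exists N, absum (fun j => mu j (k - j) * (a j * b (k - j))) N.
Proof.
move=> aA bB muc; exists (c * (bil_cst m * (A * B))).
have := @conv_absum R m m0 (fun j l => mu j l / (w j * w l)%:C) _ _ A B c k
  (l2_le_34_74w aA) (l2_le_34_74w bB).
move=> H J uJ; apply: le_trans (H _ J uJ); last first.
  move=> j l; rewrite Normc.normcM Normc.normcV normcR.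
  have jl : 0 < w j * w l by rewrite mulr_gt0// jap_gt0.
  by rewrite ger0_norm ?(ltW jl)// ler_pdivrMr.
apply: ler_sum => j _; rewrite le_eqVlt; apply/orP; left; apply/eqP.
congr (normc _); rewrite rmorphM/=.
have n0 i : (w i)%:C != 0 :> R[i].
  by rewrite -normc_eq0P normcR normr_eq0 gt_eqF// jap_gt0.
by field; rewrite !n0.
Qed.

Let conv_out (mu : Z3 -> Z3 -> R[i]) (f : Z3 -> R[i]) a b A B c k :
  N34 a A -> N34 b B -> (forall j l, normc (mu j l) <= c) ->
  fconv (fun j l => f (j + l) * mu j l) a b k = f k * fconv mu a b k.
Proof.
move=> aA bB muc; rewrite -(convZ m0 (f k) k aA bB muc).
by apply: csum_ext => j; rewrite subrKC.
Qed.

Lemma jap_wprod j l : w (j + l) <= 2 * emb * (w j * w l).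
Proof.
have wj := jap_gt0 m0 j; have wl := jap_gt0 m0 l.
apply: le_trans (jap_triangle m j l) _.
have h1 := ler_wpM2r (ltW wj) (jap_mass l).
have h2 := ler_wpM2r (ltW wl) (jap_mass j).
by lra.
Qed.

(** Two derivatives are gained: one from beta, and one by moving the weight of
    the output frequency to the two input frequencies. *)
Lemma Tm_bound_74 mu a b A B c : N74 a A -> N74 b B -> bddm mu c ->
  N74 (quad_form mu a b) (emb * (c * (2 * emb) * (Tcst * (A * B)))).
Proof.
move=> aA bB muc.
have c0 : 0 <= c by apply: le_trans (muc true true 0 0); exact: normc_ge0.
pose nu : mult := fun x y j l => (w (j + l))%:C * mu x y j l.
have nuc : wbddm nu (c * (2 * emb)).
  move=> x y j l; rewrite /nu Normc.normcM normcR ger0_norm ?jap_ge0//.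
  rewrite mulrC -mulrA; apply: ler_pM; rewrite ?normc_ge0 ?jap_ge0//.
  exact: jap_wprod.
have e k : quad_form nu a b k = (w k)%:C * quad_form mu a b k.
  have a34 := l2_le_34_1 (l2_le_1_74 aA); have b34 := l2_le_34_1 (l2_le_1_74 bB).
  have sa := l2_le_34_star a34; have sb := l2_le_34_star b34.
  rewrite /quad_form /Qm /nu.
  rewrite (conv_out (fun k => (w k)%:C) k a34 b34 (muc false false)).
  rewrite (conv_out (fun k => (w k)%:C) k a34 sb (muc false true)).
  rewrite (conv_out (fun k => (w k)%:C) k sa sb (muc true true)).
  by ring.
have c1 : 0 <= c * (2 * emb) by rewrite !mulr_ge0 ?emb_ge0.
have := Tm_bound_w c1 aA bB nuc; apply: l2_le_weight; [exact: emb_ge0|exact: w1_ge0|].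
move=> k; rewrite e; set x := quad_form mu a b k.
have -> : normc ((w k)%:C * x) = w k * normc x.
  by rewrite Normc.normcM normcR ger0_norm ?jap_ge0.
rewrite exprMn; have := w34_w1 k; rewrite /w74 /w1 => h.
have h2 : 0 <= w k ^+ 2 * normc x ^+ 2 by rewrite mulr_ge0 ?sqr_ge0.
by have := ler_wpM2r h2 h; lra.
Qed.

(** Membership in H^1 without a bound, for the algebraic identities between the
    quadratic forms, where only summability matters. *)
Definition H1 a := exists A, N1 a A.
Definition bdd mu := exists c, bddm mu c.

Lemma H1_34 a : H1 a -> exists A, N34 a A /\ N34 (star a) A.
Proof.
move=> [A /l2_le_34_1 aA]; exists (emb * A); split=> //; exact: l2_le_34_star.
Qed.

Lemma H1Z s a : H1 a -> H1 (fun k => s%:C * a k).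
Proof. by move=> [A aA]; exists (normc s%:C * A); apply: l2_leZ aA; exact: w1_ge0. Qed.

Lemma H1D a b : H1 a -> H1 b -> H1 (fun k => a k + b k).
Proof. by move=> [A aA] [B bB]; exists (A + B); apply: l2_leD aA bB; exact: w1_ge0. Qed.

Lemma H1B a b : H1 a -> H1 b -> H1 (fun k => a k - b k).
Proof. by move=> [A aA] [B bB]; exists (A + B); apply: l2_leB aA bB; exact: w1_ge0. Qed.

Lemma TmDl mu a a' b k : bdd mu -> H1 a -> H1 a' -> H1 b ->
  quad_form mu (fun k => a k + a' k) b k = quad_form mu a b k + quad_form mu a' b k.
Proof.
move=> [c muc] /H1_34[A [aA sA]] /H1_34[A' [aA' sA']] /H1_34[B [bB sB]].
rewrite /quad_form /Qm (convDl m0 k aA aA' bB (muc _ _)).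
rewrite (convDl m0 k aA aA' sB (muc _ _)).
have -> : star (fun k => a k + a' k) = fun k => star a k + star a' k.
  by apply/funext => i; exact: starD.
by rewrite (convDl m0 k sA sA' sB (muc _ _)); ring.
Qed.

Lemma TmDr mu a b b' k : bdd mu -> H1 a -> H1 b -> H1 b' ->
  quad_form mu a (fun k => b k + b' k) k = quad_form mu a b k + quad_form mu a b' k.
Proof.
move=> [c muc] /H1_34[A [aA sA]] /H1_34[B [bB sB]] /H1_34[B' [bB' sB']].
rewrite /quad_form /Qm (convDr m0 k aA bB bB' (muc _ _)).
have -> : star (fun k => b k + b' k) = fun k => star b k + star b' k.
  by apply/funext => i; exact: starD.
rewrite (convDr m0 k aA sB sB' (muc _ _)).
by rewrite (convDr m0 k sA sB sB' (muc _ _)); ring.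
Qed.

Lemma TmZ mu (x : R[i]) a b k : bdd mu -> H1 a -> H1 b ->
  quad_form (fun e f j l => x * mu e f j l) a b k = x * quad_form mu a b k.
Proof.
move=> [c muc] /H1_34[A [aA sA]] /H1_34[B [bB sB]]; rewrite /quad_form /Qm.
rewrite (convZ m0 x k aA bB (muc _ _)) (convZ m0 x k aA sB (muc _ _)).
by rewrite (convZ m0 x k sA sB (muc _ _)); ring.
Qed.

Lemma TmZl mu s a b k : bdd mu -> H1 a -> H1 b ->
  quad_form mu (fun k => s%:C * a k) b k = s%:C * quad_form mu a b k.
Proof.
move=> bm ha hb; rewrite -TmZ// /quad_form /Qm; congr (_ * (_ + _ * _ + _));
 apply: csum_ext => j; rewrite ?starZ; ring.
Qed.

Lemma TmZr mu s a b k : bdd mu -> H1 a -> H1 b ->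
  quad_form mu a (fun k => s%:C * b k) k = s%:C * quad_form mu a b k.
Proof.
move=> bm ha hb; rewrite -TmZ// /quad_form /Qm; congr (_ * (_ + _ * _ + _));
 apply: csum_ext => j; rewrite ?starZ; ring.
Qed.

Lemma TmBm mu nu a b k : bdd mu -> bdd nu -> H1 a -> H1 b ->
  quad_form (fun e f j l => mu e f j l - nu e f j l) a b k = quad_form mu a b k - quad_form nu a b k.
Proof.
move=> bm bn ha hb.
have [c' nuc] := bn; have [c muc] := bm.
have nuN x y j l : normc (-1 * nu x y j l) <= c' by rewrite mulN1r normcN.
have -> : - quad_form nu a b k = -1 * quad_form nu a b k by rewrite mulN1r.
rewrite -(TmZ (-1) _ bn ha hb).
have [A [aA sA]] := H1_34 ha; have [B [bB sB]] := H1_34 hb.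
rewrite /quad_form /Qm.
rewrite -mulrDr; congr (_ * _).
have D x y a1 b1 : N34 a1 A -> N34 b1 B ->
  fconv (fun j l => mu x y j l - nu x y j l) a1 b1 k =
  fconv (mu x y) a1 b1 k + fconv (fun j l => -1 * nu x y j l) a1 b1 k.
  move=> h1 h2; rewrite -(convDm m0 k h1 h2 (muc _ _) (nuN _ _)).
  by apply: csum_ext => j; rewrite mulN1r.
by rewrite !D//; ring.
Qed.

End QuadraticForm.

(** * Phases, and the symbol of the scheme *)

Section Phases.
Context {R : realType} (m : R).
Hypothesis m0 : m != 0.
Implicit Types (s tau h : R) (x y : bool) (j l : Z3).

Local Notation w := (jap m).

Definition sg x : R := if x then -1 else 1.

(** The resonance of the three waves when both inputs are not conjugated. *)
Definition gam j l : R := w j + w l - w (j + l).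

(** In the variable transported back by the free flow, the exact solution is
    driven by the oscillations exp(i s phase). *)
Definition phase x y j l : R := sg x * w j + sg (x || y) * w l - w (j + l).

(** The part of the phase that the scheme integrates exactly: -2 times the
    frequency on which the functions of the operator A act. That frequency is
    the output frequency for conj(u)^2, the frequency of conj(u) for u conj(u),
    and zero for u^2, according to the three components of G. *)
Definition domf x y j l : R :=
  - (2 * (if x then w (j + l) else if y then w l else w 0)).

(** What is left of the phase after domf and gam splits off into this term, which
    comes from the twisted difference of G in the scheme. *)
Definition bet x y j l : R :=
  if x then - (2 * gam j l) else if y then 0 else 2 * w 0.

Definition flow_phase s : mult := fun x y j l => cis (s * phase x y j l).

(** The scheme replaces exp(i s (bet + gam)) by 1 + (s / tau) kap: the increments
    over one step of the two slow oscillations are added and interpolated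
    linearly in s. *)
Definition kap tau x y j l : R[i] :=
  (cis (tau * bet x y j l) - 1) + (cis (tau * gam j l) - 1).

(** The symbol by which the scheme replaces the oscillations of the exact flow. *)
Definition symY tau s : mult := fun x y j l =>
  cis (s * domf x y j l) * (1 + (s / tau)%:C * kap tau x y j l).

(** The time integral of symY from 0 to s; at s = tau it is the symbol of the
    quadratic terms of the scheme. *)
Definition symX tau s : mult := fun x y j l =>
  prim1 (domf x y j l) s + prim2 (domf x y j l) s * ((tau^-1)%:C * kap tau x y j l).

(** The algebraic identity on which the scheme is built. *)
Lemma phase_split x y j l :
  phase x y j l = domf x y j l + (bet x y j l + gam j l).
Proof.
by case: x; case: y; rewrite /phase /domf /bet /gam /sg /=; ring.
Qed.

Lemma domf_neq0 x y j l : domf x y j l != 0.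
Proof.
by rewrite /domf oppr_eq0 mulf_neq0//; case: x; [|case: y]; rewrite gt_eqF// jap_gt0.
Qed.

Let em := emb m.

Lemma wprod_ge1 j l : 1 <= em ^+ 2 * (w j * w l).
Proof.
have := jap_mass m0 j; have := jap_mass m0 l; rewrite -/em => h1 h2.
have -> : em ^+ 2 * (w j * w l) = (em * w j) * (em * w l) by ring.
exact: mulr_ege1.
Qed.

Lemma w0_le j : w 0 <= w j.
Proof. by rewrite jap0 jap_ge_mass. Qed.

Lemma gam_sqr j l : gam j l ^+ 2 <= 4 * (w j * w l).
Proof. exact: resonance_sqr. Qed.

Lemma bet_sqr x y j l : bet x y j l ^+ 2 <= 16 * (w j * w l).
Proof.
have wj := jap_gt0 m0 j; have wl := jap_gt0 m0 l.
have p : 0 <= w j * w l by rewrite mulr_ge0// ltW.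
rewrite /bet; case: x; [|case: y].
- by have := gam_sqr j l; lra.
- by rewrite expr0n/= mulr_ge0.
- have w0p := jap_ge0 m 0.
  have : w 0 * w 0 <= w j * w l by apply: ler_pM => //; exact: w0_le.
  by lra.
Qed.

Lemma sum_w_le j l : w j + w l <= 2 * em * (w j * w l).
Proof.
have wj := jap_gt0 m0 j; have wl := jap_gt0 m0 l.
have h1 := ler_wpM2r (ltW wj) (jap_mass m0 l).
have h2 := ler_wpM2r (ltW wl) (jap_mass m0 j).
by rewrite /em; lra.
Qed.

Lemma phase_bound x y j l : `|phase x y j l| <= 4 * em * (w j * w l).
Proof.
have wj := jap_gt0 m0 j; have wl := jap_gt0 m0 l; have wjl := jap_gt0 m0 (j + l).
have := sum_w_le j l; have := jap_triangle m j l.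
by rewrite /phase /sg ler_norml; case: x; case: y => /= *; apply/andP; split; lra.
Qed.

Lemma domf_bound x y j l : `|domf x y j l| <= 4 * em * (w j * w l).
Proof.
have wj := jap_gt0 m0 j; have wl := jap_gt0 m0 l; have wjl := jap_gt0 m0 (j + l).
have w0p := jap_gt0 m0 0; have := w0_le j.
have := sum_w_le j l; have := jap_triangle m j l.
rewrite /domf normrN normrM ger0_norm//.
by case: x; [|case: y] => *; rewrite ger0_norm ?jap_ge0//; lra.
Qed.

Lemma chi_bound s : bddm (flow_phase s) 1.
Proof. by move=> x y j l; rewrite normc_cis. Qed.

Lemma chiB1_bound s : wbddm m (fun x y j l => flow_phase s x y j l - 1) (8 * em * `|s|).
Proof.
move=> x y j l; apply: le_trans (cisB1_bound _) _; rewrite normrM.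
have := ler_wpM2l (normr_ge0 s) (phase_bound x y j l); lra.
Qed.

(** The linear interpolation is bounded without any loss of derivative, which is
    what makes the scheme stable in H^1. *)
Lemma kap_bound tau x y j l : normc (kap tau x y j l) <= 4.
Proof.
have h z : normc (cis z - 1 : R[i]) <= 2.
  by apply: le_trans (ler_normcB _ _) _; rewrite normc_cis Normc.normc1.
apply: le_trans (ler_normcD _ _) _.
by have := h (tau * bet x y j l); have := h (tau * gam j l); lra.
Qed.

Lemma symY_bound tau s : 0 < tau -> 0 <= s <= tau -> bddm (symY tau s) 5.
Proof.
move=> t0 /andP[s0 sT] x y j l; rewrite Normc.normcM normc_cis mul1r.
apply: le_trans (ler_normcD _ _) _; rewrite Normc.normc1 Normc.normcM normcR.
have h : `|s / tau| <= 1 by rewrite ger0_norm ?divr_ge0 ?(ltW t0)// ler_pdivrMr ?mul1r.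
have := ler_pM (normr_ge0 _) (normc_ge0 _) h (kap_bound tau x y j l); lra.
Qed.

Lemma prim1_bound A s : A != 0 -> normc (prim1 A s) <= 2 * `|s|.
Proof.
move=> A0; rewrite /prim1 Normc.normcM Normc.normcV Normc.normcM normci mul1r normcR.
rewrite ler_pdivrMr ?normr_gt0//; apply: le_trans (cisB1_bound _) _.
by rewrite normrM mulrA.
Qed.

Lemma prim2_bound A s : A != 0 -> normc (prim2 A s) <= 2 * s ^+ 2.
Proof.
move=> A0; have [->|s0] := eqVneq s 0; first by rewrite prim20 Normc.normc0 expr0n mulr0.
rewrite prim2_phi2// Normc.normcM mulrC.
have sA : s * A != 0 by rewrite mulf_neq0.
have -> : normc (s%:C ^+ 2) = s ^+ 2.
  by rewrite expr2 Normc.normcM normcR -expr2 real_normK// num_real.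
by rewrite ler_wpM2r ?sqr_ge0// phi2_bound.
Qed.

Lemma symX_bound tau s : 0 < tau -> bddm (symX tau s) (2 * `|s| + 8 * s ^+ 2 / tau).
Proof.
move=> t0 x y j l; apply: le_trans (ler_normcD _ _) _.
have d0 := domf_neq0 x y j l; apply: lerD; first exact: prim1_bound.
rewrite (Normc.normcM (prim2 _ _)) (Normc.normcM _%:C) normcR gtr0_norm ?invr_gt0//.
have h1 := prim2_bound s d0; have h2 := kap_bound tau x y j l.
have ti : 0 <= tau^-1 by rewrite invr_ge0 ltW.
have := ler_pM (normc_ge0 _) (normc_ge0 _) h1 h2.
by move=> h3; have h4 := ler_wpM2l ti h3; lra.
Qed.

Lemma symX_step tau : 0 < tau -> bddm (symX tau tau) (10 * tau).
Proof.
move=> t0 x y j l; apply: le_trans (symX_bound tau t0 x y j l) _.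
rewrite gtr0_norm// expr2 mulrA mulrK ?unitfE ?gt_eqF//; lra.
Qed.

Lemma symX0 tau x y j l : symX tau 0 x y j l = 0.
Proof. by rewrite /symX prim10 prim20 mul0r addr0. Qed.

Lemma symX_quad tau s : 0 < tau -> exists C, forall h x y j l,
  normc (symX tau (s + h) x y j l - symX tau s x y j l - h%:C * symY tau s x y j l)
  <= h ^+ 2 * (C * (w j * w l)).
Proof.
move=> t0; exists (8 * em + 4 / tau * (8 * `|s| * em + 4 * em ^+ 2)) => h x y j l.
have d0 := domf_neq0 x y j l.
rewrite /symX /symY; set A := domf x y j l in d0 *; set kp := kap _ _ _ _ _.
have -> : prim1 A (s + h) + prim2 A (s + h) * ((tau^-1)%:C * kp) -
   (prim1 A s + prim2 A s * ((tau^-1)%:C * kp)) -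
   h%:C * (cis (s * A) * (1 + (s / tau)%:C * kp)) =
   (prim1 A (s + h) - prim1 A s - h%:C * cis (s * A)) +
   ((tau^-1)%:C * kp) * (prim2 A (s + h) - prim2 A s - h%:C * (s%:C * cis (s * A))).
  by rewrite rmorphM/=; ring.
apply: le_trans (ler_normcD _ _) _.
have b1 := prim1_quad s h d0; have b2 := prim2_quad s h d0.
have ti : 0 < tau^-1 by rewrite invr_gt0.
rewrite !Normc.normcM normcR gtr0_norm//.
have b3 : tau^-1 * normc kp <= 4 / tau.
  by rewrite mulrC ler_wpM2r ?(ltW ti)// kap_bound.
have p1 : 0 <= tau^-1 * normc kp by rewrite mulr_ge0 ?normc_ge0 ?ltW.
have b4 := ler_pM p1 (normc_ge0 _) b3 b2.
have h2 := sqr_ge0 h; have s0 := normr_ge0 s.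
have b5 : `|A| <= 4 * em * (w j * w l) := domf_bound x y j l.
have b6 := wprod_ge1 j l.
apply: le_trans (lerD b1 b4) _.
rewrite [leRHS]mulrC.
have -> : h ^+ 2 * (2 * `|A|) + 4 / tau * (h ^+ 2 * (2 * `|s| * `|A| + 4)) =
  (2 * `|A| + 4 / tau * (2 * `|s| * `|A| + 4)) * h ^+ 2 by ring.
rewrite ler_wpM2r//.
have c1 : 2 * `|s| * `|A| <= 2 * `|s| * (4 * em * (w j * w l)).
  by rewrite ler_wpM2l// mulr_ge0.
have c2 : 0 <= 4 / tau by rewrite mulr_ge0// ltW.
have c3 : 2 * `|s| * `|A| + 4 <= (8 * `|s| * em + 4 * em ^+ 2) * (w j * w l) by lra.
by have := ler_wpM2l c2 c3; lra.
Qed.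

(** Second order consistency of the symbols. Both interpolations are exact to
    first order, and their second differences are of size s^2 times the squares
    of bet and gam, hence controlled by the resonance estimate. *)
Lemma chiY_bound tau s : 0 < tau -> 0 <= s <= tau ->
  wbddm m (fun x y j l => flow_phase s x y j l - symY tau s x y j l) (120 * tau ^+ 2).
Proof.
move=> t0 /andP[s0 sT] x y j l.
rewrite /flow_phase phase_split mulrDr cisD.
pose Rm z : R[i] := cis z - 1 - 'i * z%:C.
set A := domf x y j l; set B := bet x y j l; set G := gam j l.
have tC : tau%:C != 0 :> R[i] by rewrite -normc_eq0P normcR normr_eq0 gt_eqF.
(* all linear terms of the Taylor expansions cancel *)
have -> : cis (s * A) * cis (s * (B + G)) - symY tau s x y j l =
  cis (s * A) * (Rm (s * (B + G)) - (s / tau)%:C * (Rm (tau * B) + Rm (tau * G))).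
  rewrite /symY -/A /kap -/B -/G /Rm !rmorphM/= !rmorphD/= fmorphV/=.
  by field.
rewrite Normc.normcM normc_cis mul1r.
apply: le_trans (ler_normcB _ _) _.
have h : 0 <= s / tau <= 1 by rewrite divr_ge0 ?(ltW t0)//= ler_pdivrMr ?mul1r.
have /andP[h0 h1] := h.
have b1 := cisB1i_bound (s * (B + G)).
have b2 : normc ((s / tau)%:C * (Rm (tau * B) + Rm (tau * G))) <=
   2 * (tau * B) ^+ 2 + 2 * (tau * G) ^+ 2.
  rewrite Normc.normcM normcR ger0_norm//.
  apply: (@le_trans _ _ (1 * normc (Rm (tau * B) + Rm (tau * G)))).
    by rewrite ler_wpM2r ?normc_ge0.
  rewrite mul1r; apply: le_trans (ler_normcD _ _) _.
  by apply: lerD; exact: cisB1i_bound.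
apply: le_trans (lerD b1 b2) _.
have s2 : s ^+ 2 <= tau ^+ 2 by rewrite lerXn2r ?nnegrE// ltW.
have b3 : s ^+ 2 * (B + G) ^+ 2 <= tau ^+ 2 * (B + G) ^+ 2 by rewrite ler_wpM2r ?sqr_ge0.
have t2 : 0 <= tau ^+ 2 by exact: sqr_ge0.
have b4 : (B + G) ^+ 2 <= 2 * B ^+ 2 + 2 * G ^+ 2.
  by have := sqr_ge0 (B - G); lra.
have b5 : B ^+ 2 <= 16 * (w j * w l) := bet_sqr x y j l.
have b6 : G ^+ 2 <= 4 * (w j * w l) := gam_sqr j l.
have b7 : (B + G) ^+ 2 + B ^+ 2 + G ^+ 2 <= 60 * (w j * w l) by lra.
have := ler_wpM2l t2 b7; rewrite !exprMn; lra.
Qed.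

End Phases.

(** * Local error *)

Section LocalError.
Context {R : realType} (m : R).
Hypothesis m0 : m != 0.

Local Notation w := (jap m).
Local Notation N1 := (l2_le (w1 m)).
Local Notation N74 := (l2_le (w74 m)).
Local Notation H1 := (H1 m).
Local Notation Tm := (quad_form m).
Local Notation chi := (flow_phase m).
Local Notation em := (emb m).
Local Notation K := (Tcst m).

Lemma w74N (k : Z3) : w74 m (- k) = w74 m k.
Proof. by rewrite /w74 w34N japN. Qed.

(** A curve of symbols whose Taylor remainders lose one derivative on each factor
    is differentiated under the convolution of two H^(7/4) functions. *)
Lemma cder_fconv (X : R -> Z3 -> Z3 -> R[i]) (Y : Z3 -> Z3 -> R[i]) a b A B s C k :
  N74 a A -> N74 b B -> (forall r, exists c, forall j l, normc (X r j l) <= c) ->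
  (exists c, forall j l, normc (Y j l) <= c) ->
  (forall h j l, normc (X (s + h) j l - X s j l - h%:C * Y j l)
     <= h ^+ 2 * (C * (w j * w l))) ->
  cder (fun r => fconv (X r) a b k) s (fconv Y a b k).
Proof.
move=> aA bB Xb [c Yc] H.
have a34 := l2_le_34_1 m0 (l2_le_1_74 m0 aA); have b34 := l2_le_34_1 m0 (l2_le_1_74 m0 bB).
have wC j l : normc (C * (w j * w l))%:C <= `|C| * (w j * w l).
  by rewrite normcR normrM [`|w j * w l|]ger0_norm ?mulr_ge0 ?jap_ge0.
have [N WN] := @absum_w R m m0 (fun j l => (C * (w j * w l))%:C) a b A B `|C| k aA bB wC.
apply: (@cder_csum _ _ (fun r j => X r j (k - j) * (a j * b (k - j))) _ _ _ _ _ _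
  (conv_absum m0 k a34 b34 Yc) WN).
  move=> r; have [c' Xc] := Xb r.
  by exists (c' * (bil_cst m * (em * (em * A) * (em * (em * B))))); exact: (conv_absum m0 k a34 b34 Xc).
move=> h j; rewrite Normc.normcM.
have -> : X (s + h) j (k - j) * (a j * b (k - j)) - X s j (k - j) * (a j * b (k - j)) -
   h%:C * (Y j (k - j) * (a j * b (k - j))) =
   (X (s + h) j (k - j) - X s j (k - j) - h%:C * Y j (k - j)) * (a j * b (k - j)) by ring.
rewrite Normc.normcM [leRHS]mulrA ler_wpM2r ?normc_ge0//.
apply: le_trans (H h j (k - j)) _; rewrite ler_wpM2l ?sqr_ge0// normcR.
exact: ler_norm.
Qed.

Lemma cder_Tm_symX tau s v M k : 0 < tau -> 0 <= s <= tau -> N74 v M ->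
  cder (fun r => Tm (symX m tau r) v v k) s (Tm (symY m tau s) v v k).
Proof.
move=> t0 st0 vM; have sv : N74 (star v) M by apply: l2_le_star vM; exact: w74N.
have [C HC] := symX_quad m0 s t0.
have D x y a b : N74 a M -> N74 b M ->
  cder (fun r => fconv (symX m tau r x y) a b k) s (fconv (symY m tau s x y) a b k).
  move=> aM bM; apply: (@cder_fconv (fun r => symX m tau r x y) (symY m tau s x y) a b M M s C k aM bM).
  - by move=> r; exists (2 * `|r| + 8 * r ^+ 2 / tau) => j l; exact: symX_bound.
  - by exists 5 => j l; exact: symY_bound.
  - by move=> h j l; exact: HC.
rewrite /quad_form; apply: cderZ; rewrite /Qm; apply: cderD; last exact: D.
by apply: cderD; [exact: D|apply: cderZ; exact: D].
Qed.

Definition onem : @mult R := cstm 1.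

(** The nonlinearity f(u, conj u) and its differential at u in the real direction
    g, in which conj u moves along with u. *)
Definition nonlin (u : Z3 -> R[i]) : Z3 -> R[i] := Tm onem u u.
Definition Dnonlin (u g : Z3 -> R[i]) k : R[i] := Tm onem u g k + Tm onem g u k.

(** One step of the numerical flow from v, in the variable that is transported
    back by the free flow. The first correction is the integral of the replaced
    oscillations with v frozen, and the last one is the second order Taylor term
    of v along the flow. The intermediate times s interpolate the step, so that
    the local error can be estimated by differentiating in s. *)
Definition twisted tau s (v : Z3 -> R[i]) k : R[i] :=
  v k + Tm (symX m tau s) v v k + (s ^+ 2 / 2)%:C * Dnonlin v (nonlin v) k.

Lemma onem_bdd : bddm onem 1.
Proof. by move=> x y j l; rewrite /onem /cstm Normc.normc1. Qed.

Let b1 : bdd onem. Proof. by exists 1; exact: onem_bdd. Qed.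
Let bchi s : bdd (chi s). Proof. by exists 1; exact: chi_bound. Qed.

Lemma cder_real s : cder (fun r => r%:C) s (1 : R[i]).
Proof.
apply: (@cder_quad _ _ _ _ 0) => h.
have -> : (s + h)%:C - s%:C - h%:C * 1 = 0 :> R[i] by rewrite rmorphD/=; ring.
by rewrite Normc.normc0 mul0r.
Qed.

Lemma ccontW T T' (f : R -> R[i]) : T' <= T -> ccont T f -> ccont T' f.
Proof.
move=> TT [f1 f2]; split; apply: continuous_subspaceW (f1) || apply: continuous_subspaceW (f2).
- by move=> x; rewrite /= !in_itv/= => /andP[-> /le_trans]; apply.
- by move=> x; rewrite /= !in_itv/= => /andP[-> /le_trans]; apply.
Qed.

Lemma cder_ccont T (f f' : R -> R[i]) : (forall s, 0 <= s <= T -> cder f s (f' s)) -> ccont T f.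
Proof.
move=> H; split; apply: derivable_within_continuous => s; rewrite in_itv/= => /H[h1 h2];
 exact: (@ex_derive _ _ _ _ _ _ _).
Qed.

Lemma ccontB T (f g : R -> R[i]) : ccont T f -> ccont T g -> ccont T (fun s => f s - g s).
Proof.
move=> [f1 f2] [g1 g2]; split.
  have -> : (fun r => Re (f r - g r)) = fun r => Re (f r) - Re (g r).
    by apply/funext => r; rewrite cReD cReN.
  by move=> x; apply: cvgB; [exact: f1|exact: g1].
have -> : (fun r => Im (f r - g r)) = fun r => Im (f r) - Im (g r).
  by apply/funext => r; rewrite cImD cImN.
by move=> x; apply: cvgB; [exact: f2|exact: g2].
Qed.

Section Flow.
Variables (tau M : R) (p : R -> Z3 -> R[i]).
Hypothesis tau0 : 0 < tau.
Hypothesis pc : forall k, ccont tau (fun s => p s k).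
Hypothesis pd : forall s k, 0 < s < tau ->
  cder (fun r => p r k) s (Tm (chi s) (p s) (p s) k).
Hypothesis pM : forall s, 0 <= s <= tau -> N74 (p s) M.

Let v := p 0.
Let g := nonlin v.
Let d s k := p s k - v k.
Let q s k := d s k - s%:C * g k.
Let M1 := em * M.
Let D1 := K * (M1 * M1).
Let D2 := 2 * (K * (D1 * M1)) + 8 * em * (K * (M * M)).
Let M3 := em * (2 * em * (K * (M * M))).

Definition local_cst : R :=
  120 * (K * (M * M)) + 16 * em * (K * (M * M3)) + 2 * (K * (M1 * D2)) + K * (D1 * D1).

Let M0 : 0 <= M. Proof. by apply: (@l2_le_ge0 _ _ _ (p 0)); apply: pM; rewrite lexx ltW. Qed.
Let em0 : 0 <= em. Proof. exact: emb_ge0. Qed.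
Let K0 : 0 <= K. Proof. exact: Tcst_ge0. Qed.
Let M10 : 0 <= M1. Proof. exact: mulr_ge0. Qed.
Let D10 : 0 <= D1. Proof. by rewrite !mulr_ge0. Qed.
Let D20 : 0 <= D2. Proof. by rewrite addr_ge0 ?mulr_ge0. Qed.
Let M30 : 0 <= M3. Proof. by rewrite !mulr_ge0. Qed.

Lemma local_cst_ge0 : 0 <= local_cst.
Proof. by rewrite /local_cst !addr_ge0 ?mulr_ge0. Qed.

Let pM1 s : 0 <= s <= tau -> N1 (p s) M1.
Proof. by move=> /pM; exact: l2_le_1_74. Qed.

Let vM : N74 v M. Proof. by apply: pM; rewrite lexx ltW. Qed.
Let v1 : N1 v M1. Proof. exact: l2_le_1_74. Qed.

Let g1 : N1 g D1.
Proof. by have := Tm_bound m0 v1 v1 onem_bdd; rewrite mul1r. Qed.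

Let g74 : N74 g M3.
Proof. by have := Tm_bound_74 m0 vM vM onem_bdd; rewrite mul1r. Qed.

Let in_tau s r : 0 <= s <= tau -> 0 < r < s -> 0 <= r <= tau.
Proof. by move=> /andP[_ sT] /andP[r0 rs]; rewrite (ltW r0) (le_trans (ltW rs)). Qed.

Let in_tau' s r : 0 <= s <= tau -> 0 < r < s -> 0 < r < tau.
Proof. by move=> /andP[_ sT] /andP[r0 rs]; rewrite r0 (lt_le_trans rs). Qed.

Let dB s : 0 <= s <= tau -> N1 (d s) (s * D1).
Proof.
move=> sT; have /andP[s0 s1] := sT.
apply: (@l2_mvt _ _ _ p (fun r => Tm (chi r) (p r) (p r)) s D1) => //.
- exact: w1_ge0.
- by move=> k; exact: ccontW s1 (pc k).
- by move=> r k /(in_tau' sT); exact: pd.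
- move=> r /(in_tau sT) h; have := Tm_bound m0 (pM1 h) (pM1 h) (@chi_bound _ m r).
  by rewrite mul1r.
Qed.

Let H1v : H1 v. Proof. by exists M1. Qed.
Let H1g : H1 g. Proof. by exists D1. Qed.
Let H1p s : 0 <= s <= tau -> H1 (p s). Proof. by move=> h; exists M1; exact: pM1. Qed.
Let H1d s : 0 <= s <= tau -> H1 (d s). Proof. by move=> h; exists (s * D1); exact: dB. Qed.

Let p_vd s : p s = fun k => v k + d s k.
Proof. by apply/funext => k; rewrite /d subrKC. Qed.

Let cder_sg r k : cder (fun r => r%:C * g k) r (g k).
Proof.
by have := cderM (cder_real r) (cder_cst (g k) r); rewrite mul1r mulr0 addr0.
Qed.

Let Tm_chi_p s k : 0 <= s <= tau -> Tm (chi s) (p s) (p s) k =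
  Tm (chi s) v v k + Tm (chi s) v (d s) k + (Tm (chi s) (d s) v k + Tm (chi s) (d s) (d s) k).
Proof.
move=> h; have hd := H1d h.
by rewrite p_vd (TmDl m0 k (bchi s) H1v hd (H1D H1v hd)) (TmDr m0 k (bchi s) H1v H1v hd) (TmDr m0 k (bchi s) hd H1v hd).
Qed.

Let TmB1 s a b k : H1 a -> H1 b ->
  Tm (fun x y j l => chi s x y j l - 1) a b k = Tm (chi s) a b k - Tm onem a b k.
Proof. by move=> ha hb; rewrite -TmBm. Qed.

Let qB s : 0 <= s <= tau -> N1 (q s) (s * (s * D2)).
Proof.
move=> sT; have /andP[s0 s1] := sT.
have := @l2_mvt _ _ (w1 m) (fun r k => p r k - r%:C * g k)
  (fun r k => Tm (chi r) (p r) (p r) k - g k) s (s * D2) (@w1_ge0 _ m) s0.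
have sD2 : 0 <= s * D2 by rewrite mulr_ge0.
move=> /(_ sD2) H.
apply: l2_le_ext (H _ _ _) => [k|k|r k h|r h].
- by rewrite /q /d mul0r subr0 /v; ring.
- apply: ccontB; first exact: ccontW s1 (pc k).
  by apply: cder_ccont => r _; exact: cder_sg.
- apply: cderB; last exact: cder_sg.
  exact: pd (in_tau' sT h).
- have rt := in_tau sT h; have /andP[r0 rs] := h.
  have B1 := Tm_bound m0 (dB rt) (pM1 rt) (@chi_bound _ m r).
  have B2 := Tm_bound m0 v1 (dB rt) (@chi_bound _ m r).
  have c0 : 0 <= 8 * em * `|r| by rewrite !mulr_ge0.
  have B3 := Tm_bound_w m0 c0 vM vM (@chiB1_bound _ m m0 r).
  have B4 := l2_leD (@w1_ge0 _ m) (l2_leD (@w1_ge0 _ m) B1 B2) B3.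
  apply: (@l2_le_monoM _ _ _ _ (r * D2)).
    by rewrite ler_wpM2r// ltW.
  rewrite (ger0_norm (ltW r0)) in B4.
  have -> : r * D2 = 1 * (K * (r * D1 * M1)) + 1 * (K * (M1 * (r * D1))) +
     8 * em * r * (K * (M * M)) by rewrite /D2; ring.
  apply: l2_le_ext B4 => k.
  rewrite TmB1// Tm_chi_p//.
  have -> : Tm (chi r) (d r) (p r) k = Tm (chi r) (d r) v k + Tm (chi r) (d r) (d r) k.
    have hd := H1d rt; by rewrite p_vd (TmDr m0 k (bchi r) hd H1v hd).
  rewrite /g /nonlin; move: (Tm (chi r) v v k) (Tm onem v v k) (Tm (chi r) v (d r) k)
    (Tm (chi r) (d r) v k) (Tm (chi r) (d r) (d r) k) => *; ring.
Qed.

Let H1q s : 0 <= s <= tau -> H1 (q s). Proof. by move=> h; exists (s * (s * D2)); exact: qB. Qed.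

Let cder_twisted s k : 0 <= s <= tau ->
  cder (fun r => twisted tau r v k) s (Tm (symY m tau s) v v k + s%:C * Dnonlin v g k).
Proof.
move=> sT; rewrite /twisted -/g.
rewrite -[Tm _ _ _ _]add0r; apply: cderD.
  apply: cderD; first exact: cder_cst.
  exact: cder_Tm_symX vM.
have := cderM (cderM (cder_real s) (cder_real s)) (cder_cst (2^-1 * Dnonlin v g k) s).
rewrite mulr0 addr0 mul1r mulr1.
have n2 : (2 : R[i]) != 0 by rewrite pnatr_eq0.
have -> : (s%:C + s%:C) * (2^-1 * Dnonlin v g k) = s%:C * Dnonlin v g k by field.
apply: cder_ext => r; rewrite expr2 !rmorphM/= fmorphV/=.
by rewrite (rmorph_nat (real_complex R)); ring.
Qed.

Let deriv_error s k : 0 <= s <= tau ->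
  Tm (chi s) (p s) (p s) k - (Tm (symY m tau s) v v k + s%:C * Dnonlin v g k) =
  Tm (fun x y j l => chi s x y j l - symY m tau s x y j l) v v k +
  s%:C * (Tm (fun x y j l => chi s x y j l - 1) v g k +
          Tm (fun x y j l => chi s x y j l - 1) g v k) +
  (Tm (chi s) v (q s) k + Tm (chi s) (q s) v k) + Tm (chi s) (d s) (d s) k.
Proof.
move=> sT; have bY : bdd (symY m tau s) by exists 5; exact: symY_bound.
rewrite TmBm// !TmB1// Tm_chi_p//.
have dq : d s = fun k => s%:C * g k + q s k.
  by apply/funext => i; rewrite /q subrKC.
have H1sg : H1 (fun k => s%:C * g k) by exact: H1Z.
have -> : Tm (chi s) v (d s) k = s%:C * Tm (chi s) v g k + Tm (chi s) v (q s) k.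
  by rewrite {1}dq (TmDr m0 k (bchi s) H1v H1sg (H1q sT)) TmZr.
have -> : Tm (chi s) (d s) v k = s%:C * Tm (chi s) g v k + Tm (chi s) (q s) v k.
  by rewrite {1}dq (TmDl m0 k (bchi s) H1sg (H1q sT) H1v) TmZl.
rewrite /Dnonlin; move: (Tm (chi s) v v k) (Tm (symY m tau s) v v k) (Tm (chi s) v g k)
  (Tm (chi s) g v k) (Tm onem v g k) (Tm onem g v k) (Tm (chi s) v (q s) k)
  (Tm (chi s) (q s) v k) (Tm (chi s) (d s) (d s) k) => *; ring.
Qed.

(** After differentiation in s the error is a sum of quadratic forms of size
    s^2 or tau^2: the consistency error of the symbols, the difference between
    the oscillations and 1 on the Taylor term, and the quadratic remainder of the
    expansion of the solution. *)
Lemma local_error : N1 (fun k => p tau k - twisted tau tau (p 0) k) (local_cst * tau ^+ 3).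
Proof.
have t0 := ltW tau0.
have D0 : 0 <= local_cst * tau ^+ 2 by rewrite mulr_ge0 ?local_cst_ge0 ?sqr_ge0.
have H := @l2_mvt _ _ (w1 m) (fun r k => p r k - twisted tau r v k)
  (fun s k => Tm (chi s) (p s) (p s) k - (Tm (symY m tau s) v v k + s%:C * Dnonlin v g k))
  tau (local_cst * tau ^+ 2) (@w1_ge0 _ m) t0 D0.
have -> : local_cst * tau ^+ 3 = tau * (local_cst * tau ^+ 2) by ring.
apply: l2_le_ext (H _ _ _) => [k|k|s k h|s h].
- have -> : twisted tau 0 v k = v k.
    rewrite /twisted expr0n mul0r mul0r addr0.
    have -> : symX m tau 0 = fun x y j l => 0 * onem x y j l.
      by apply/funext => x; apply/funext => y; apply/funext => j; apply/funext => l;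
        rewrite symX0 mul0r.
    by rewrite TmZ// mul0r addr0.
  by rewrite /v subrr subr0.
- apply: ccontB => //; apply: cder_ccont => r; exact: cder_twisted.
- apply: cderB; first exact: pd.
  by apply: cder_twisted; move: h => /andP[/ltW -> /ltW ->].
- have sT : 0 <= s <= tau by move: h => /andP[/ltW -> /ltW ->].
  have /andP[s0 s1] := sT.
  have W0 := @w1_ge0 _ m.
  have t2 : 0 <= 120 * tau ^+ 2 by rewrite mulr_ge0 ?sqr_ge0.
  have B1 := Tm_bound_w m0 t2 vM vM (chiY_bound m0 tau0 sT).
  have c0 : 0 <= 8 * em * `|s| by rewrite !mulr_ge0.
  have B2 := Tm_bound_w m0 c0 vM g74 (@chiB1_bound _ m m0 s).
  have B3 := Tm_bound_w m0 c0 g74 vM (@chiB1_bound _ m m0 s).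
  have B4 := Tm_bound m0 v1 (qB sT) (@chi_bound _ m s).
  have B5 := Tm_bound m0 (qB sT) v1 (@chi_bound _ m s).
  have B6 := Tm_bound m0 (dB sT) (dB sT) (@chi_bound _ m s).
  have B := l2_leD W0 (l2_leD W0 (l2_leD W0 B1 (l2_leZ s%:C W0 (l2_leD W0 B2 B3))) (l2_leD W0 B4 B5)) B6.
  have s2 : s ^+ 2 <= tau ^+ 2 by rewrite lerXn2r ?nnegrE.
  cbv beta in B; have E := funext (fun k => deriv_error k sT).
  rewrite E; apply: l2_le_monoM B.
  rewrite normcR ger0_norm//.
  have P1 : 0 <= 16 * em * (K * (M * M3)) + 2 * (K * (M1 * D2)) + K * (D1 * D1).
    by rewrite !addr_ge0 ?mulr_ge0.
  by have := ler_wpM2l P1 s2; rewrite /local_cst; lra.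
Qed.

End Flow.

End LocalError.

(** * Stability and global error on Fourier coefficients *)

Section GlobalError.
Context {R : realType} (m : R).
Hypothesis m0 : m != 0.

Local Notation w := (jap m).
Local Notation N1 := (l2_le (w1 m)).
Local Notation N74 := (l2_le (w74 m)).
Local Notation H1 := (H1 m).
Local Notation Tm := (quad_form m).
Local Notation chi := (flow_phase m).
Local Notation em := (emb m).
Local Notation K := (Tcst m).
Local Notation nlS := (nonlin m).
Local Notation DnlS := (Dnonlin m).

Let em0 : 0 <= em. Proof. exact: emb_ge0. Qed.
Let K0 : 0 <= K. Proof. exact: Tcst_ge0. Qed.
Let W0 := @w1_ge0 _ m.
Let b1 : bdd (@onem R). Proof. by exists 1; exact: onem_bdd. Qed.

(** The scheme on Fourier coefficients; that it is the scheme is shown by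
    step_coefs below. *)
Definition stepS tau (u : Z3 -> R[i]) k : R[i] := cis (tau * w k) * twisted m tau tau u k.

Lemma l2_le_cis a A (f : Z3 -> R) : N1 a A -> N1 (fun k => cis (f k) * a k) A.
Proof.
move=> aA; rewrite -[A]mul1r; apply: l2_le_mul aA => // k.
by rewrite normc_cis.
Qed.

Lemma l2_le_nlS u A : N1 u A -> N1 (nlS u) (K * (A * A)).
Proof. by move=> uA; have := Tm_bound m0 uA uA (@onem_bdd R); rewrite mul1r. Qed.

Lemma l2_le_DnlS u g A B : N1 u A -> N1 g B -> N1 (DnlS u g) (2 * (K * (A * B))).
Proof.
move=> uA gB; have := l2_leD W0 (Tm_bound m0 uA gB (@onem_bdd R)) (Tm_bound m0 gB uA (@onem_bdd R)).
by apply: l2_le_monoM; rewrite !mul1r [B * A]mulrC; lra.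
Qed.

Lemma l2_le_stepS tau T u A : 0 < tau <= T -> N1 u A ->
  N1 (stepS tau u) (A + 10 * T * (K * (A * A)) + T ^+ 2 * (K * (A * (K * (A * A))))).
Proof.
move=> /andP[t0 tT] uA; have A0 := l2_le_ge0 uA.
apply: l2_le_cis; have B1 := Tm_bound m0 uA uA (symX_step m0 t0).
have B2 := l2_leZ (tau ^+ 2 / 2)%:C W0 (l2_le_DnlS uA (l2_le_nlS uA)).
apply: l2_le_monoM (l2_leD W0 (l2_leD W0 uA B1) B2).
rewrite normcR ger0_norm ?divr_ge0 ?sqr_ge0//.
have P1 : 0 <= K * (A * A) by rewrite !mulr_ge0.
have P2 : 0 <= K * (A * (K * (A * A))) by rewrite !mulr_ge0.
have t2 : tau ^+ 2 <= T ^+ 2 by rewrite lerXn2r ?nnegrE ?(ltW t0)// (le_trans (ltW t0)).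
have := ler_wpM2r P1 tT; have := ler_wpM2r P2 t2; lra.
Qed.

Definition lip_cst T A := 20 * K * A + 3 * T * K ^+ 2 * A ^+ 2.

Lemma Tm_diff mu u v k : bdd mu -> H1 u -> H1 v ->
  Tm mu u u k - Tm mu v v k =
  Tm mu (fun i => u i - v i) u k + Tm mu v (fun i => u i - v i) k.
Proof.
move=> bm hu hv; have hd := H1B hu hv.
have e : (fun i => u i - v i + v i) = u by apply/funext => i; rewrite subrK.
have := TmDl m0 k bm hd hv hu; rewrite e => ->.
have := TmDr m0 k bm hv hd hv; rewrite e => ->.
by rewrite addrA addrK.
Qed.

Lemma Tm_diff2 mu u v g h k : bdd mu -> H1 u -> H1 v -> H1 g -> H1 h ->
  Tm mu u g k - Tm mu v h k =
  Tm mu (fun i => u i - v i) g k + Tm mu v (fun i => g i - h i) k.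
Proof.
move=> bm hu hv hg hh; have hd := H1B hu hv; have hd2 := H1B hg hh.
have e : (fun i => u i - v i + v i) = u by apply/funext => i; rewrite subrK.
have e' : (fun i => g i - h i + h i) = g by apply/funext => i; rewrite subrK.
have := TmDl m0 k bm hd hv hg; rewrite e => ->.
have := TmDr m0 k bm hv hd2 hh; rewrite e' => ->.
by rewrite addrA addrK.
Qed.

Let diff_alg (c cu cv x x' r a a' r' b b' r'' : R[i]) :
  x - x' = r -> a - a' = r' -> b - b' = r'' ->
  cu + x + c * (a + b) - (cv + x' + c * (a' + b')) = cu - cv + r + c * (r' + r'').
Proof. by move=> <- <- <-; ring. Qed.

(** Stability in H^1 follows from the boundedness of the quadratic forms, since
    the symbol of the scheme is bounded by a multiple of tau. *)
Lemma stepS_lip tau T u v A D : 0 < tau <= T -> N1 u A -> N1 v A ->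
  N1 (fun k => u k - v k) D ->
  N1 (fun k => stepS tau u k - stepS tau v k) ((1 + tau * lip_cst T A) * D).
Proof.
move=> /andP[t0 tT] uA vA dD; have A0 := l2_le_ge0 uA; have D0 := l2_le_ge0 dD.
have hu : H1 u by exists A. have hv : H1 v by exists A.
have gu := l2_le_nlS uA; have gv := l2_le_nlS vA.
have hgu : H1 (nlS u) by exists (K * (A * A)).
have hgv : H1 (nlS v) by exists (K * (A * A)).
have bX : bdd (symX m tau tau) by exists (10 * tau); exact: symX_step.
have obd := @onem_bdd R.
have dg : N1 (fun k => nlS u k - nlS v k) (2 * (K * (A * D))).
  have := l2_leD W0 (Tm_bound m0 dD uA obd) (Tm_bound m0 vA dD obd).
  rewrite !mul1r => H; apply: l2_le_monoM (l2_le_ext _ H); first by rewrite [D * A]mulrC; lra.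
  by move=> k; rewrite /nonlin Tm_diff.
have C1 := l2_leD W0 (Tm_bound m0 dD uA (symX_step m0 t0)) (Tm_bound m0 vA dD (symX_step m0 t0)).
have C2 := l2_leD W0 (Tm_bound m0 dD gu obd) (Tm_bound m0 vA dg obd).
have C3 := l2_leD W0 (Tm_bound m0 dg uA obd) (Tm_bound m0 gv dD obd).
have C4 := l2_leZ (tau ^+ 2 / 2)%:C W0 (l2_leD W0 C2 C3).
have := l2_le_cis (fun k => tau * w k) (l2_leD W0 (l2_leD W0 dD C1) C4).
move=> H; apply: l2_le_monoM (l2_le_ext _ H).
  rewrite normcR ger0_norm ?divr_ge0 ?sqr_ge0//.
  have P2 : 0 <= K ^+ 2 * A ^+ 2 * D by rewrite !mulr_ge0.
  have t2 : tau ^+ 2 <= tau * T by rewrite expr2 ler_wpM2l// ltW.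
  have := ler_wpM2r P2 t2; rewrite /lip_cst; lra.
move=> k; rewrite /stepS -mulrBr /twisted /Dnonlin; congr (_ * _).
apply: esym; exact: (diff_alg _ _ _ (Tm_diff k bX hu hv) (Tm_diff2 k b1 hu hv hgu hgv)
  (Tm_diff2 k b1 hgu hgv hu hv)).
Qed.

(** Passing to the variable transported back by the free flow multiplies the
    symbol of the nonlinearity by the oscillations of the phase. *)
Lemma Tm_twist s a k : H1 a ->
  nlS (fun i => cis (s * w i) * a i) k = cis (s * w k) * Tm (chi s) a a k.
Proof.
move=> ha; have bc : bdd (chi s) by exists 1; exact: chi_bound.
rewrite -TmZ// /nonlin /quad_form /Qm.
have stE i : star (fun i => cis (s * w i) * a i) i = cis (- (s * w i)) * star a i.
  by rewrite /star conjcM japN cisN.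
have E (x y z : Z3) (e1 e2 : R) (b c : R[i]) : cis (s * w x) * cis (s * (e1 * w y + e2 * w z - w x)) =
   cis (s * (e1 * w y)) * cis (s * (e2 * w z)).
  by rewrite -!cisD; congr cis; ring.
congr (_ * (_ + _ * _ + _)); apply: csum_ext => j;
  rewrite ?stE /flow_phase /phase /sg /= subrKC E// ?mul1r ?mulN1r ?mulrN; ring.
Qed.

Lemma continuous_shift T (f : R -> R) t tau : 0 <= t -> t + tau <= T ->
  {within `[0, T], continuous f} -> {within `[0, tau], continuous (fun r => f (t + r))}.
Proof.
move=> t0 tT /subspace_continuousP H; apply/subspace_continuousP => x.
rewrite /= in_itv/= => /andP[x0 xt].
have xT : t + x \in `[0, T] by rewrite in_itv/= addr_ge0//= (le_trans _ tT)// lerD2l.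
apply: (@cvg_comp _ _ _ (fun r => t + r) f _ _ _ _ (H _ xT)).
move=> P [e /= e0 Pe]; exists e => //= r xr.
rewrite in_itv/= => /andP[r0 rt]; apply: Pe => /=.
  by rewrite opprD addrACA subrr add0r.
by rewrite in_itv/= addr_ge0//= (le_trans _ tT)// lerD2l.
Qed.

Lemma ccont_shift T f t tau : 0 <= t -> t + tau <= T -> ccont T f ->
  @ccont R tau (fun r => f (t + r)).
Proof.
by move=> t0 tT [f1 f2]; split;
  [exact: (continuous_shift t0 tT f1)|exact: (continuous_shift t0 tT f2)].
Qed.

Lemma ccontM T (f g : R -> R[i]) : ccont T f -> ccont T g -> ccont T (fun s => f s * g s).
Proof.
move=> [f1 f2] [g1 g2]; split.
  have -> : (fun r => Re (f r * g r)) = fun r => Re (f r) * Re (g r) - Im (f r) * Im (g r).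
    by apply/funext => r; rewrite cReM.
  by move=> x; apply: cvgB; apply: cvgM; [exact: f1|exact: g1|exact: f2|exact: g2].
have -> : (fun r => Im (f r * g r)) = fun r => Re (f r) * Im (g r) + Im (f r) * Re (g r).
  by apply/funext => r; rewrite cImM.
by move=> x; apply: cvgD; apply: cvgM; [exact: f1|exact: g2|exact: f2|exact: g1].
Qed.

Section Global.
Variables (T M : R) (U : R -> Z3 -> R[i]).
Hypothesis T0 : 0 < T.
Hypothesis UM : forall t, 0 <= t <= T -> N74 (U t) M.
Hypothesis Uc : forall k, ccont T (fun t => U t k).
Hypothesis Ud : forall t k, 0 < t < T ->
  cder (fun r => U r k) t ('i * (w k)%:C * U t k + nlS (U t) k).

Let M1 := em * M.
Let M0 : 0 <= M. Proof. by apply: (@l2_le_ge0 _ _ _ (U 0)); apply: UM; rewrite lexx ltW. Qed.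
Let M10 : 0 <= M1. Proof. exact: mulr_ge0. Qed.

(** The local error along the solution, transported forward again by the free
    flow, which is an isometry. *)
Lemma one_step_error t tau : 0 <= t -> 0 < tau -> t + tau <= T ->
  N1 (fun k => U (t + tau) k - stepS tau (U t) k) (local_cst m M * tau ^+ 3).
Proof.
move=> t0 tau0 tT.
pose p s k := cis (s * - w k) * U (t + s) k.
have p0 : p 0 = U t by apply/funext => k; rewrite /p mul0r cis0 mul1r addr0.
have inT s : 0 <= s <= tau -> 0 <= t + s <= T.
  by move=> /andP[s0 sT]; rewrite addr_ge0//= (le_trans _ tT)// lerD2l.
have Uk s k : U (t + s) k = cis (s * w k) * p s k.
  by rewrite /p mulrA -cisD mulrN subrr cis0 mul1r.
have pM s : 0 <= s <= tau -> N74 (p s) M.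
  move=> /inT h; rewrite -[M]mul1r; apply: (l2_le_mul _ _ _ (UM h)) => //.
    exact: w74_ge0.
  by move=> k; rewrite normc_cis.
have := @local_error _ m m0 tau M p tau0 _ _ pM; rewrite p0 => H.
have {}H := l2_le_cis (fun k => tau * w k) (H _ _).
apply: l2_le_ext (H _ _) => [k|k|s k h].
- by rewrite mulrBr -Uk.
- apply: ccontM; last exact: (ccont_shift t0 tT (Uc k)).
  by apply: cder_ccont => s _; exact: cder_cis.
- have tsT : 0 < t + s < T.
    by move: h => /andP[s0 sT]; rewrite ltr_wpDl//= (lt_le_trans _ tT)// ltrD2l.
  have := cderM (cder_cis (- w k) s) (cder_shift (Ud k tsT)).
  congr (cder _ _ _).
  have hp : H1 (p s).
    by exists M1; apply: l2_le_1_74 => //; apply: pM; move: h => /andP[/ltW -> /ltW ->].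
  have -> : U (t + s) = fun i => cis (s * w i) * p s i by apply/funext => i; exact: Uk.
  rewrite Tm_twist// mulrN cisN.
  have c1 : conjc (cis (s * w k)) * cis (s * w k) = 1 :> R[i].
    by rewrite -cisN -cisD addNr cis0.
  rewrite rmorphN/=.
  have -> : 'i * - (w k)%:C * conjc (cis (s * w k)) * (cis (s * w k) * p s k) +
    conjc (cis (s * w k)) * ('i * (w k)%:C * (cis (s * w k) * p s k) +
      cis (s * w k) * Tm (chi s) (p s) (p s) k) =
    (conjc (cis (s * w k)) * cis (s * w k)) * Tm (chi s) (p s) (p s) k by ring.
  by rewrite c1 mul1r.
Qed.

Let A := M1 + 1.
Let L := lip_cst T A.
Let C1 := local_cst m M.
Let C2 := C1 * T * expR (L * T) + 1.
Let V tau n := iter n (stepS tau) (U 0).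

Let A0 : 0 <= A. Proof. exact: addr_ge0. Qed.
Let L0 : 0 <= L.
Proof.
have T1 := ltW T0.
have h1 : 0 <= K * A by rewrite mulr_ge0.
have h2 : 0 <= T * (K ^+ 2 * A ^+ 2) by rewrite mulr_ge0// mulr_ge0// sqr_ge0.
by rewrite /L /lip_cst; lra.
Qed.
Let C10 : 0 <= C1. Proof. exact: (local_cst_ge0 T0 UM). Qed.
Let C20 : 0 < C2. Proof.
have h : 0 <= C1 * T * expR (L * T) by rewrite !mulr_ge0 ?expR_ge0// ltW.
by rewrite /C2; lra.
Qed.

Let N1U t : 0 <= t <= T -> N1 (U t) M1. Proof. by move=> /UM; exact: l2_le_1_74. Qed.

Let gron (n : nat) tau : 0 < tau -> n%:R * tau <= T ->
  n%:R * C1 * tau ^+ 3 * (1 + tau * L) ^+ n <= C2 * tau ^+ 2.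
Proof.
move=> t0 nt.
have e1 : (1 + tau * L) ^+ n <= expR (L * T).
  apply: (@le_trans _ _ (expR (tau * L) ^+ n)).
    rewrite lerXn2r ?nnegrE ?expR_ge0 ?addr_ge0 ?mulr_ge0 ?(ltW t0)//.
    exact: expR_ge1Dx.
  rewrite -expRM_natl ler_expR.
  have := ler_wpM2r L0 nt; rewrite -mulr_natl; lra.
have p1 : 0 <= n%:R * C1 * tau ^+ 3 by rewrite !mulr_ge0 ?exprn_ge0// ltW.
apply: le_trans (ler_wpM2l p1 e1) _.
have p2 : 0 <= C1 * tau ^+ 2 * expR (L * T) by rewrite !mulr_ge0 ?expR_ge0 ?sqr_ge0 ?(ltW t0) //.
have := ler_wpM2l p2 nt; have := sqr_ge0 tau; rewrite /C2; lra.
Qed.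

Let V_bound tau n : N1 (fun k => U (n%:R * tau) k - V tau n k) 1 ->
  0 <= n%:R * tau <= T -> N1 (V tau n) A.
Proof.
move=> H nt; have := l2_leB W0 (N1U nt) H; apply: l2_le_ext => k; ring.
Qed.

Let small_steps tau : 0 < tau -> C2 * tau ^+ 2 <= 1 -> forall n, n%:R * tau <= T ->
  N1 (fun k => U (n%:R * tau) k - V tau n k) (n%:R * C1 * tau ^+ 3 * (1 + tau * L) ^+ n).
Proof.
move=> t0 C2t; elim=> [_|n IH nT].
  rewrite !mul0r; apply: l2_le_ext (l2_le0 _) => k; by rewrite subrr.
have nt' : n%:R * tau <= T.
  by apply: le_trans nT; rewrite ler_wpM2r ?(ltW t0)// ler_nat.
have ntT : 0 <= n%:R * tau <= T by rewrite nt' mulr_ge0// ltW.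
have tT : 0 < tau <= T.
  rewrite t0 (le_trans _ nT)//; rewrite -natr1 mulrDl mul1r lerDr.
  by rewrite mulr_ge0// ltW.
have H := IH nt'.
have VA : N1 (V tau n) A.
  apply: V_bound ntT; apply: l2_le_monoM H; apply: le_trans C2t; exact: gron.
have UA : N1 (U (n%:R * tau)) A by apply: l2_le_monoM (N1U ntT); rewrite lerDl.
have S1 := stepS_lip tT UA VA H.
have nS : n.+1%:R * tau = n%:R * tau + tau by rewrite -natr1 mulrDl mul1r.
have S2 : N1 (fun k => U (n%:R * tau + tau) k - stepS tau (U (n%:R * tau)) k) (C1 * tau ^+ 3).
  by apply: one_step_error => //; [case/andP: ntT|rewrite -nS].
have := l2_leD W0 S2 S1; rewrite nS => S3.
apply: l2_le_monoM (l2_le_ext _ S3); last by move=> k; rewrite /V iterS; ring.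
have e0 : 0 <= tau * L by rewrite mulr_ge0// ltW.
have e1 : 1 <= (1 + tau * L) ^+ n.+1 by rewrite exprn_ege1// lerDl.
have c0 : 0 <= C1 * tau ^+ 3 by rewrite mulr_ge0// exprn_ge0// ltW.
have := ler_wpM2l c0 e1; rewrite -/L [(1 + tau * L) ^+ n.+1]exprS -[n.+1%:R]natr1; lra.
Qed.

Let S a := a + 10 * T * (K * (a * a)) + T ^+ 2 * (K * (a * (K * (a * a)))).

Let S_ge a : 0 <= a -> a <= S a.
Proof.
move=> a0; rewrite /S -addrA lerDl addr_ge0// !mulr_ge0// ?sqr_ge0// ltW//.
Qed.

Let iterS_ge n : 0 <= iter n S M1.
Proof.
by elim: n => //= n IH; apply: le_trans IH (S_ge IH).
Qed.

Let V_any tau n : 0 < tau <= T -> N1 (V tau n) (iter n S M1).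
Proof.
move=> tT; elim: n => [|n IH]; first by apply: N1U; rewrite lexx ltW.
exact: l2_le_stepS.
Qed.

Let iterS_mono n p : (n <= p)%N -> iter n S M1 <= iter p S M1.
Proof.
move=> /subnK <-; elim: (p - n)%N => // q IH.
by rewrite addSn iterS; apply: le_trans IH (S_ge (iterS_ge _)).
Qed.

(** For small steps this is the telescoping of local errors by stability, where
    the numerical solution stays in a ball as long as the error is at most 1. If
    C2 tau^2 > 1 the number of steps is bounded; the crude growth bound of each
    step is then absorbed in the constant. *)
Lemma global_error : exists C, 0 < C /\ forall tau n, 0 < tau -> n%:R * tau <= T ->
  N1 (fun k => U (n%:R * tau) k - iter n (stepS tau) (U 0) k) (C * tau ^+ 2).
Proof.
(* bounds the number of steps when C2 tau^2 > 1 *)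
pose N := Num.bound (T ^+ 2 * C2).
have P : 0 <= (M1 + iter N S M1) * C2 by apply: mulr_ge0; [apply: addr_ge0 => //; exact: iterS_ge | exact: ltW].
exists (C2 + (M1 + iter N S M1) * C2); split; first by rewrite ltr_pwDl.
move=> tau n t0 nT; have t2 : 0 <= tau ^+ 2 := sqr_ge0 tau.
have [C2t|C2t] := leP (C2 * tau ^+ 2) 1.
  apply: l2_le_monoM (small_steps t0 C2t nT).
  by apply: le_trans (gron t0 nT) _; rewrite [leRHS]mulrDl lerDl mulr_ge0.
case: n nT => [_|n nT].
  rewrite mul0r; apply: (@l2_le_monoM _ _ _ _ 0); last by apply: l2_le_ext (l2_le0 _) => k; rewrite /= subrr.
  by apply: mulr_ge0 => //; apply: addr_ge0 => //; exact: ltW.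
have tT : 0 < tau <= T.
  rewrite t0 (le_trans _ nT)//; rewrite -natr1 mulrDl mul1r lerDr.
  by rewrite mulr_ge0// ltW.
have nN : (n.+1 <= N)%N.
  rewrite -(@ler_nat R).
  have h1 : (n.+1%:R * tau) ^+ 2 <= T ^+ 2.
    by rewrite lerXn2r ?nnegrE// ?mulr_ge0 ?(ltW t0)// ltW.
  have h2 : n.+1%:R <= n.+1%:R ^+ 2 :> R by rewrite expr2 -natrM ler_nat leq_pmulr.
  have h3 : n.+1%:R ^+ 2 <= T ^+ 2 * C2.
    have q0 : 0 <= n.+1%:R ^+ 2 :> R by exact: sqr_ge0.
    have := ler_wpM2l q0 (ltW C2t); have := ler_wpM2r (ltW C20) h1; rewrite exprMn; lra.
  apply: (le_trans h2); apply: (le_trans h3); apply: ltW.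
  by apply: archi_boundP; rewrite mulr_ge0 ?sqr_ge0 ?(ltW C20).
have ntT : 0 <= n.+1%:R * tau <= T by rewrite nT mulr_ge0// ltW.
apply: l2_le_monoM (l2_leB W0 (N1U ntT) (V_any n.+1 tT)).
apply: (@le_trans _ _ (M1 + iter N S M1)); first by rewrite lerD2l iterS_mono.
have Q : 0 <= M1 + iter N S M1 by apply: addr_ge0 => //; exact: iterS_ge.
have := ler_wpM2l Q (ltW C2t); have : 0 <= C2 * tau ^+ 2 by apply: mulr_ge0 => //; exact: ltW.
lra.
Qed.

End Global.
End GlobalError.

(** * Integration of complex valued functions *)

Section Integrals.
Context {R : realType} {d : measure_display} {T : measurableType d}.
Variable mu : subprobability T R.
Implicit Types f g h : T -> R.

Definition intg f := mu.-integrable setT (EFin \o f).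
Local Notation I f := (Rintegral mu setT f).

Lemma intg_meas f : intg f -> measurable_fun setT f.
Proof. by move=> /measurable_int /measurable_EFinP. Qed.

Lemma intg_ext f g : f =1 g -> intg f -> intg g.
Proof. by move=> /funext ->. Qed.

Lemma I_ext f g : f =1 g -> I f = I g.
Proof. by move=> /funext ->. Qed.

(** Bounded measurable functions, which multiply integrable ones. *)
Definition bm f := measurable_fun setT f /\ exists B, forall x, `|f x| <= B.

Lemma bm_bounded f B : (forall x, `|f x| <= B) -> [bounded f x | x in setT].
Proof.
move=> fB; exists B; split; first exact: num_real.
by move=> M BM x _ /=; rewrite (le_trans (fB x))// ltW.
Qed.

Lemma sprob_lty : (mu setT < +oo)%E.
Proof. by rewrite -ge0_fin_numE// fin_num_measure. Qed.

Lemma bm_intg f : bm f -> intg f.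
Proof.
move=> [mf [B fB]]; apply: measurable_bounded_integrable => //.
  exact: sprob_lty.
exact: bm_bounded fB.
Qed.

Lemma intg_bm f g : intg f -> bm g -> intg (fun x => f x * g x).
Proof.
move=> fi [mg [B gB]].
by have := integrableMl measurableT fi mg (bm_bounded gB); apply: eq_integrable.
Qed.

Lemma intgD f g : intg f -> intg g -> intg (fun x => f x + g x).
Proof. by move=> fi gi; have := integrableD measurableT fi gi; apply: eq_integrable. Qed.

Lemma intgZ r f : intg f -> intg (fun x => r * f x).
Proof. by move=> fi; have := integrableZl measurableT r fi; apply: eq_integrable. Qed.

Lemma intgB f g : intg f -> intg g -> intg (fun x => f x - g x).
Proof. by move=> fi gi; have := integrableB measurableT fi gi; apply: eq_integrable. Qed.

Lemma intg_norm f : intg f -> intg (fun x => `|f x|).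
Proof. exact: integrable_norm. Qed.

Lemma intg_cst r : intg (fun=> r).
Proof. by apply: bm_intg; split=> //; exists `|r|. Qed.

Lemma intg_le f g : measurable_fun setT f -> (forall x, `|f x| <= g x) -> intg g -> intg f.
Proof.
move=> mf fg gi; apply: (le_integrable measurableT) gi.
  exact/measurable_EFinP.
move=> x _ /=; rewrite lee_fin (le_trans (fg x))// ler_norm//.
Qed.

Lemma I_D f g : intg f -> intg g -> I (fun x => f x + g x) = I f + I g.
Proof. exact: RintegralD. Qed.

Lemma I_B f g : intg f -> intg g -> I (fun x => f x - g x) = I f - I g.
Proof. exact: RintegralB. Qed.

Lemma I_Z r f : intg f -> I (fun x => r * f x) = r * I f.
Proof. exact: RintegralZl. Qed.

Lemma I_le f g : intg f -> intg g -> (forall x, f x <= g x) -> I f <= I g.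
Proof. by move=> fi gi fg; exact: le_Rintegral. Qed.

Lemma I_ge0 f : (forall x, 0 <= f x) -> 0 <= I f.
Proof. by move=> f0; apply: Rintegral_ge0. Qed.

Lemma I_norm f : intg f -> `|I f| <= I (fun x => `|f x|).
Proof. exact: le_normr_Rintegral. Qed.

Lemma I_cst_le r : 0 <= r -> I (fun=> r) <= r.
Proof.
move=> r0; rewrite Rintegral_cst// -[leRHS]mulr1 ler_wpM2l//.
rewrite -lee_fin fineK ?fin_num_measure//.
exact: sprobability_setT.
Qed.

Lemma I_EFin f : intg f -> (\int[mu]_x (f x)%:E = (I f)%:E)%E.
Proof. by move=> fi; rewrite fineK//; exact: integrable_fin_num. Qed.

Lemma intg_sum (J : Type) (s : seq J) (F : J -> T -> R) :
  (forall j, intg (F j)) -> intg (fun x => \sum_(j <- s) F j x).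
Proof.
move=> Fi; elim: s => [|a s IH].
  by apply: intg_ext (intg_cst 0) => x; rewrite big_nil.
by apply: intg_ext (intgD (Fi a) IH) => x; rewrite big_cons.
Qed.

Lemma I_sum (J : Type) (s : seq J) (F : J -> T -> R) :
  (forall j, intg (F j)) -> I (fun x => \sum_(j <- s) F j x) = \sum_(j <- s) I (F j).
Proof.
move=> Fi; elim: s => [|a s IH].
  rewrite big_nil; have -> : (fun x => \sum_(j <- [::]) F j x) = fun=> 0.
    by apply/funext => x; rewrite big_nil.
  by rewrite Rintegral_cst// mul0r.
rewrite big_cons -IH -I_D//; last exact: intg_sum.
by apply: I_ext => x; rewrite big_cons.
Qed.

(** Dominated convergence for real valued functions. *)
Lemma I_cvg (f_ : nat -> T -> R) f g :
  (forall n, measurable_fun setT (f_ n)) ->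
  (forall x, f_ ^~ x @ \oo --> f x) ->
  (forall n x, `|f_ n x| <= g x) -> intg g ->
  intg f /\ (fun n => I (f_ n)) @ \oo --> I f.
Proof.
move=> mf ff fg gi.
have mfl : measurable_fun setT f.
  by apply: (@measurable_fun_cvg _ _ _ setT f_) => // x _; exact: ff.
have fgl x : `|f x| <= g x.
  have c : (fun n => `|f_ n x|) @ \oo --> `|f x| by apply: cvg_norm; exact: ff.
  rewrite -(cvg_lim _ c)//; apply: limr_le; first exact: cvgP c.
  by near=> n; exact: fg.
have fi : intg f := intg_le mfl fgl gi.
split=> //.
have [|||||_ _ H] := @dominated_convergence _ T R mu setT measurableT
   (fun n => EFin \o f_ n) (EFin \o f) (EFin \o g) => //.
- by move=> n; exact/measurable_EFinP.
- exact/measurable_EFinP.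
- by apply: aeW => x _; apply/fine_cvgP; split; [near=> n|exact: ff].
- by apply: aeW => x n _; rewrite /= lee_fin.
have fin n : intg (f_ n) by exact: intg_le (mf n) (fg n) gi.
have : (fun n => (I (f_ n))%:E) @ \oo --> (I f)%:E.
  by rewrite -(I_EFin fi); under eq_fun do rewrite -I_EFin//.
by move=> /fine_cvgP[].
Unshelve. all: by end_near. Qed.

Lemma ae_I_eq f g : intg f -> measurable_fun setT g ->
  {ae mu, forall x, f x = g x} -> I f = I g.
Proof.
move=> fi mg fg; congr fine; apply: ae_eq_integral => //.
- exact: measurable_int fi.
- exact/measurable_EFinP.
- by apply: filterS fg => x /= -> _.
Qed.

Lemma ae_intg f g : intg f -> measurable_fun setT g ->
  {ae mu, forall x, f x = g x} -> intg g.
Proof.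
move=> fi mg fg; apply/integrableP; split; first exact/measurable_EFinP.
have /integrableP[_] := fi; apply: le_lt_trans.
rewrite le_eqVlt; apply/orP; left; apply/eqP; apply: ae_eq_integral => //.
- by apply: measurableT_comp => //; exact/measurable_EFinP.
- by apply: measurableT_comp => //; exact: measurable_int fi.
- by apply: filterS fg => x /= -> _.
Qed.

Implicit Types F G : T -> R[i].

(** Complex valued functions are measured and integrated through their real and
    imaginary parts. *)
Definition cmeas F := measurable_fun setT (fun x => Re (F x)) /\
  measurable_fun setT (fun x => Im (F x)).
Definition cintg F := intg (fun x => Re (F x)) /\ intg (fun x => Im (F x)).
Definition cint F : R[i] := I (fun x => Re (F x)) +i* I (fun x => Im (F x)).

Lemma cintg_meas F : cintg F -> cmeas F.
Proof. by move=> [f1 f2]; split; exact: intg_meas. Qed.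

Lemma cint_ext F G : F =1 G -> cint F = cint G.
Proof. by move=> /funext ->. Qed.

Lemma cmeasD F G : cmeas F -> cmeas G -> cmeas (fun x => F x + G x).
Proof.
move=> [f1 f2] [g1 g2]; split.
  under eq_fun do rewrite cReD; exact: measurable_funD.
under eq_fun do rewrite cImD; exact: measurable_funD.
Qed.

Lemma cmeasM F G : cmeas F -> cmeas G -> cmeas (fun x => F x * G x).
Proof.
move=> [f1 f2] [g1 g2]; split.
  under eq_fun do rewrite cReM; apply: measurable_funB; exact: measurable_funM.
under eq_fun do rewrite cImM; apply: measurable_funD; exact: measurable_funM.
Qed.

Lemma cmeas_cst c : cmeas (fun=> c).
Proof. by split; exact: measurable_cst. Qed.

Lemma cmeasZ c F : cmeas F -> cmeas (fun x => c * F x).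
Proof. by apply: cmeasM; exact: cmeas_cst. Qed.

Lemma cmeas_conj F : cmeas F -> cmeas (fun x => conjc (F x)).
Proof.
move=> [f1 f2]; split; first by under eq_fun do rewrite cRe_conj.
under eq_fun do rewrite cIm_conj; exact: measurable_funN.
Qed.

Lemma cmeas_normc F : cmeas F -> measurable_fun setT (fun x => normc (F x) ^+ 2).
Proof.
move=> [f1 f2]; under eq_fun do rewrite normc_sqrE.
by apply: measurable_funD; exact: measurable_funX.
Qed.

Lemma cmeas_normc1 F : cmeas F -> measurable_fun setT (fun x => normc (F x)).
Proof.
move=> mF.
have -> : (fun x => normc (F x)) = Num.sqrt \o (fun x => normc (F x) ^+ 2).
  by apply/funext => x /=; rewrite sqrtr_sqr ger0_norm ?normc_ge0.
apply: measurableT_comp; last exact: cmeas_normc.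
by apply: continuous_measurable_fun; exact: sqrt_continuous.
Qed.

Lemma cintg_normc F : cmeas F -> intg (fun x => normc (F x)) -> cintg F.
Proof.
move=> [m1 m2] nF; split.
  by apply: intg_le nF => // x; exact: Re_le_normc.
by apply: intg_le nF => // x; exact: Im_le_normc.
Qed.

Lemma normc_cintg F : cintg F -> intg (fun x => normc (F x)).
Proof.
move=> cF; have [f1 f2] := cF.
apply: (intg_le (cmeas_normc1 (cintg_meas cF))) (intgD (intg_norm f1) (intg_norm f2)) => x.
by rewrite ger0_norm ?normc_ge0// normc_le_ReIm.
Qed.

Lemma cintgD F G : cintg F -> cintg G -> cintg (fun x => F x + G x).
Proof.
move=> [f1 f2] [g1 g2]; split.
  by apply: intg_ext (intgD f1 g1) => x; rewrite cReD.
by apply: intg_ext (intgD f2 g2) => x; rewrite cImD.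
Qed.

Lemma cintgZ c F : cintg F -> cintg (fun x => c * F x).
Proof.
move=> [f1 f2]; split.
  by apply: intg_ext (intgB (intgZ (Re c) f1) (intgZ (Im c) f2)) => x; rewrite cReM.
by apply: intg_ext (intgD (intgZ (Re c) f2) (intgZ (Im c) f1)) => x; rewrite cImM.
Qed.

Lemma cintD F G : cintg F -> cintg G -> cint (fun x => F x + G x) = cint F + cint G.
Proof.
move=> [f1 f2] [g1 g2]; apply: complexP.
  by rewrite cReD /= -I_D//; apply: I_ext => x; rewrite cReD.
by rewrite cImD /= -I_D//; apply: I_ext => x; rewrite cImD.
Qed.

Lemma cintZ c F : cintg F -> cint (fun x => c * F x) = c * cint F.
Proof.
move=> [f1 f2]; apply: complexP.
  rewrite cReM /= -!I_Z// -I_B; [|exact: intgZ|exact: intgZ].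
  by apply: I_ext => x; rewrite cReM.
rewrite cImM /= -!I_Z// -I_D; [|exact: intgZ|exact: intgZ].
by apply: I_ext => x; rewrite cImM.
Qed.

Lemma cintgB F G : cintg F -> cintg G -> cintg (fun x => F x - G x).
Proof.
by move=> cF cG; have := cintgD cF (cintgZ (-1) cG); under eq_fun do rewrite mulN1r.
Qed.

Lemma cint_conj F : cintg F -> cint (fun x => conjc (F x)) = conjc (cint F).
Proof.
move=> [f1 f2]; apply: complexP.
  by rewrite cRe_conj; apply: I_ext => x; rewrite cRe_conj.
rewrite cIm_conj /= -mulN1r -I_Z//; apply: I_ext => x.
by rewrite cIm_conj mulN1r.
Qed.

Lemma cint_sum (J : Type) (s : seq J) (F : J -> T -> R[i]) :
  (forall j, cintg (F j)) -> cint (fun x => \sum_(j <- s) F j x) = \sum_(j <- s) cint (F j).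
Proof.
move=> Fi; apply: complexP.
  rewrite cRe_sum -(I_sum s (fun j => (Fi j).1)).
  by apply: I_ext => x; rewrite cRe_sum.
rewrite cIm_sum -(I_sum s (fun j => (Fi j).2)).
by apply: I_ext => x; rewrite cIm_sum.
Qed.

Lemma cint_le F : cintg F -> normc (cint F) <= 2 * I (fun x => normc (F x)).
Proof.
move=> cF; have [f1 f2] := cF; have nF := normc_cintg cF.
apply: le_trans (normc_le_ReIm _) _; rewrite mulr_natl mulr2n; apply: lerD.
  apply: le_trans (I_norm f1) _; apply: I_le => //; first exact: intg_norm.
  by move=> x; exact: Re_le_normc.
apply: le_trans (I_norm f2) _; apply: I_le => //; first exact: intg_norm.
by move=> x; exact: Im_le_normc.
Qed.

Definition cbm F := cmeas F /\ exists B, forall x, normc (F x) <= B.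

Lemma cbm_cintg F : cbm F -> cintg F.
Proof.
move=> [mF [B FB]]; apply: cintg_normc => //.
apply: bm_intg; split; first exact: cmeas_normc1.
by exists B => x; rewrite ger0_norm ?normc_ge0.
Qed.

Lemma cintgMb F G : cintg F -> cbm G -> cintg (fun x => F x * G x).
Proof.
move=> cF [mG [B GB]]; apply: cintg_normc.
  by apply: cmeasM => //; exact: cintg_meas.
have bG : bm (fun x => normc (G x)).
  by split; [exact: cmeas_normc1|exists B => x; rewrite ger0_norm ?normc_ge0].
by apply: intg_ext (intg_bm (normc_cintg cF) bG) => x; rewrite Normc.normcM.
Qed.

Lemma ae_cint_eq F G : cintg F -> cmeas G -> {ae mu, forall x, F x = G x} ->
  cint F = cint G.
Proof.
move=> [f1 f2] [g1 g2] FG; apply: complexP; apply: ae_I_eq => //;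
 by apply: filterS FG => x /= ->.
Qed.

End Integrals.

Section ProductIntegrals.
Context {R : realType} {d1 d2 : measure_display}.
Context {T1 : measurableType d1} {T2 : measurableType d2}.
Variables (m1 : subprobability T1 R) (m2 : subprobability T2 R).

(** Fubini's theorem for products of bounded functions of one variable each. *)
Lemma I_prod (f : T1 -> R) (g : T2 -> R) : bm f -> bm g ->
  Rintegral (product_subprobability (m1, m2)) setT (fun z => f z.1 * g z.2) =
  Rintegral m1 setT f * Rintegral m2 setT g.
Proof.
move=> bf bg.
have bfg : bm (fun z : T1 * T2 => f z.1 * g z.2).
  have [mf [B fB]] := bf; have [mg [C gC]] := bg; split.
    by apply: measurable_funM; exact: measurableT_comp.
  by exists (B * C) => z; rewrite normrM ler_pM.
have if_ := bm_intg m1 bf; have ig := bm_intg m2 bg.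
rewrite /Rintegral -(@integral12_prod_meas1 _ _ _ _ _ m1 m2 (fun z => (f z.1 * g z.2)%:E)).
  rewrite /fubini_F /=.
  under eq_integral => x _.
    under eq_integral do rewrite EFinM.
    rewrite integralZl// (I_EFin ig).
    over.
  rewrite integralZr// (I_EFin if_) -EFinM/=.
  by rewrite (I_EFin ig).
exact: (bm_intg (product_subprobability (m1, m2)) bfg).
Qed.

Lemma cint_prod (f : T1 -> R[i]) (g : T2 -> R[i]) : cbm f -> cbm g ->
  cint (product_subprobability (m1, m2)) (fun z => f z.1 * g z.2) =
  cint m1 f * cint m2 g.
Proof.
move=> [[mf mf'] [B fB]] [[mg mg'] [C gC]].
have b1 : bm (fun x => Re (f x)).
  by split=> //; exists B => x; rewrite (le_trans (Re_le_normc _)).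
have b2 : bm (fun x => Im (f x)).
  by split=> //; exists B => x; rewrite (le_trans (Im_le_normc _)).
have b3 : bm (fun x => Re (g x)).
  by split=> //; exists C => x; rewrite (le_trans (Re_le_normc _)).
have b4 : bm (fun x => Im (g x)).
  by split=> //; exists C => x; rewrite (le_trans (Im_le_normc _)).
have bp (u : T1 -> R) (v : T2 -> R) : bm u -> bm v ->
    intg (product_subprobability (m1, m2)) (fun z => u z.1 * v z.2).
  move=> [mu [D uD]] [mv [E vE]]; apply: bm_intg; split.
    by apply: measurable_funM; exact: measurableT_comp.
  by exists (D * E) => z; rewrite normrM ler_pM.
apply: complexP.
  rewrite cReM /= -!I_prod// -(I_B (bp _ _ b1 b3) (bp _ _ b2 b4)).
  by apply: I_ext => z; rewrite cReM.
rewrite cImM /= -!I_prod// -(I_D (bp _ _ b1 b4) (bp _ _ b2 b3)).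
by apply: I_ext => z; rewrite cImM.
Qed.

End ProductIntegrals.

(** * Characters of the torus *)

Section OneDimension.
Context {R : realType}.

Lemma haar1_setT : haar1 R setT = 1%E.
Proof. exact: probability_setT. Qed.

Lemma derivable_LR (F g : R -> R) a b : (forall x, is_derive x (1 : R) F (g x)) ->
  derivable_oo_LRcontinuous F a b.
Proof.
move=> dF.
have cF x : {for x, continuous F}.
  by apply: differentiable_continuous; apply/derivable1_diffP; exact: ex_derive.
split; first by move=> x _; exact: ex_derive.
- exact: (cvg_at_right_filter (cF a)).
- exact: (cvg_at_left_filter (cF b)).
Qed.

(** The fundamental theorem of calculus for a periodic primitive. The constant 1
    added in the proof makes the integrand nonnegative. *)
Lemma haar1_mean0 (F g : R -> R) : (forall x, is_derive x (1 : R) F (g x)) ->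
  continuous g -> (forall x, `|g x| <= 1) -> F (2 * pi) = F 0 ->
  Rintegral (haar1 R) setT g = 0.
Proof.
move=> dF cg g1 F2pi.
have mg : measurable_fun setT g by exact: continuous_measurable_fun.
have bg : bm g by split=> //; exists 1.
have ig := bm_intg (haar1 R : subprobability _ R) bg.
have i1 := intg_cst (haar1 R : subprobability _ R) (1 : R).
suff : Rintegral (haar1 R) setT (fun x => g x + 1) = 1.
  rewrite (I_D ig i1) Rintegral_cst// (_ : fine _ = 1); last exact: (congr1 fine haar1_setT).
  by move=> h; apply: (addIr 1); rewrite add0r -[RHS]h mulr1.
rewrite /Rintegral [X in fine X](_ : _ = 1%E)//.
rewrite (@integral_uniform _ _ _ (twopi_gt0 R) (fun x => (g x + 1)%:E)); last 2 first.
- by apply/measurable_EFinP; apply: measurable_funD.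
- move=> x; rewrite lee_fin; have := g1 x; rewrite ler_norml => /andP[]; lra.
have dG x : is_derive x (1 : R) (fun x => F x + x) (g x + 1).
  exact: is_derive_eqf (is_deriveD (dF x) (is_derive_id x 1)).
rewrite (@continuous_FTC2 _ (fun x => g x + 1) (fun x => F x + x)).
- rewrite F2pi addr0 subr0 -EFinB -EFinM; congr EFin.
  rewrite addrAC subrr add0r mulVf// gt_eqF// twopi_gt0//.
- exact: twopi_gt0.
- apply: continuous_subspaceT => x; apply: cvgD; [exact: cg|exact: cvg_cst].
- exact: derivable_LR dG.
- by move=> x _; rewrite derive1E; have := dG x => /@derive_val.
Qed.

Lemma cis_2pi_nat n : cis (n%:R * (2 * pi)) = 1 :> R[i].
Proof.
elim: n => [|n IH]; first by rewrite mul0r cis0.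
rewrite -natr1 mulrDl mul1r cisD IH mul1r.
by apply: complexP => /=; rewrite mulr_natl ?cos2pi ?sin2pi.
Qed.

Lemma cis_2pi (n : int) : cis (n%:~R * (2 * pi)) = 1 :> R[i].
Proof.
case: n => n; first exact: cis_2pi_nat.
by rewrite NegzE mulrNz mulNr cisN cis_2pi_nat conjc_real.
Qed.

Lemma continuous_cisM (A : R) :
  continuous (fun x : R => cos (x * A)) /\ continuous (fun x : R => sin (x * A)).
Proof.
have cA : continuous (fun x : R => x * A) by move=> x; apply: mulrr_continuous.
by split=> x; apply: continuous_comp; [exact: cA|exact: continuous_cos
  |exact: cA|exact: continuous_sin].
Qed.

Lemma haar1_cis (n : int) :
  cint (haar1 R : subprobability _ R) (fun x => cis (x * n%:~R)) = (n == 0)%:R.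
Proof.
have [->|n0] := eqVneq n 0.
  under [X in cint _ X]eq_fun do rewrite mulr0z mulr0 cis0.
  rewrite (_ : _%:R = 1)//; apply: complexP; rewrite /= Rintegral_cst// ?mul0r// mul1r.
  exact: (congr1 fine haar1_setT).
have A0 : n%:~R != 0 :> R by rewrite intr_eq0.
have dF x : cder (prim1 n%:~R) x (cis (x * n%:~R) : R[i]).
  apply: (@cder_quad _ _ _ _ (2 * `|n%:~R|)) => h.
  by rewrite [leRHS]mulrC; exact: prim1_quad.
have per : prim1 n%:~R (2 * pi) = prim1 n%:~R 0 :> R[i].
  by rewrite prim10 /prim1 [2 * pi * _]mulrC cis_2pi subrr mul0r.
have [cc cs] := continuous_cisM n%:~R.
apply: complexP => /=.
  apply: (@haar1_mean0 (fun x => Re (prim1 n%:~R x))) => //.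
  - by move=> x; exact: (dF x).1.
  - by move=> x; rewrite ler_norml cos_geN1 cos_le1.
  - by rewrite per.
apply: (@haar1_mean0 (fun x => Im (prim1 n%:~R x))) => //.
- by move=> x; exact: (dF x).2.
- by move=> x; rewrite ler_norml sin_geN1 sin_le1.
- by rewrite per.
Qed.

Lemma cbm_cisM (A : R) : cbm (fun x : measurableTypeR R => cis (x * A) : R[i]).
Proof.
have [cc cs] := continuous_cisM A; split; first split.
- exact: (continuous_measurable_fun cc).
- exact: (continuous_measurable_fun cs).
- by exists 1 => x; rewrite normc_cis.
Qed.

End OneDimension.

Section Characters.
Context {R : realType}.
Implicit Types (k j : Z3) (x : T3 R).

(** The characters of the torus. *)
Definition ek k x : R[i] := cis (dot3 k x).

Lemma dot3D j k x : dot3 (j + k) x = dot3 j x + dot3 k x.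
Proof. by rewrite /dot3 /= !intrD; ring. Qed.

Lemma dot3N k x : dot3 (- k) x = - dot3 k x.
Proof. by rewrite /dot3 /= !mulrNz; ring. Qed.

Lemma ekD j k x : ek (j + k) x = ek j x * ek k x.
Proof. by rewrite /ek dot3D cisD. Qed.

Lemma ekN k x : ek (- k) x = conjc (ek k x).
Proof. by rewrite /ek dot3N cisN. Qed.

Lemma ek0 x : ek 0 x = 1.
Proof. by rewrite /ek /dot3 /= !mulr0z !mul0r !addr0 cis0. Qed.

Lemma normc_ek k x : normc (ek k x) = 1. Proof. exact: normc_cis. Qed.

Lemma ek_prod k x :
  ek k x = (cis (x.1.1 * k.1.1%:~R) * cis (x.1.2 * k.1.2%:~R)) * cis (x.2 * k.2%:~R).
Proof. by rewrite -!cisD /ek /dot3; congr cis; ring. Qed.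

Lemma cbm_ek k : cbm (ek k).
Proof.
have [[c1 s1] _] := cbm_cisM (k.1.1%:~R : R).
have [[c2 s2] _] := cbm_cisM (k.1.2%:~R : R).
have [[c3 s3] _] := cbm_cisM (k.2%:~R : R).
split; last by exists 1 => x; rewrite normc_ek.
have f1 : measurable_fun setT (fun x : T3 R => x.1.1) by exact: measurableT_comp.
have f2 : measurable_fun setT (fun x : T3 R => x.1.2) by exact: measurableT_comp.
have -> : ek k = fun x => (cis (x.1.1 * k.1.1%:~R) * cis (x.1.2 * k.1.2%:~R)) * cis (x.2 * k.2%:~R).
  by apply/funext => x; exact: ek_prod.
apply: cmeasM; first apply: cmeasM.
- split; [exact: (measurableT_comp c1 f1)|exact: (measurableT_comp s1 f1)].
- split; [exact: (measurableT_comp c2 f2)|exact: (measurableT_comp s2 f2)].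
- split; [exact: (measurableT_comp c3 measurable_snd)|exact: (measurableT_comp s3 measurable_snd)].
Qed.

(** Orthogonality of the characters, factor by factor. *)
Lemma cint_ek k : cint (haar R) (ek k) = (k == 0)%:R.
Proof.
have -> : ek k = fun x => (cis (x.1.1 * k.1.1%:~R) * cis (x.1.2 * k.1.2%:~R)) * cis (x.2 * k.2%:~R).
  by apply/funext => x; exact: ek_prod.
have b12 : cbm (fun y : measurableTypeR R * measurableTypeR R =>
    cis (y.1 * k.1.1%:~R) * cis (y.2 * k.1.2%:~R) : R[i]).
  have [[c1 s1] _] := cbm_cisM (k.1.1%:~R : R).
  have [[c2 s2] _] := cbm_cisM (k.1.2%:~R : R).
  split; last by exists 1 => y; rewrite Normc.normcM !normc_cis mulr1.
  apply: cmeasM; split.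
  - exact: (measurableT_comp c1 measurable_fst).
  - exact: (measurableT_comp s1 measurable_fst).
  - exact: (measurableT_comp c2 measurable_snd).
  - exact: (measurableT_comp s2 measurable_snd).
rewrite (@cint_prod _ _ _ _ _ (product_subprobability (haar1 R : subprobability _ R,
   haar1 R : subprobability _ R)) (haar1 R : subprobability _ R)
  (fun y => cis (y.1 * k.1.1%:~R) * cis (y.2 * k.1.2%:~R)) (fun y => cis (y * k.2%:~R)) b12 (cbm_cisM _)).
rewrite (@cint_prod _ _ _ _ _ (haar1 R : subprobability _ R) (haar1 R : subprobability _ R)
  (fun y => cis (y * k.1.1%:~R)) (fun y => cis (y * k.1.2%:~R)) (cbm_cisM _) (cbm_cisM _)).
rewrite !haar1_cis; case: k {b12} => -[a b] c /=.
have -> : ((a, b, c) == 0) = [&& a == 0, b == 0 & c == 0].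
  by rewrite /eq_op /= /eq_op /= -andbA.
by case: eqP; case: eqP; case: eqP; rewrite ?mulr0 ?mul0r ?mulr1.
Qed.

Lemma fourierE (f : T3 R -> R[i]) k : fourier f k = cint (haar R) (fun x => f x * ek (- k) x).
Proof.
rewrite /fourier; congr integralC; apply/funext => x.
by rewrite -mulrN -rmorphN expC_im /ek dot3N.
Qed.

End Characters.

(** * From characters to indicators of boxes *)

Section Powers.
Context {R : realType}.

Lemma bernoulli_ge (y : R) N : 0 <= y <= 1 -> 1 - N%:R * y <= (1 - y) ^+ N.
Proof.
move=> /andP[y0 y1]; elim: N => [|N IH]; first by rewrite mul0r subr0 expr0.
rewrite exprS; have h : 0 <= 1 - y by rewrite subr_ge0.
apply: le_trans (ler_wpM2l h IH).
have : 0 <= N%:R * y ^+ 2 by rewrite mulr_ge0 ?sqr_ge0.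
rewrite -natr1; lra.
Qed.

Lemma bernoulli_le (y : R) N : 0 <= y <= 1 -> (1 - y) ^+ N * (1 + N%:R * y) <= 1.
Proof.
move=> /andP[y0 y1]; elim: N => [|N IH]; first by rewrite mul0r addr0 expr0 mul1r.
have p : 0 <= (1 - y) ^+ N by rewrite exprn_ge0// subr_ge0.
apply: le_trans IH; rewrite exprSr -mulrA ler_wpM2l// -natr1.
have : 0 <= N%:R * y ^+ 2 by rewrite mulr_ge0 ?sqr_ge0.
have := sqr_ge0 y; lra.
Qed.

(** The polynomials (1 - x^n)^(2^n) tend to the indicator of x < 1/2 on the unit
    interval, except at 1/2, by Bernoulli's inequality: they turn indicators into
    limits of polynomials in a given function. *)
Lemma step_poly_lt (x : R) : 0 <= x -> x < 2^-1 ->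
  (fun n => (1 - x ^+ n) ^+ (2 ^ n)) @ \oo --> (1 : R).
Proof.
move=> x0 x2; have x1 : x <= 1 by lra.
have h2 : `|2 * x| < 1 by rewrite ger0_norm; lra.
apply: (@squeeze_cvgr _ _ _ _ (fun n => 1 - (2 * x) ^+ n) (fun=> 1)).
- near=> n; have xn : 0 <= x ^+ n <= 1 by rewrite exprn_ge0//= exprn_ile1.
  apply/andP; split.
    by rewrite exprMn -natrX; exact: bernoulli_ge.
  by move: xn => /andP[q0 q1]; rewrite exprn_ile1// ?subr_ge0// lerBlDr lerDl.
- rewrite -[X in _ --> X]subr0; apply: cvgB; first exact: cvg_cst.
  exact: cvg_expr.
- exact: cvg_cst.
Unshelve. all: by end_near. Qed.

Lemma step_poly_gt (x : R) : 2^-1 < x -> x <= 1 ->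
  (fun n => (1 - x ^+ n) ^+ (2 ^ n)) @ \oo --> (0 : R).
Proof.
move=> x2 x1; have x0 : 0 < x by lra.
have h2 : `|(2 * x)^-1| < 1.
  by rewrite ger0_norm ?invr_ge0 ?invf_lt1; lra.
apply: (@squeeze_cvgr _ _ _ _ (fun=> 0) (fun n => (2 * x)^-1 ^+ n)).
- near=> n; have xn : 0 <= x ^+ n <= 1 by rewrite exprn_ge0 ?(ltW x0)//= exprn_ile1// ltW.
  have /andP[q0 q1] := xn.
  have p0 : 0 <= (1 - x ^+ n) ^+ (2 ^ n) by rewrite exprn_ge0// subr_ge0.
  apply/andP; split=> //; rewrite exprVn -[_^-1]mul1r.
  have px : 0 < (2 * x) ^+ n by rewrite exprn_gt0// mulr_gt0.
  rewrite ler_pdivlMr//; apply: le_trans (bernoulli_le (2 ^ n) xn).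
  rewrite ler_wpM2l// exprMn natrX lerDr//.
- exact: cvg_cst.
- exact: cvg_expr.
Unshelve. all: by end_near. Qed.

End Powers.

Section Uniqueness.
Context {R : realType}.
Local Notation mu := (haar R).
Local Notation I f := (Rintegral mu setT f).
Implicit Types (phi psi : T3 R -> R) (E : set (T3 R)).

Lemma bmM d (T : measurableType d) (f g : T -> R) : bm f -> bm g -> bm (fun x => f x * g x).
Proof.
move=> [mf [B fB]] [mg [C gC]]; split; first exact: measurable_funM.
by exists (B * C) => z; rewrite normrM ler_pM.
Qed.

Lemma bmD d (T : measurableType d) (f g : T -> R) : bm f -> bm g -> bm (fun x => f x + g x).
Proof.
move=> [mf [B fB]] [mg [C gC]]; split; first exact: measurable_funD.
by exists (B + C) => z; rewrite (le_trans (ler_normD _ _))// lerD.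
Qed.

Lemma bm_cst d (T : measurableType d) (c : R) : @bm R d T (fun=> c).
Proof. by split=> //; exists `|c|. Qed.

Lemma bm_Re d (T : measurableType d) (F : T -> R[i]) : cbm F -> bm (fun x => Re (F x)).
Proof. by move=> [[m1 m2] [B FB]]; split=> //; exists B => x; rewrite (le_trans (Re_le_normc _)). Qed.

Lemma bm_Im d (T : measurableType d) (F : T -> R[i]) : cbm F -> bm (fun x => Im (F x)).
Proof. by move=> [[m1 m2] [B FB]]; split=> //; exists B => x; rewrite (le_trans (Im_le_normc _)). Qed.

Definition ck (k : Z3) x : R := cos (dot3 k x).
Definition sk (k : Z3) x : R := sin (dot3 k x).

Lemma bm_ck k : bm (ck k). Proof. exact: bm_Re (cbm_ek k). Qed.
Lemma bm_sk k : bm (sk k). Proof. exact: bm_Im (cbm_ek k). Qed.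

(** Products of characters are linear combinations of characters, which is what
    makes the characters multipliers in the sense below. *)
Lemma ckck j k x : ck j x * ck k x = 2^-1 * (ck (j + k) x + ck (j - k) x).
Proof. by rewrite /ck !dot3D !dot3N; move: (dot3 j x) (dot3 k x) => a b; rewrite !cosD cosN sinN; field. Qed.
Lemma sksk j k x : sk j x * sk k x = 2^-1 * (ck (j - k) x - ck (j + k) x).
Proof. by rewrite /ck /sk !dot3D !dot3N; move: (dot3 j x) (dot3 k x) => a b; rewrite !cosD cosN sinN; field. Qed.
Lemma skck j k x : sk j x * ck k x = 2^-1 * (sk (j + k) x + sk (j - k) x).
Proof. by rewrite /ck /sk !dot3D !dot3N; move: (dot3 j x) (dot3 k x) => a b; rewrite !sinD cosN sinN; field. Qed.

Variable f : T3 R -> R.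
Hypothesis fi : intg mu f.
Hypothesis f0 : forall k, I (fun x => f x * ck k x) = 0 /\ I (fun x => f x * sk k x) = 0.

(** The functions phi such that f phi is orthogonal to the characters, and the
    multipliers of this space. The multipliers form an algebra that is closed
    under bounded pointwise limits, so the sets whose indicator is a multiplier
    form a sigma-algebra. *)
Definition orth phi := bm phi /\ forall k,
  I (fun x => f x * phi x * ck k x) = 0 /\ I (fun x => f x * phi x * sk k x) = 0.
Definition omul phi := bm phi /\ forall psi, orth psi -> orth (fun x => phi x * psi x).

Let intf3 phi g : bm phi -> bm g -> intg mu (fun x => f x * phi x * g x).
Proof. by move=> bp bg; apply: intg_bm => //; exact: intg_bm. Qed.

Lemma orth1 : orth (fun=> 1).
Proof.
split; first exact: bm_cst.
by move=> k; have [h1 h2] := f0 k; split; [rewrite -[RHS]h1|rewrite -[RHS]h2];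
  apply: I_ext => x; rewrite mulr1.
Qed.

Lemma orthD phi psi : orth phi -> orth psi -> orth (fun x => phi x + psi x).
Proof.
move=> [b1 h1] [b2 h2]; split; first exact: bmD.
move=> k; have [a1 a2] := h1 k; have [c1 c2] := h2 k.
have bc := bm_ck k; have bs := bm_sk k.
split; [rewrite -[RHS]addr0 -{1}a1 -c1|rewrite -[RHS]addr0 -{1}a2 -c2];
  (rewrite -I_D; [|exact: intf3|exact: intf3]); apply: I_ext => x; ring.
Qed.

Lemma orthZ (c : R) phi : orth phi -> orth (fun x => c * phi x).
Proof.
move=> [b1 h1]; split; first by apply: bmM => //; exact: bm_cst.
move=> k; have [a1 a2] := h1 k; have bc := bm_ck k; have bs := bm_sk k.
split; [rewrite -[RHS](mulr0 c) -a1|rewrite -[RHS](mulr0 c) -a2];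
  (rewrite -I_Z; [|exact: intf3]); apply: I_ext => x; ring.
Qed.

Lemma orth_ext phi psi : phi =1 psi -> orth phi -> orth psi.
Proof. by move=> /funext ->. Qed.

Lemma omul_ext phi psi : phi =1 psi -> omul phi -> omul psi.
Proof. by move=> /funext ->. Qed.

Lemma omul_cst c : omul (fun=> c).
Proof. by split; [exact: bm_cst|move=> psi; exact: orthZ]. Qed.

Lemma omulM phi psi : omul phi -> omul psi -> omul (fun x => phi x * psi x).
Proof.
move=> [b1 h1] [b2 h2]; split; first exact: bmM.
by move=> g /h2 /h1; apply: orth_ext => x; rewrite mulrA.
Qed.

Lemma omulD phi psi : omul phi -> omul psi -> omul (fun x => phi x + psi x).
Proof.
move=> [b1 h1] [b2 h2]; split; first exact: bmD.
move=> g hg; apply: orth_ext (orthD (h1 _ hg) (h2 _ hg)) => x.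
by rewrite mulrDl.
Qed.

Lemma omulZ c phi : omul phi -> omul (fun x => c * phi x).
Proof. by move=> h; apply: omulM => //; exact: omul_cst. Qed.

Lemma omulX phi n : omul phi -> omul (fun x => phi x ^+ n).
Proof.
move=> h; elim: n => [|n IH]; first by apply: omul_ext (omul_cst 1) => x; rewrite expr0.
by apply: omul_ext (omulM h IH) => x; rewrite exprS.
Qed.

Lemma omul_ck k : omul (ck k).
Proof.
split; first exact: bm_ck.
move=> psi [bp hp]; split; first by apply: bmM => //; exact: bm_ck.
move=> j; have [a1 a2] := hp (k + j); have [c1 c2] := hp (k - j).
have [d1 d2] := hp (j + k); have [e1 e2] := hp (j - k).
have bc l := bm_ck l; have bs l := bm_sk l; split.
  rewrite -[RHS](mulr0 2^-1) -[X in _ * X]addr0 -{1}a1 -c1 -I_D;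
    [|exact: intf3|exact: intf3].
  rewrite -I_Z; last by apply: intgD; exact: intf3.
  apply: I_ext => x.
  have -> : f x * (ck k x * psi x) * ck j x = f x * psi x * (ck k x * ck j x) by ring.
  by rewrite ckck; ring.
rewrite -[RHS](mulr0 2^-1) -[X in _ * X]addr0 -{1}d2 -e2 -I_D;
  [|exact: intf3|exact: intf3].
rewrite -I_Z; last by apply: intgD; exact: intf3.
apply: I_ext => x.
have -> : f x * (ck k x * psi x) * sk j x = f x * psi x * (sk j x * ck k x) by ring.
by rewrite skck; ring.
Qed.

Lemma omul_sk k : omul (sk k).
Proof.
split; first exact: bm_sk.
move=> psi [bp hp]; split; first by apply: bmM => //; exact: bm_sk.
move=> j; have [a1 a2] := hp (k + j); have [c1 c2] := hp (k - j).
have bc l := bm_ck l; have bs l := bm_sk l; split.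
  rewrite -[RHS](mulr0 2^-1) -[X in _ * X]addr0 -{1}a2 -c2 -I_D;
    [|exact: intf3|exact: intf3].
  rewrite -I_Z; last by apply: intgD; exact: intf3.
  apply: I_ext => x.
  have -> : f x * (sk k x * psi x) * ck j x = f x * psi x * (sk k x * ck j x) by ring.
  by rewrite skck; ring.
rewrite -[RHS](mulr0 2^-1) -[X in _ * X]subr0 -{1}c1 -a1 -I_B;
  [|exact: intf3|exact: intf3].
rewrite -I_Z; last by apply: intgB; exact: intf3.
apply: I_ext => x.
have -> : f x * (sk k x * psi x) * sk j x = f x * psi x * (sk k x * sk j x) by ring.
by rewrite sksk; ring.
Qed.

Lemma orth_lim (p_ : nat -> T3 R -> R) phi B : (forall n, orth (p_ n)) ->
  (forall n x, `|p_ n x| <= B) -> (forall x, p_ ^~ x @ \oo --> phi x) -> orth phi.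
Proof.
move=> ho pB plim.
have mp : measurable_fun setT phi.
  by apply: (@measurable_fun_cvg _ _ _ setT p_) => [n|x _]; [exact: (ho n).1.1|exact: plim].
have phiB x : `|phi x| <= B.
  have c : (fun n => `|p_ n x|) @ \oo --> `|phi x| by apply: cvg_norm; exact: plim.
  rewrite -(cvg_lim _ c)//; apply: limr_le; first exact: cvgP c.
  by near=> n; exact: pB.
split; first by split=> //; exists B.
have key g : bm g -> (forall n, I (fun x => f x * p_ n x * g x) = 0) ->
    I (fun x => f x * phi x * g x) = 0.
  move=> [mg [C gC]] h0.
  have [|||| _ lim0] := @I_cvg _ _ _ mu (fun n x => f x * p_ n x * g x)
     (fun x => f x * phi x * g x) (fun x => (B * C) * `|f x|).
  - move=> n; apply: measurable_funM => //; apply: measurable_funM; last exact: (ho n).1.1.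
    exact: intg_meas fi.
  - by move=> x; apply: cvgM; [apply: cvgM; [exact: cvg_cst|exact: plim]|exact: cvg_cst].
  - move=> n x; rewrite !normrM -mulrA mulrC ler_wpM2r//.
    by apply: ler_pM.
  - by apply: intgZ; exact: intg_norm.
  have e0 : (fun n => I (fun x => f x * p_ n x * g x)) = fun=> 0.
    by apply/funext => n; exact: h0.
  rewrite e0 in lim0; rewrite -(cvg_lim _ lim0)//; exact: lim_cst.
by move=> k; split; apply: key; [exact: bm_ck|move=> n; exact: ((ho n).2 k).1
  |exact: bm_sk|move=> n; exact: ((ho n).2 k).2].
Unshelve. all: by end_near. Qed.

Lemma omul_lim (p_ : nat -> T3 R -> R) phi B : (forall n, omul (p_ n)) ->
  (forall n x, `|p_ n x| <= B) -> (forall x, p_ ^~ x @ \oo --> phi x) -> omul phi.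
Proof.
move=> ho pB plim.
have ho1 n : orth (p_ n).
  by apply: orth_ext ((ho n).2 _ orth1) => x; rewrite mulr1.
split; first exact: (orth_lim ho1 pB plim).1.
move=> psi hp; have [bp _] := hp; have [_ [C pC]] := bp.
apply: (@orth_lim (fun n x => p_ n x * psi x) _ (B * C)).
- by move=> n; exact: (ho n).2.
- by move=> n x; rewrite normrM ler_pM.
- by move=> x; apply: cvgM; [exact: plim|exact: cvg_cst].
Qed.

Definition oset E := measurable E /\ omul (\1_E).

Lemma osetT : oset setT.
Proof.
split=> //; apply: omul_ext (omul_cst 1) => x; rewrite indicE in_setT//.
Qed.

Lemma osetC E : oset E -> oset (~` E).
Proof.
move=> [mE hE]; split; first exact: measurableC.
apply: omul_ext (omulD (omul_cst 1) (omulZ (-1) hE)) => x.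
rewrite !indicE in_setC; case: (x \in E) => /=; ring.
Qed.

Lemma osetI E F : oset E -> oset F -> oset (E `&` F).
Proof.
move=> [mE hE] [mF hF]; split; first exact: measurableI.
apply: omul_ext (omulM hE hF) => x.
by rewrite !indicE in_setI; case: (x \in E); case: (x \in F); rewrite ?mulr1 ?mulr0.
Qed.

Lemma oset_bigcup (F : nat -> set (T3 R)) : (forall n, oset (F n)) -> oset (\bigcup_n F n).
Proof.
move=> hF; have mF : measurable (\bigcup_n F n).
  by apply: bigcupT_measurable => n; exact: (hF n).1.
split=> //.
pose p n x : R := \prod_(i < n) (1 - \1_(F i) x).
have bit i x : (\1_(F i) x : R) = 0 \/ (\1_(F i) x : R) = 1.
  by rewrite indicE; case: (x \in F i); [right|left].
have hp n : omul (p n).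
  rewrite /p; elim: n => [|n IH].
    by apply: omul_ext (omul_cst 1) => x; rewrite big_ord0.
  apply: omul_ext (omulM IH (omulD (omul_cst 1) (omulZ (-1) (hF n).2))) => x.
  by rewrite big_ord_recr/= mulN1r.
have p01 n x : 0 <= p n x <= 1.
  rewrite /p; elim: n => [|n /andP[h1 h2]]; first by rewrite big_ord0 ler01 lexx.
  rewrite big_ord_recr/=; case: (bit n x) => ->; rewrite ?subr0 ?mulr1 ?subrr ?mulr0 ?lexx ?ler01//.
  by rewrite h1 h2.
apply: (@omul_lim (fun n x => 1 + -1 * p n x) _ 1).
- by move=> n; apply: omulD; [exact: omul_cst|exact: omulZ].
- move=> n x; rewrite mulN1r ler_norml; have /andP[h1 h2] := p01 n x; apply/andP; split; lra.
- move=> x; rewrite indicE; have [|xF] := boolP (x \in \bigcup_n F n).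
    rewrite inE => -[i _ Fix]; apply: cvg_near_cst.
    exists i.+1 => // n /= ni; rewrite (_ : p n x = 0) ?mulr0 ?addr0//.
    rewrite /p (bigD1 (Ordinal ni))//= indicE mem_set// subrr mul0r//.
  rewrite (_ : (fun n => _) = fun=> 0); first exact: cvg_cst.
  apply/funext => n; rewrite (_ : p n x = 1) ?mulr1 ?addrN//.
  rewrite /p big1// => i _; rewrite indicE memNset ?subr0// => Fix.
  by move/negP: xF; apply; rewrite inE; exists i.
Qed.

(** The powers of 1 - phi^2 tend to the indicator of the zero set of phi. *)
Lemma omul_neq0 phi : omul phi -> (forall x, `|phi x| <= 1) -> oset [set x | phi x = 0].
Proof.
move=> ho p1; have [[mp _] _] := ho; split.
  have -> : [set x | phi x = 0] = phi @^-1` [set 0] by [].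
  by rewrite -[X in measurable X]setTI; exact: mp.
apply: (@omul_lim (fun n x => (1 + -1 * phi x ^+ 2) ^+ n) _ 1).
- move=> n; apply: omulX; apply: omulD; first exact: omul_cst.
  by apply: omulZ; exact: omulX.
- move=> n x; have := p1 x; rewrite -(@ler_pXn2r _ 2)// ?nnegrE// expr1n real_normK ?num_real// => h.
  have h0 : 0 <= phi x ^+ 2 by exact: sqr_ge0.
  rewrite normrX exprn_ile1// mulN1r ger0_norm; lra.
- move=> x; have := p1 x; rewrite -(@ler_pXn2r _ 2)// ?nnegrE// expr1n real_normK ?num_real// => h.
  rewrite indicE; have [|] := boolP (x \in _).
    rewrite inE => /= ->; rewrite expr0n mulr0 addr0.
    by under eq_fun do rewrite expr1n; exact: cvg_cst.
  rewrite notin_setE /= => /eqP px; apply: cvg_expr.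
  have h0 : 0 < phi x ^+ 2 by rewrite exprn_even_gt0.
  rewrite mulN1r ger0_norm; lra.
Qed.

(** An affine change of variable brings phi into the unit interval and the level
    c to 1/2; the level set, where the polynomials do not converge to the
    indicator, is removed beforehand. *)
Lemma omul_lt phi (c : R) : omul phi -> oset [set x | phi x < c].
Proof.
move=> ho; have [[mp [B pB]] _] := ho.
have B0 : 0 <= B by apply: le_trans (pB ((0, 0), 0)); exact: normr_ge0.
pose D := 2 * (B + `|c| + 1).
have D0 : 0 < D by rewrite mulr_gt0// ltr_wpDl// addr_ge0.
pose y x := D^-1 * (phi x + - c) + 2^-1.
have hy : omul y.
  by apply: omulD; [apply: omulZ; apply: omulD => //|]; exact: omul_cst.
have y01 x : 0 <= y x <= 1.
  have : `|phi x - c| <= D / 2.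
    rewrite (le_trans (ler_normB _ _))// /D mulrC mulKf// -addrA lerD// lerDl//.
  rewrite ler_norml => /andP[h1 h2].
  have i0 : 0 <= D^-1 by rewrite invr_ge0 ltW.
  have := ler_wpM2l i0 h1; have := ler_wpM2l i0 h2.
  rewrite mulrN mulrA mulVf ?gt_eqF// mul1r /y => a b; apply/andP; split; lra.
have yc x : (phi x < c) = (y x < 2^-1).
  rewrite /y -subr_lt0 -[RHS]subr_lt0 addrK pmulr_rlt0// invr_gt0//.
split.
  have -> : [set x | phi x < c] = phi @^-1` [set r | r < c] by [].
  rewrite -[X in measurable X]setTI; apply: mp => //.
  by have := @measurable_itv R `]-oo, c[; rewrite set_itvE.
have h0 : oset [set x | y x - 2^-1 = 0].
  apply: omul_neq0.
    by apply: omulD => //; exact: omul_cst.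
  by move=> x; rewrite ler_norml; have /andP[a b] := y01 x; apply/andP; split; lra.
apply: (@omul_lim (fun n x => \1_(~` [set x | y x - 2^-1 = 0]) x * (1 + -1 * y x ^+ n) ^+ (2 ^ n)) _ 1).
- move=> n; apply: omulM; first exact: (osetC h0).2.
  apply: omulX; apply: omulD; first exact: omul_cst.
  by apply: omulZ; exact: omulX.
- move=> n x; have /andP[a b] := y01 x.
  have q1 : 0 <= y x ^+ n <= 1 by rewrite exprn_ge0//= exprn_ile1.
  have q2 : `|(1 + -1 * y x ^+ n) ^+ (2 ^ n)| <= 1.
    by move: q1 => /andP[? ?]; rewrite normrX exprn_ile1// mulN1r ger0_norm; lra.
  rewrite normrM indicE; case: (x \in _); rewrite ?normr1 ?normr0 ?mul1r ?mul0r//.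
- move=> x; have /andP[a b] := y01 x; under eq_fun do rewrite mulN1r.
  set S := [set x | y x - 2^-1 = 0]; set L := [set x | phi x < c].
  have [e|ne] := eqVneq (y x) 2^-1.
    have m1 : x \in ~` S = false by apply: memNset => /= H; apply: H; rewrite /S/= e subrr.
    have m2 : x \in L = false by apply: memNset; rewrite /L/= yc e ltxx.
    by rewrite !indicE m1 m2; under eq_fun do rewrite mul0r; exact: cvg_cst.
  have m1 : x \in ~` S by apply: mem_set => /= /eqP; rewrite subr_eq0 (negbTE ne).
  rewrite !indicE m1; under eq_fun do rewrite mul1r.
  have [l|l] := ltP (y x) 2^-1.
    have -> : x \in L by apply: mem_set; rewrite /L/= yc.
    exact: step_poly_lt.
  have -> : x \in L = false by apply: memNset; rewrite /L/= yc ltNge l.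
  by apply: step_poly_gt => //; rewrite lt_neqAle eq_sym ne.
Qed.

End Uniqueness.

(** * Measurable subsets of the cell *)

Section UniquenessConclusion.
Context {R : realType}.
Local Notation mu := (haar R).
Local Notation I f := (Rintegral mu setT f).
Variable f : T3 R -> R.
Hypothesis fi : intg mu f.
Hypothesis f0 : forall k, I (fun x => f x * ck k x) = 0 /\ I (fun x => f x * sk k x) = 0.

(** The open fundamental cell, of full measure. *)
Definition cell : set (T3 R) := [set x |
  [/\ 0 < x.1.1 < 2 * pi, 0 < x.1.2 < 2 * pi & 0 < x.2 < 2 * pi]].

(** Sets that agree on the open cell with a set whose indicator is a
    multiplier. Only on the cell are the coordinates functions of the
    characters. *)
Definition cset (E : set (T3 R)) := exists F, oset f F /\ cell `&` E = cell `&` F.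

Lemma cset_oset E : oset f E -> cset E. Proof. by exists E. Qed.

Lemma csetC E : cset E -> cset (~` E).
Proof.
move=> [F [oF eF]]; exists (~` F); split; first exact: osetC.
apply/seteqP; split=> x [cx nE]; split=> // h; apply: nE.
  by have [] : (cell `&` E) x by rewrite eF.
by have [] : (cell `&` F) x by rewrite -eF.
Qed.

Lemma cset_bigcup (F : nat -> set (T3 R)) : (forall n, cset (F n)) -> cset (\bigcup_n F n).
Proof.
move=> /choice[G hG]; exists (\bigcup_n G n); split.
  by apply: oset_bigcup => // n; exact: (hG n).1.
rewrite !setI_bigcupr; apply: eq_bigcupr => n _; exact: (hG n).2.
Qed.

Lemma cset_ext E F : cell `&` E = cell `&` F -> cset E -> cset F.
Proof. by move=> EF [G [oG eG]]; exists G; split=> //; rewrite -EF. Qed.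

Lemma csetI E F : cset E -> cset F -> cset (E `&` F).
Proof.
move=> [E' [oE eE]] [F' [oF eF]]; exists (E' `&` F'); split; first exact: osetI.
by rewrite [LHS]setIIr [RHS]setIIr eE eF.
Qed.

Lemma sigma_algebra_cset : sigma_algebra setT cset.
Proof.
split.
- rewrite -setCT; apply: csetC; apply: cset_oset; exact: osetT.
- by move=> A; rewrite setTD; exact: csetC.
- exact: cset_bigcup.
Qed.

Section Coordinate.
Variables (y : T3 R -> R) (k : Z3).
Hypothesis yk : forall x, dot3 k x = y x.
Hypothesis y_cell : forall x, cell x -> 0 < y x < 2 * pi.

Let cos_lt a : oset f [set x | cos (y x) < a].
Proof.
have := omul_lt fi f0 a (omul_ck fi k); congr (oset f _).
by apply/seteqP; split=> x /=; rewrite /ck yk.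
Qed.

Let sin_lt0 : oset f [set x | sin (y x) < 0].
Proof.
have := omul_lt fi f0 0 (omul_sk fi k); congr (oset f _).
by apply/seteqP; split=> x /=; rewrite /sk yk.
Qed.

Let sin_gt0 : oset f [set x | 0 < sin (y x)].
Proof.
have := omul_lt fi f0 0 (omulZ fi (-1) (omul_sk fi k)); congr (oset f _).
by apply/seteqP; split=> x /=; rewrite /sk yk mulN1r oppr_lt0.
Qed.

Let cos_gt a : oset f [set x | a < cos (y x)].
Proof.
have := omul_lt fi f0 (- a) (omulZ fi (-1) (omul_ck fi k)); congr (oset f _).
by apply/seteqP; split=> x /=; rewrite /ck yk mulN1r ltrN2.
Qed.

Let sin_pos (t : R) : 0 < t < 2 * pi -> (0 < sin t) = (t < pi).
Proof.
move=> /andP[t0 t2]; have [tp|tp] := ltP t pi; first by apply: sin_gt0_pi; rewrite t0.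
apply/negbTE; rewrite -leNgt -(subrK pi t) sinDpi oppr_le0 sin_ge0_pi//.
by rewrite subr_ge0 tp/=; lra.
Qed.

Let sin_neg (t : R) : 0 < t < 2 * pi -> (sin t < 0) = (pi < t).
Proof.
move=> /andP[t0 t2]; have [tp|tp] := ltP pi t.
  rewrite -(subrK pi t) sinDpi oppr_lt0 sin_gt0_pi// subr_gt0 tp/=; lra.
by apply/negbTE; rewrite -leNgt; apply: sin_ge0_pi; rewrite (ltW t0).
Qed.

Let cos_refl (t : R) : cos (2 * pi - t) = cos t.
Proof. by rewrite mulr_natl addrC cosD2pi cosN. Qed.

(** On the open cell, the half line y < a is described by the signs of sin y and
    of cos y - cos a, since the cosine is monotone on each half period. *)
Lemma cset_ray a : cset [set x | y x < a].
Proof.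
have p0 := pi_gt0 R.
have [a0|a0] := leP a 0.
  apply: (@cset_ext set0); last by rewrite -setCT; apply/csetC/cset_oset/osetT.
  rewrite setI0; apply/seteqP; split=> // x [/y_cell/andP[yx _]] /= h.
  by have := lt_trans yx (lt_le_trans h a0); rewrite ltxx.
have [a2|a2] := leP (2 * pi) a.
  apply: (@cset_ext setT); last by apply/cset_oset/osetT.
  rewrite setIT; apply/seteqP; split=> x => [cx|[]//]; split=> //=.
  by have /andP[_ h] := y_cell cx; exact: lt_le_trans h a2.
have [ap|ap] := leP a pi.
  apply: (@cset_ext ([set x | cos a < cos (y x)] `&` [set x | 0 < sin (y x)])).
    have ia : a \in `[0, pi] by rewrite in_itv/= (ltW a0).
    apply/seteqP; split=> x [cx] /=; have yx := y_cell cx; have /andP[y0 _] := yx.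
      rewrite sin_pos// => -[h yp]; split=> //; move: h.
      have iy : y x \in `[0, pi] by rewrite in_itv/= (ltW y0) (ltW yp).
      by rewrite (ltr_cos iy ia).
    move=> h; have yp : y x < pi by exact: lt_le_trans h ap.
    have iy : y x \in `[0, pi] by rewrite in_itv/= (ltW y0) (ltW yp).
    by split=> //; rewrite sin_pos// (ltr_cos iy ia).
  by apply: csetI; exact: cset_oset.
apply: (@cset_ext (~` ([set x | sin (y x) < 0] `&` ~` [set x | cos (y x) < cos a]))).
  have key x : cell x -> (sin (y x) < 0 /\ ~ (cos (y x) < cos a)) <-> ~ (y x < a).
    move=> cx; have yx := y_cell cx; have /andP[y0 y2] := yx; rewrite sin_neg//.
    have ia : 2 * pi - a \in `[0, pi] by rewrite in_itv/=; apply/andP; split; lra.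
    have E : pi <= y x -> (cos (y x) < cos a) = (y x < a).
      move=> yp; have iy : 2 * pi - y x \in `[0, pi] by rewrite in_itv/=; apply/andP; split; lra.
      by rewrite -cos_refl -(cos_refl a) (ltr_cos ia iy) ltrD2l ltrN2.
    split; first by move=> [yp h] ya; apply: h; rewrite E// ltW.
    move=> /negP; rewrite -leNgt => ay; have yp : pi < y x by lra.
    by split=> //; rewrite E ?(ltW yp)//; apply/negP; rewrite -leNgt.
  apply/seteqP; split=> x [cx] /= h; split=> //.
    by apply: contrapT => /(key _ cx) h2; apply: h.
  by move=> /(key _ cx).
by apply/csetC/csetI; [exact: cset_oset|apply/csetC/cset_oset].
Qed.

(** The Borel sets are generated by the half lines. *)
Lemma cset_coord (B : set R) : measurable (B : set (measurableTypeR R)) -> cset (y @^-1` B).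
Proof.
move=> mB; have : (<<s RGenInftyO.G (R:=R) >>) B.
  by have : (RGenInftyO.G (R:=R)).-sigma.-measurable B
    by rewrite -RGenInftyO.measurableE; exact: mB.
apply: (@smallest_sub _ _ _ [set B | cset (y @^-1` B)]).
  split.
  - rewrite /= preimage_set0; exact: (let: And3 h _ _ := sigma_algebra_cset in h).
  - by move=> A /= hA; rewrite setTD preimage_setC; exact: csetC.
  - by move=> F hF /=; rewrite preimage_bigcup; exact: cset_bigcup.
move=> _ [a ->] /=; apply: cset_ext (cset_ray a).
by congr (_ `&` _); apply/seteqP; split=> x /=; rewrite in_itv.
Qed.

End Coordinate.
End UniquenessConclusion.

(** * Uniqueness of Fourier coefficients *)

Lemma sub_null3 (R : realType) d (T : measurableType d) (mu : subprobability T R)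
    (D A B C : set T) : measurable D -> measurable A -> measurable B -> measurable C ->
  mu A = 0%E -> mu B = 0%E -> mu C = 0%E -> D `<=` A `|` B `|` C -> mu D = 0%E.
Proof.
move=> mD mA mB mC A0 B0 C0 DABC.
have mAB := measurableU _ _ mA mB; have mABC := measurableU _ _ mAB mC.
apply: (subset_measure0 mD mABC DABC); apply: null_set_setU => //.
exact: null_set_setU.
Qed.

Section Uniqueness2.
Context {R : realType}.
Local Notation mu := (haar R).
Local Notation I f := (Rintegral mu setT f).

Lemma haar1_null (B : set (measurableTypeR R)) : measurable B ->
  B = ~` `]0, 2 * pi[%classic -> haar1 R B = 0%E.
Proof.
move=> mB eB; have -> : haar1 R B = (\int[haar1 R]_x (\1_B x)%:E)%E.
  by rewrite integral_indic// setIT.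
rewrite (@integral_uniform _ _ _ (twopi_gt0 R)); last 2 first.
- by apply/measurable_EFinP; exact: measurable_indic.
- by move=> x; rewrite lee_fin.
rewrite integral_indic//.
rewrite [X in (_ * X)%E](_ : _ = 0%E) ?mule0//.
transitivity (lebesgue_measure ([set 0] `|` [set 2 * pi] : set R)).
  congr lebesgue_measure.
  have p0 := pi_gt0 R.
  rewrite eB; apply/seteqP; split=> x /=; rewrite !in_itv/=.
    move=> [h /andP[x0 x2]]; have [x00|x00] := eqVneq x 0; [by left|right].
    by apply/eqP; rewrite eq_le x2/= leNgt; apply/negP => xl; apply: h; rewrite lt_neqAle eq_sym x00 x0.
  by case=> ->; rewrite ?ltxx ?lexx/=; split=> //; rewrite ?andbF//; lra.
rewrite measureU//=.
- by rewrite !lebesgue_measure_set1 adde0.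
- by apply/seteqP; split=> // x [/= e h]; move: (twopi_gt0 R); rewrite -h e ltxx.
Qed.

Lemma measurable_cell : measurable (@cell R).
Proof.
have f1 : measurable_fun setT (fun x : T3 R => x.1.1) by exact: measurableT_comp.
have f2 : measurable_fun setT (fun x : T3 R => x.1.2) by exact: measurableT_comp.
have f3 : measurable_fun setT (fun x : T3 R => x.2) by exact: measurable_snd.
have mI : measurable (`]0, 2 * pi[%classic : set (measurableTypeR R)) by exact: measurable_itv.
have -> : @cell R = ((fun x : T3 R => x.1.1) @^-1` `]0, 2 * pi[%classic) `&`
  ((fun x : T3 R => x.1.2) @^-1` `]0, 2 * pi[%classic) `&`
  ((fun x : T3 R => x.2) @^-1` `]0, 2 * pi[%classic).
  by apply/seteqP; split=> x; rewrite /cell/= !in_itv/=; [case|move=> [[]]].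
apply: measurableI; first apply: measurableI.
- by rewrite -[X in measurable X]setTI; exact: f1.
- by rewrite -[X in measurable X]setTI; exact: f2.
- by rewrite -[X in measurable X]setTI; exact: f3.
Qed.

Lemma haar_cellC : mu (~` @cell R) = 0%E.
Proof.
pose B : set (measurableTypeR R) := ~` `]0, 2 * pi[%classic.
have mB : measurable B by apply: measurableC; exact: measurable_itv.
have B0 : haar1 R B = 0%E by exact: haar1_null.
pose P := product_subprobability (haar1 R : subprobability _ R, haar1 R : subprobability _ R).
have P1 : P (B `*` setT) = 0%E.
  transitivity (haar1 R B * haar1 R setT)%E; last by rewrite B0 mul0e.
  exact: product_measure1E.
have P2 : P (setT `*` B) = 0%E.
  transitivity (haar1 R setT * haar1 R B)%E; last by rewrite B0 mule0.
  exact: product_measure1E.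
have h1 : mu ((B `*` setT) `*` setT) = 0%E.
  transitivity (P (B `*` setT) * haar1 R setT)%E; last by rewrite P1 mul0e.
  by apply: product_measure1E => //; exact: measurableX.
have h2 : mu ((setT `*` B) `*` setT) = 0%E.
  transitivity (P (setT `*` B) * haar1 R setT)%E; last by rewrite P2 mul0e.
  by apply: product_measure1E => //; exact: measurableX.
have h3 : mu (setT `*` B) = 0%E.
  transitivity (P setT * haar1 R B)%E; last by rewrite B0 mule0.
  exact: product_measure1E.
have m1 : measurable ((B `*` setT) `*` setT : set (T3 R)).
  by apply: measurableX => //; exact: measurableX.
have m2 : measurable ((setT `*` B) `*` setT : set (T3 R)).
  by apply: measurableX => //; exact: measurableX.
have m3 : measurable (setT `*` B : set (T3 R)) by exact: measurableX.
have mC : measurable (~` @cell R) by apply: measurableC; exact: measurable_cell.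
apply: (sub_null3 mC m1 m2 m3 h1 h2 h3) => x.
rewrite /cell /= => h; apply: contrapT => h2'; apply: h; split; apply: contrapT => h'; apply: h2'.
+ by left; left; split=> //; split=> //; rewrite /B/= in_itv.
+ by left; right; split=> //; split=> //; rewrite /B/= in_itv.
+ by right; split=> //; rewrite /B/= in_itv.
Qed.

Lemma ae_cell : {ae mu, forall x, @cell R x}.
Proof.
exists (~` @cell R); split; [by apply: measurableC; exact: measurable_cell| exact: haar_cellC|by []].
Qed.

Section F.
Variable f : T3 R -> R.
Hypothesis fi : intg mu f.
Hypothesis f0 : forall k, I (fun x => f x * ck k x) = 0 /\ I (fun x => f x * sk k x) = 0.

(** The product sigma-algebra is generated by the preimages of Borel sets under
    the three coordinates. *)
Lemma cset_measurable E : measurable E -> cset f E.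
Proof.
have k1 x : dot3 ((1, 0, 0) : Z3) x = x.1.1 :> R by rewrite /dot3 /= !mulr0z; ring.
have k2 x : dot3 ((0, 1, 0) : Z3) x = x.1.2 :> R by rewrite /dot3 /= !mulr0z; ring.
have k3 x : dot3 ((0, 0, 1) : Z3) x = x.2 :> R by rewrite /dot3 /= !mulr0z; ring.
have c1 := cset_coord fi f0 k1 (fun x (h : cell x) => let: And3 a _ _ := h in a).
have c2 := cset_coord fi f0 k2 (fun x (h : cell x) => let: And3 _ a _ := h in a).
have c3 := cset_coord fi f0 k3 (fun x (h : cell x) => let: And3 _ _ a := h in a).
rewrite measurable_prod_measurableType; apply: smallest_sub.
  exact: sigma_algebra_cset.
move=> _ [A mA [B mB <-]].
have -> : A `*` B = ((fun x => x.1) @^-1` A) `&` ((fun x => x.2) @^-1` B) by [].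
apply: csetI => //; last exact: c3.
move: mA; rewrite measurable_prod_measurableType.
apply: (@smallest_sub _ _ _ [set A | cset f ((fun x : T3 R => x.1) @^-1` A)]).
  split.
  - rewrite /= preimage_set0; exact: (let: And3 h _ _ := sigma_algebra_cset fi f0 in h).
  - by move=> A' /= hA; rewrite setTD preimage_setC; exact: csetC.
  - by move=> F hF /=; rewrite preimage_bigcup; exact: cset_bigcup.
move=> _ [A1 mA1 [A2 mA2 <-]] /=.
have -> : (fun x : T3 R => x.1) @^-1` (A1 `*` A2) =
   ((fun x => x.1.1) @^-1` A1) `&` ((fun x => x.1.2) @^-1` A2) by [].
by apply: csetI => //; [exact: c1|exact: c2].
Qed.

Lemma I_indic0 E : measurable E -> I (fun x => f x * \1_E x) = 0.
Proof.
move=> mE; have [F [[mF [bF hF]] eF]] := cset_measurable mE.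
have [_ h] := hF _ (orth1 f0).
have bE : bm (\1_E : T3 R -> R).
  split; first exact: measurable_indic.
  by exists 1 => x; rewrite indicE; case: (_ \in _); rewrite ?normr1 ?normr0.
have -> : I (fun x => f x * \1_E x) = I (fun x => f x * \1_F x).
  apply: ae_I_eq; first exact: intg_bm.
    by apply: measurable_funM; [exact: intg_meas fi|exact: bF.1].
  apply: filterS ae_cell => x cx; congr (_ * _); rewrite !indicE; congr ((nat_of_bool _)%:R).
  apply/idP/idP; rewrite !inE => h2.
    by have [] : (cell `&` F) x by rewrite -eF.
  by have [] : (cell `&` E) x by rewrite eF.
have [<- _] := h 0; apply: I_ext => x.
by rewrite mulr1 /ck /dot3 /= !mulr0z !mul0r !addr0 cos0 mulr1.
Qed.

(** The function f is orthogonal to every indicator, in particular to those of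
    its own positive and negative sets. *)
Lemma real_uniqueness : {ae mu, forall x, f x = 0}.
Proof.
pose E := [set x | 0 <= f x].
have mf := intg_meas fi.
have mE : measurable E.
  have -> : E = f @^-1` [set r | 0 <= r] by [].
  rewrite -[X in measurable X]setTI; apply: mf => //.
  by have := @measurable_itv R `[0, +oo[; rewrite set_itvE.
have bE (F : set (T3 R)) : measurable F -> bm (\1_F : T3 R -> R).
  move=> mF; split; first exact: measurable_indic.
  by exists 1 => x; rewrite indicE; case: (_ \in _); rewrite ?normr1 ?normr0.
have mEC := measurableC mE.
have n0 : I (fun x => `|f x|) = 0.
  have -> : I (fun x => `|f x|) = I (fun x => f x * \1_E x - f x * \1_(~` E) x).
    apply: I_ext => x; rewrite !indicE in_setC.
    have [xE|xE] := boolP (x \in E); rewrite /= ?mulr1 ?mulr0 ?subr0 ?sub0r.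
      by rewrite ger0_norm//; move: xE; rewrite inE.
    rewrite ltr0_norm//; move: xE; rewrite notin_setE /E/= => /negP; by rewrite -ltNge.
  by rewrite (I_B (intg_bm fi (bE _ mE)) (intg_bm fi (bE _ mEC))) !I_indic0// subr0.
have H : (\int[mu]_x `|(EFin \o f) x|)%E = 0%E.
  by rewrite -[0%E]/(0%:E) -n0 -I_EFin//; exact: intg_norm.
have mfE : measurable_fun setT (EFin \o f) by exact/measurable_EFinP.
have h := (ae_eq_integral_abs mu measurableT mfE).1 H.
by apply: (@filterS _ _ _ _ _ _ h) => x /(_ Logic.I) [].
Qed.

End F.

(** The indicator of every measurable set is reached from the characters by
    algebra and bounded limits, and all integrals stay zero on the way. *)
Lemma fourier_uniqueness (F : T3 R -> R[i]) : cintg mu F ->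
  (forall k, fourier F k = 0) -> {ae mu, forall x, F x = 0}.
Proof.
move=> cF F0; have [f1 f2] := cF.
have bc k := bm_ck k; have bs k := bm_sk k.
have key k : I (fun x => Re (F x) * ck k x) + I (fun x => Im (F x) * sk k x) = 0 /\
   I (fun x => Im (F x) * ck k x) - I (fun x => Re (F x) * sk k x) = 0.
  have := F0 k; rewrite fourierE => e; split.
    rewrite -[RHS]/(Re 0) -e /= -I_D; [|exact: intg_bm|exact: intg_bm].
    by apply: I_ext => x; rewrite cReM ekN /=; rewrite mulrN opprK.
  rewrite -[RHS]/(Im 0) -e /= -I_B; [|exact: intg_bm|exact: intg_bm].
  by apply: I_ext => x; rewrite cImM ekN /=; rewrite mulrN addrC.
have ckN k x : ck (- k) x = ck k x :> R by rewrite /ck dot3N cosN.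
have skN k x : sk (- k) x = -1 * sk k x :> R by rewrite /sk dot3N sinN mulN1r.
have keyN k : I (fun x => Re (F x) * ck k x) - I (fun x => Im (F x) * sk k x) = 0 /\
   I (fun x => Im (F x) * ck k x) + I (fun x => Re (F x) * sk k x) = 0.
  have [h1 h2] := key (- k).
  have e1 (g : T3 R -> R) : I (fun x => g x * ck (- k) x) = I (fun x => g x * ck k x).
    by apply: I_ext => x; rewrite ckN.
  have e2 (g : T3 R -> R) : intg mu g -> I (fun x => g x * sk (- k) x) = - I (fun x => g x * sk k x).
    move=> gi; rewrite -[RHS]mulN1r -I_Z; last exact: intg_bm.
    by apply: I_ext => x; rewrite skN mulrCA.
  move: h1 h2; rewrite !e1 !e2// opprK => h1 h2; split=> //.
have r0 : {ae mu, forall x, Re (F x) = 0}.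
  apply: real_uniqueness => // k; have [h1 h2] := key k; have [h3 h4] := keyN k; split; lra.
have i0 : {ae mu, forall x, Im (F x) = 0}.
  apply: real_uniqueness => // k; have [h1 h2] := key k; have [h3 h4] := keyN k; split; lra.
by apply: filterS2 r0 i0 => x h1 h2; apply: complexP.
Qed.

End Uniqueness2.

(** * Square integrable functions *)

Section SquareIntegrable.
Context {R : realType}.
Local Notation mu := (haar R).
Local Notation I f := (Rintegral mu setT f).
Implicit Types (f g h : T3 R -> R[i]) (k j : Z3) (a : Z3 -> R[i]) (K : seq Z3).

(** The square of the L^2 norm, as a real number; it is meaningful under
    sqint. *)
Definition sqI f : R := I (fun x => normc (f x) ^+ 2).

Lemma sqI_ge0 f : 0 <= sqI f. Proof. by apply: I_ge0 => x; exact: sqr_ge0. Qed.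

Lemma L2norm_sqr f : (L2norm f `^ 2 = \int[mu]_x (normc (f x) ^+ 2)%:E)%E.
Proof.
rewrite /L2norm poweR_Lnorm ?pnatr_eq0//; apply: eq_integral => x _.
by rewrite abse_EFin ger0_norm ?normc_ge0// poweR_EFin powR_mulrn ?normc_ge0.
Qed.

Lemma L2norm_ge0 f : (0 <= L2norm f)%E. Proof. exact: Lnorm_ge0. Qed.

(** Equivalent to L2 by L2P, but stated with a real integral. *)
Definition sqint f := cmeas f /\ intg mu (fun x => normc (f x) ^+ 2).

Lemma L2P f : L2 f <-> sqint f.
Proof.
split=> [[m1 m2 fo]|[mf fi]].
  split=> //; apply/integrableP; split.
    by apply/measurable_EFinP; exact: cmeas_normc.
  under eq_integral do rewrite /= ger0_norm ?sqr_ge0//.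
  by rewrite -L2norm_sqr; apply: poweR_lty.
split; [exact: mf.1|exact: mf.2|].
have : (L2norm f `^ 2 < +oo)%E.
  by rewrite L2norm_sqr I_EFin// ltry.
by apply: lty_poweRy.
Qed.

Lemma L2normE f : sqint f -> L2norm f = (Num.sqrt (sqI f))%:E.
Proof.
move=> lf; have [mf fi] := lf; have := L2norm_sqr f; rewrite I_EFin//.
have [_ _] := (L2P f).2 lf; have := L2norm_ge0 f.
case: (L2norm f) => [r| |] //; rewrite lee_fin => r0 _.
rewrite poweR_EFin => -[]; rewrite powR_mulrn// /sqI => <-.
by rewrite sqrtr_sqr ger0_norm.
Qed.

Lemma sqint_meas f : sqint f -> cmeas f. Proof. by case. Qed.

Lemma intg_normM f g : sqint f -> sqint g -> intg mu (fun x => normc (f x) * normc (g x)).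
Proof.
move=> [mf fi] [mg gi].
apply: intg_le (intgD fi gi).
  by apply: measurable_funM; exact: cmeas_normc1.
move=> x; rewrite ger0_norm ?mulr_ge0 ?normc_ge0//.
have := sqr_ge0 (normc (f x) - normc (g x)).
have := mulr_ge0 (normc_ge0 (f x)) (normc_ge0 (g x)); lra.
Qed.

Lemma cintgM f g : sqint f -> sqint g -> cintg mu (fun x => f x * g x).
Proof.
move=> lf lg; apply: cintg_normc; first by apply: cmeasM; exact: sqint_meas.
by apply: intg_ext (intg_normM lf lg) => x; rewrite Normc.normcM.
Qed.

Lemma sqint_cbm f : cbm f -> sqint f.
Proof.
move=> [mf [B fB]]; split=> //; apply: bm_intg; split; first exact: cmeas_normc.
have B0 : 0 <= B by apply: le_trans (fB ((0, 0), 0)); exact: normc_ge0.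
exists (B ^+ 2) => x; rewrite ger0_norm ?sqr_ge0//.
by rewrite lerXn2r ?nnegrE ?normc_ge0.
Qed.

Lemma cbm_cst (c : R[i]) : cbm (fun _ : T3 R => c).
Proof. by split; [exact: cmeas_cst|exists (normc c)]. Qed.

Lemma sqint_cintg f : sqint f -> cintg mu f.
Proof.
move=> lf; have := cintgM lf (sqint_cbm (cbm_cst 1)).
by under eq_fun do rewrite mulr1.
Qed.

Lemma sqint_le f g (c : R) : cmeas f -> (forall x, normc (f x) <= c * normc (g x)) ->
  sqint g -> sqint f.
Proof.
move=> mf fg [mg gi]; split=> //.
apply: (@intg_le _ _ _ _ _ (fun x => c ^+ 2 * normc (g x) ^+ 2)).
- exact: cmeas_normc.
- move=> x; rewrite ger0_norm ?sqr_ge0// -exprMn lerXn2r ?nnegrE ?normc_ge0//.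
  by rewrite (le_trans _ (fg x)) ?normc_ge0.
- exact: intgZ.
Qed.

Lemma sqintD f g : sqint f -> sqint g -> sqint (fun x => f x + g x).
Proof.
move=> [mf fi] [mg gi]; split; first exact: cmeasD.
apply: intg_le (intgZ 2 (intgD fi gi)).
  by apply: cmeas_normc; exact: cmeasD.
move=> x; rewrite ger0_norm ?sqr_ge0//.
apply: (@le_trans _ _ ((normc (f x) + normc (g x)) ^+ 2)).
  by rewrite lerXn2r ?nnegrE ?addr_ge0 ?normc_ge0// ler_normcD.
have := sqr_ge0 (normc (f x) - normc (g x)); lra.
Qed.

Lemma sqintZ c f : sqint f -> sqint (fun x => c * f x).
Proof.
move=> lf; apply: (sqint_le (c := normc c)) (lf).
  by apply: cmeasZ; exact: sqint_meas.
by move=> x; rewrite Normc.normcM.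
Qed.

Lemma sqintB f g : sqint f -> sqint g -> sqint (fun x => f x - g x).
Proof.
move=> lf lg; have := sqintD lf (sqintZ (-1) lg).
by under eq_fun do rewrite mulN1r.
Qed.

Lemma sqint_conj f : sqint f -> sqint (fun x => conjc (f x)).
Proof.
move=> lf; apply: (sqint_le (c := 1)) (lf).
  by apply: cmeas_conj; exact: sqint_meas.
by move=> x; rewrite normc_conj mul1r.
Qed.

Lemma sqintMb f g : sqint f -> cbm g -> sqint (fun x => f x * g x).
Proof.
move=> lf [mg [B gB]]; apply: (sqint_le (c := B)) (lf).
  by apply: cmeasM => //; exact: sqint_meas.
by move=> x; rewrite Normc.normcM mulrC ler_wpM2r ?normc_ge0.
Qed.

Lemma sqint_sum (J : Type) (s : seq J) (F : J -> T3 R -> R[i]) :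
  (forall i, sqint (F i)) -> sqint (fun x => \sum_(i <- s) F i x).
Proof.
move=> Fi; elim: s => [|b s IH].
  have -> : (fun x => \sum_(i <- [::]) F i x) = fun=> 0 by apply/funext => x; rewrite big_nil.
  exact: sqint_cbm (cbm_cst 0).
have -> : (fun x => \sum_(i <- b :: s) F i x) = fun x => F b x + \sum_(i <- s) F i x.
  by apply/funext => x; rewrite big_cons.
exact: sqintD.
Qed.

Lemma ae_sqint f g : sqint f -> cmeas g -> {ae mu, forall x, f x = g x} -> sqint g.
Proof.
move=> [mf fi] mg fg; split=> //; apply: ae_intg fi _ _; first exact: cmeas_normc.
by apply: filterS fg => x ->.
Qed.

Lemma ae_sqI f g : sqint f -> cmeas g -> {ae mu, forall x, f x = g x} -> sqI f = sqI g.
Proof.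
move=> [mf fi] mg fg; apply: ae_I_eq => //; first exact: cmeas_normc.
by apply: filterS fg => x ->.
Qed.

Lemma ae_fourier f g k : cintg mu f -> cmeas g -> {ae mu, forall x, f x = g x} ->
  fourier f k = fourier g k.
Proof.
move=> cf mg fg; rewrite !fourierE; apply: ae_cint_eq.
- by apply: cintgMb => //; exact: cbm_ek.
- by apply: cmeasM => //; exact: (cbm_ek _).1.
- by apply: filterS fg => x ->.
Qed.

Lemma fourierD f g k : cintg mu f -> cintg mu g ->
  fourier (fun x => f x + g x) k = fourier f k + fourier g k.
Proof.
move=> cf cg; have be := cbm_ek (- k); rewrite !fourierE -cintD; [|exact: cintgMb..].
by apply: cint_ext => x; rewrite mulrDl.
Qed.

Lemma fourierZ c f k : cintg mu f -> fourier (fun x => c * f x) k = c * fourier f k.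
Proof.
move=> cf; have be := cbm_ek (- k); rewrite !fourierE -cintZ; last exact: cintgMb.
by apply: cint_ext => x; rewrite mulrA.
Qed.

Lemma fourierB f g k : cintg mu f -> cintg mu g ->
  fourier (fun x => f x - g x) k = fourier f k - fourier g k.
Proof.
move=> cf cg; rewrite -[- fourier g k]mulN1r -fourierZ// -fourierD//; last exact: cintgZ.
by congr (fourier _ k); apply/funext => x; rewrite mulN1r.
Qed.

Lemma fourier_sum (J : Type) (s : seq J) (F : J -> T3 R -> R[i]) k :
  (forall i, cintg mu (F i)) ->
  fourier (fun x => \sum_(i <- s) F i x) k = \sum_(i <- s) fourier (F i) k.
Proof.
move=> Fi; have be := cbm_ek (- k); rewrite fourierE.
under eq_bigr do rewrite fourierE.
rewrite -cint_sum; last by move=> i; exact: cintgMb.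
by apply: cint_ext => x; rewrite mulr_suml.
Qed.

Lemma fourier_conj f k : cintg mu f -> fourier (fun x => conjc (f x)) k = conjc (fourier f (- k)).
Proof.
move=> cf; have be := cbm_ek (- - k); rewrite !fourierE -cint_conj; last exact: cintgMb.
by apply: cint_ext => x; rewrite conjcM opprK ekN.
Qed.

Lemma fourier_ek j k : fourier (ek j : T3 R -> R[i]) k = (j == k)%:R.
Proof.
rewrite fourierE; transitivity (cint mu (ek (j - k) : T3 R -> R[i])).
  by apply: cint_ext => x; rewrite ekD.
by rewrite cint_ek subr_eq0.
Qed.

Lemma fourier_ekM j f k : fourier (fun x => ek j x * f x) k = fourier f (k - j).
Proof.
by rewrite !fourierE; apply: cint_ext => x; rewrite opprB ekD; ring.
Qed.

Definition trig_poly a K x : R[i] := \sum_(k <- K) a k * ek k x.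

Lemma sqint_trig a K : sqint (trig_poly a K).
Proof.
by apply: sqint_sum => k; apply: sqintZ; apply: sqint_cbm; exact: cbm_ek.
Qed.

Lemma fourier_trig a K k : uniq K -> fourier (trig_poly a K) k = if k \in K then a k else 0.
Proof.
move=> uK; have ec j : cintg mu (ek j) by apply: cbm_cintg; exact: cbm_ek.
rewrite fourier_sum; last by move=> j; exact: cintgZ.
have -> : \sum_(j <- K) fourier (fun x => a j * ek j x) k = \sum_(j <- K) a j * (j == k)%:R.
  by apply: eq_bigr => j _; rewrite (fourierZ (a j) k (ec j)) fourier_ek.
case: ifPn => kK.
  rewrite (bigD1_seq k)//= eqxx mulr1 big1 ?addr0// => j jk.
  by rewrite (negbTE jk) mulr0.
rewrite big_seq big1// => j jK; case: eqP => [e|_]; last by rewrite mulr0.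
by rewrite -e jK in kK.
Qed.

Lemma I_Re_trig f a K : sqint f ->
  I (fun x => Re (f x * conjc (trig_poly a K x))) = Re (\sum_(k <- K) conjc (a k) * fourier f k).
Proof.
move=> lf.
transitivity (Re (cint mu (fun x => \sum_(k <- K) conjc (a k) * (f x * ek (- k) x)))).
  congr (I _); apply/funext => x; congr Re; rewrite /trig_poly.
  elim: K => [|b K IH]; first by rewrite !big_nil /conjc /= oppr0 mulr0.
  by rewrite !big_cons -IH conjcD conjcM ekN; ring.
congr Re; rewrite cint_sum.
  apply: eq_bigr => k _; rewrite cintZ ?fourierE//.
  by apply: cintgMb; [exact: sqint_cintg|exact: cbm_ek].
move=> k; apply: cintgZ; apply: cintgMb; [exact: sqint_cintg|exact: cbm_ek].
Qed.

Lemma sqI_sub f g : sqint f -> sqint g ->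
  sqI (fun x => f x - g x) = sqI f + sqI g - 2 * I (fun x => Re (f x * conjc (g x))).
Proof.
move=> lf lg; have [c1 _] := cintgM lf (sqint_conj lg).
rewrite /sqI -I_Z// -I_D; [|exact: lf.2|exact: lg.2].
rewrite -I_B; [|by apply: intgD; [exact: lf.2|exact: lg.2]|exact: intgZ].
apply: I_ext => x; rewrite !normc_sqrE !(cReD, cImD, cReN, cImN) cReM cRe_conj cIm_conj; ring.
Qed.

Lemma sqI_trig a K : uniq K -> sqI (trig_poly a K) = \sum_(k <- K) normc (a k) ^+ 2.
Proof.
move=> uK; transitivity (I (fun x => Re (trig_poly a K x * conjc (trig_poly a K x)))).
  by apply: I_ext => x; rewrite conjcM_normc.
rewrite I_Re_trig; last exact: sqint_trig.
rewrite cRe_sum big_seq [RHS]big_seq; apply: eq_bigr => k kK.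
by rewrite fourier_trig// kK mulrC conjcM_normc.
Qed.

Lemma sqI_sub_trig f K : sqint f -> uniq K ->
  sqI (fun x => f x - trig_poly (fourier f) K x) = sqI f - \sum_(k <- K) normc (fourier f k) ^+ 2.
Proof.
move=> lf uK; rewrite sqI_sub//; last exact: sqint_trig.
rewrite sqI_trig// I_Re_trig// cRe_sum.
have -> : \sum_(i <- K) Re (conjc (fourier f i) * fourier f i) = \sum_(k <- K) normc (fourier f k) ^+ 2.
  by apply: eq_bigr => k _; rewrite mulrC conjcM_normc.
ring.
Qed.

(** Bessel's inequality, from the expansion of the square of f minus its Fourier
    polynomial. *)
Lemma bessel f K : sqint f -> uniq K -> \sum_(k <- K) normc (fourier f k) ^+ 2 <= sqI f.
Proof. by move=> lf uK; rewrite -subr_ge0 -sqI_sub_trig// sqI_ge0. Qed.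

Lemma fourier_le f k : sqint f -> normc (fourier f k) ^+ 2 <= sqI f.
Proof. by move=> lf; have := bessel lf (K := [:: k]) isT; rewrite big_seq1. Qed.

(** The Cauchy-Schwarz inequality in the additive form of Young, which avoids
    square roots; e is free and will be small. *)
Lemma fourierM_le f g k (e : R) : 0 < e -> sqint f -> sqint g ->
  normc (fourier (fun x => f x * g x) k) <= e^-1 * sqI f + e * sqI g.
Proof.
move=> e0 lf lg; rewrite fourierE.
have cfg := cintgM lf lg.
apply: le_trans (cint_le (cintgMb cfg (cbm_ek _))) _.
have [mf fi] := lf; have [mg gi] := lg; have ei : 0 < e^-1 by rewrite invr_gt0.
rewrite -I_Z; last by apply: normc_cintg; exact: cintgMb (cbm_ek _).
rewrite /sqI -!I_Z// -I_D; [|exact: intgZ..].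
apply: I_le.
- by apply: intgZ; apply: normc_cintg; exact: cintgMb (cbm_ek _).
- by apply: intgD; exact: intgZ.
move=> x; rewrite !Normc.normcM normc_ek mulr1.
set u := normc (f x); set v := normc (g x).
have : 0 <= e^-1 * (u - e * v) ^+ 2 by rewrite mulr_ge0 ?sqr_ge0 ?ltW.
have -> : e^-1 * (u - e * v) ^+ 2 = e^-1 * u ^+ 2 + e * v ^+ 2 - 2 * (u * v).
  by field; rewrite gt_eqF.
lra.
Qed.

End SquareIntegrable.

(** * Riesz-Fischer theorem and products *)

Section RieszFischer.
Context {R : realType}.
Local Notation mu := (haar R).
Local Notation I f := (Rintegral mu setT f).
Implicit Types (f g h : T3 R -> R[i]) (k j : Z3) (a : Z3 -> R[i]) (K : seq Z3).

Definition ccvg (u : nat -> R[i]) (l : R[i]) :=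
  (fun n => Re (u n)) @ \oo --> Re l /\ (fun n => Im (u n)) @ \oo --> Im l.

Lemma limn_einf_ub (u : nat -> \bar R) (M : \bar R) n0 :
  (forall n, (n0 <= n)%N -> (u n <= M)%E) -> (limn_einf u <= M)%E.
Proof.
move=> uM; rewrite limn_einf_lim; apply: lime_le; first exact: is_cvg_einfs.
exists n0 => // n n0n; apply: le_trans (uM _ n0n).
by apply: ereal_inf_lbound; exists n => /=.
Qed.

(** Fatou's lemma for squares: it gives at the same time the integrability of a
    pointwise limit and the bound on its norm. *)
Lemma fatou_sq (f_ : nat -> T3 R -> R[i]) f (M : R) n0 :
  (forall n, sqint (f_ n)) -> (forall x, ccvg (f_ ^~ x) (f x)) ->
  (forall n, (n0 <= n)%N -> sqI (f_ n) <= M) -> sqint f /\ sqI f <= M.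
Proof.
move=> lf cf fM.
have mf : cmeas f.
  split.
    apply: (@measurable_fun_cvg _ _ _ setT (fun n x => Re (f_ n x))) => // [n|x _].
      exact: (lf n).1.1.
    exact: (cf x).1.
  apply: (@measurable_fun_cvg _ _ _ setT (fun n x => Im (f_ n x))) => // [n|x _].
    exact: (lf n).1.2.
  exact: (cf x).2.
have H : (\int[mu]_x (normc (f x) ^+ 2)%:E <= M%:E)%E.
  have := @fatou _ _ _ mu setT measurableT (fun n x => (normc (f_ n x) ^+ 2)%:E).
  move=> /(_ _ _)/wrap[n|n x _|F].
  - by apply/measurable_EFinP; apply: cmeas_normc; exact: (lf n).1.
  - by rewrite lee_fin sqr_ge0.
  rewrite (eq_integral (fun x => limn_einf (fun n => (normc (f_ n x) ^+ 2)%:E))).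
    apply: le_trans F _; apply: (@limn_einf_ub _ _ n0) => n n0n.
    by rewrite I_EFin ?lee_fin ?fM//; exact: (lf n).2.
  move=> x _; have [c1 c2] := cf x.
  have c : (fun n => (normc (f_ n x) ^+ 2)%:E) @ \oo --> (normc (f x) ^+ 2)%:E.
    apply/fine_cvgP; split; first by near=> n.
    rewrite normc_sqrE.
    have -> : fine \o (fun n => (normc (f_ n x) ^+ 2)%:E) =
       fun n => Re (f_ n x) ^+ 2 + Im (f_ n x) ^+ 2.
      by apply/funext => n /=; rewrite normc_sqrE.
    by apply: cvgD; apply: cvgM.
  by rewrite (cvg_limn_einf_sup c).1.
have lf' : sqint f.
  split=> //; apply/integrableP; split.
    by apply/measurable_EFinP; exact: cmeas_normc.
  under eq_integral do rewrite /= ger0_norm ?sqr_ge0//.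
  exact: le_lt_trans H (ltry _).
by split=> //; rewrite -lee_fin /sqI -I_EFin//; exact: lf'.2.
Unshelve. all: by end_near. Qed.

Lemma sum_cvg_tail a M : l2_le (fun=> 1) a M ->
  forall e : R, 0 < e -> exists n, forall p, (n <= p)%N ->
   \sum_(k <- fenum p) normc (a k) ^+ 2 - \sum_(k <- fenum n) normc (a k) ^+ 2 <= e.
Proof.
move=> [_ aM] e e0; pose s n := \sum_(k <- fenum n) normc (a k) ^+ 2 : R.
have cs : cvgn s.
  apply: (@cvg_dominated_sum _ _ _ (M ^+ 2)) => J uJ; apply: le_trans (aM J uJ).
  by apply: ler_sum => k _; rewrite mul1r ger0_norm ?sqr_ge0.
have /cvgrPdist_le c : s @ \oo --> limn s by exact: cs.
have e2 : 0 < e / 2 by rewrite divr_gt0.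
have [N _ H] := c _ e2.
exists N => p Np; have := H _ Np; have := H _ (leqnn N).
rewrite /= -/(s p) -/(s N); move: (s p) (s N) (limn s) => x y z.
rewrite !ler_distl => /andP[h1 h2] /andP[h3 h4]; lra.
Qed.

(** A subsequence of the Fourier polynomials has L^2 increments of size 2^(-i),
    so that the sum of the absolute increments is integrable, hence finite almost
    everywhere. The polynomials are set to zero on the exceptional set, so that
    they converge everywhere, and the limit is controlled by Fatou's lemma. *)
Lemma riesz_fischer a M : l2_le (fun=> 1) a M ->
  exists f, [/\ sqint f, forall k, fourier f k = a k & sqI f <= M ^+ 2].
Proof.
move=> aM.
have r0 i : 0 < (4 ^+ i)^-1 :> R by rewrite invr_gt0 exprn_gt0.
have [n0 Hn0] := @choice _ _ (fun i n => forall p, (n <= p)%N ->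
   \sum_(k <- fenum p) normc (a k) ^+ 2 - \sum_(k <- fenum n) normc (a k) ^+ 2
   <= (4 ^+ i)^-1) (fun i => sum_cvg_tail aM (r0 i)).
(* strictly increasing, so that every frequency is reached, and beyond n0 *)
pose nn := fix nn i := if i is i'.+1 then maxn (nn i').+1 (n0 i) else n0 0%N.
have nnS i : (nn i < nn i.+1)%N by exact: leq_maxl.
have nn_mono i l : (i <= l)%N -> (nn i <= nn l)%N.
  by move=> /subnK <-; elim: (l - i)%N => // d IH; exact: leq_trans (ltnW (nnS _)).
have nn0 i : (n0 i <= nn i)%N by case: i => // i; exact: leq_maxr.
pose f i := trig_poly a (fenum (nn i)).
have lf i : sqint (f i) by exact: sqint_trig.
have sf i : sqI (f i) <= M ^+ 2.
  rewrite sqI_trig ?fenum_uniq//; apply: le_trans (aM.2 (fenum (nn i)) (fenum_uniq _)).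
  by apply: ler_sum => k _; rewrite mul1r.
have df i l : (i <= l)%N -> sqI (fun x => f l x - f i x) <= (4 ^+ i)^-1.
  move=> il; have e : (fun x => f l x - f i x) =1
     (fun x => f l x - trig_poly (fourier (f l)) (fenum (nn i)) x).
    move=> x; congr (_ - _); rewrite /f /trig_poly big_seq [RHS]big_seq; apply: eq_bigr => k ki.
    by rewrite fourier_trig ?fenum_uniq// (fenum_sub (nn_mono _ _ il) ki).
  rewrite (funext e) sqI_sub_trig ?fenum_uniq// sqI_trig ?fenum_uniq//.
  have -> : \sum_(k <- fenum (nn i)) normc (fourier (f l) k) ^+ 2 =
            \sum_(k <- fenum (nn i)) normc (a k) ^+ 2.
    rewrite big_seq [RHS]big_seq; apply: eq_bigr => k ki.
    by rewrite fourier_trig ?fenum_uniq// (fenum_sub (nn_mono _ _ il) ki).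
  have := Hn0 i _ (leq_trans (nn0 i) (nn_mono _ _ il)).
  have : \sum_(k <- fenum (n0 i)) normc (a k) ^+ 2 <= \sum_(k <- fenum (nn i)) normc (a k) ^+ 2.
    apply: ler_sum_uniq_sub; [exact: fenum_uniq|exact: fenum_uniq|exact: fenum_sub (nn0 i)|].
    by move=> k; exact: sqr_ge0.
  lra.
pose d i x := f i.+1 x - f i x.
have ld i : sqint (d i) by exact: sqintB.
have md i : measurable_fun setT (fun x => (normc (d i x))%:E).
  by apply/measurable_EFinP; apply: cmeas_normc1; exact: (ld i).1.
have Id i : I (fun x => normc (d i x)) <= (2 ^+ i)^-1.
  have nd := normc_cintg (sqint_cintg (ld i)).
  have p0 : 0 < 2 ^+ i :> R by rewrite exprn_gt0.
  have q0 : 0 < (2 ^+ i)^-1 :> R by rewrite invr_gt0.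
  apply: (@le_trans _ _ (I (fun x => 2 ^+ i / 2 * normc (d i x) ^+ 2 + (2 ^+ i)^-1 / 2))).
    apply: I_le => //; first by apply: intgD (intg_cst _ _); apply: intgZ; exact: (ld i).2.
    move=> x; have : 0 <= 2 ^+ i * (normc (d i x) - (2 ^+ i)^-1) ^+ 2 by rewrite mulr_ge0 ?sqr_ge0 ?ltW.
    have -> : 2 ^+ i * (normc (d i x) - (2 ^+ i)^-1) ^+ 2 =
       2 ^+ i * normc (d i x) ^+ 2 - 2 * normc (d i x) + (2 ^+ i)^-1.
      by field; rewrite expf_eq0 pnatr_eq0 andbF.
    lra.
  rewrite I_D; [|by apply: intgZ; exact: (ld i).2|exact: intg_cst].
  rewrite I_Z; last exact: (ld i).2.
  have h1 : I (fun=> (2 ^+ i)^-1 / 2) <= (2 ^+ i)^-1 / 2 by apply: I_cst_le; rewrite divr_ge0 ?ltW.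
  have h2 := df i _ (leqnSn i).
  have h3 : 2 ^+ i / 2 * sqI (d i) <= 2 ^+ i / 2 * (4 ^+ i)^-1.
    by apply: ler_wpM2l h2; rewrite divr_ge0 ?ltW.
  have e4 : (4 ^+ i)^-1 = (2 ^+ i)^-1 * (2 ^+ i)^-1 :> R by rewrite -invfM -exprMn -natrM.
  have e5 : 2 ^+ i / 2 * (4 ^+ i)^-1 = (2 ^+ i)^-1 / 2 :> R.
    by rewrite e4; field; rewrite expf_eq0 pnatr_eq0 andbF.
  rewrite e5 in h3; rewrite /sqI in h3; lra.
pose S x := (\sum_(i <oo) (normc (d i x))%:E)%E.
have mS : measurable_fun setT S.
  apply: (@ge0_emeasurable_sum _ _ _ setT (fun i x => (normc (d i x))%:E) xpredT).
    by move=> *; rewrite lee_fin normc_ge0.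
  by move=> i _; exact: md.
have S0 x : (0 <= S x)%E by apply: nneseries_ge0 => *; rewrite lee_fin normc_ge0.
have IS : (\int[mu]_x S x <= 2%:E)%E.
  rewrite integral_nneseries//; last by move=> *; rewrite lee_fin normc_ge0.
  apply: lime_le.
    by apply: is_cvg_nneseries => i _ _; apply: integral_ge0 => x _; rewrite lee_fin normc_ge0.
  exists 0%N => // l _.
  rewrite (eq_bigr (fun i => (I (fun x => normc (d i x)))%:E)); last first.
    by move=> i _; rewrite I_EFin//; exact: normc_cintg (sqint_cintg (ld i)).
  rewrite sumEFin lee_fin.
  apply: (@le_trans _ _ (2 - 2 * (2 ^+ l)^-1)); last first.
    by rewrite lerBlDr lerDl mulr_ge0// invr_ge0 exprn_ge0.
  elim: l => [|l IH]; first by rewrite big_geq// expr0 invr1; lra.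
  rewrite big_nat_recr//=.
  have e2 : (2 ^+ l.+1)^-1 = (2 ^+ l)^-1 / 2 :> R by rewrite exprSr invfM.
  rewrite e2; have := Id l; move: IH; lra.
pose A := [set x : T3 R | (S x < +oo)%E].
have mA : measurable A.
  by have := emeasurable_fun_infty_o measurableT mS +oo%E; rewrite setTI.
have iS : mu.-integrable setT S.
  apply/integrableP; split=> //; under eq_integral do rewrite gee0_abs//.
  exact: le_lt_trans IS (ltry _).
have aeA : {ae mu, forall x, A x}.
  have := integrable_ae measurableT iS; apply: filterS => x /(_ Logic.I).
  by rewrite ge0_fin_numE.
pose h i x := (\1_A x)%:C * f i x.
have bA : cbm (fun x : T3 R => (\1_A x)%:C : R[i]).
  split; first split => /=.
  - exact: measurable_indic.
  - exact: measurable_cst.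
  - exists 1 => x; rewrite normcR indicE; case: (_ \in _); rewrite /= ?normr1 ?normr0//.
have lh i : sqint (h i).
  by have := sqintMb (lf i) bA; under eq_fun do rewrite mulrC.
have hf i : {ae mu, forall x, f i x = h i x}.
  by apply: filterS aeA => x Ax; rewrite /h indicE mem_set// mul1r.
have cvgA x : A x -> exists l, ccvg (f ^~ x) l.
  move=> Ax; pose M' := fine (S x).
  have SM : S x = M'%:E by rewrite fineK// ge0_fin_numE.
  have bd l : \sum_(0 <= i < l) normc (d i x) <= M'.
    rewrite -lee_fin -SM -sumEFin.
    by apply: (nneseries_lim_ge (u_ := fun i => (normc (d i x))%:E)) => *; rewrite lee_fin normc_ge0.
  have cc (P : R[i] -> R) : (forall u v, P (u - v) = P u - P v) -> (forall u, `|P u| <= normc u) ->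
      cvgn (fun i => P (f i x)).
    move=> PB Pn.
    have e : (fun i => P (f i x)) = fun i => P (f 0%N x) + series (fun i => P (d i x)) i.
      apply/funext => i; rewrite /series /=; elim: i => [|i IH]; first by rewrite big_geq// addr0.
      by rewrite big_nat_recr//= addrA -IH PB; ring.
    rewrite e; apply: is_cvgD; first exact: is_cvg_cst.
    apply: (@normed_cvg R R^o); apply: nondecreasing_is_cvgn.
      by apply: nondecreasing_series => i _ _; exact: normr_ge0.
    exists M' => _ [n _ <-] /=; rewrite /series /=.
    by apply: le_trans (bd n); apply: ler_sum => i _; exact: Pn.
  exists (limn (fun i => Re (f i x)) +i* limn (fun i => Im (f i x))); split => /=.
    have : cvgn (fun i => Re (f i x)) by apply: cc => [u v|u]; [rewrite cReD cReN|exact: Re_le_normc].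
    exact.
  have : cvgn (fun i => Im (f i x)) by apply: cc => [u v|u]; [rewrite cImD cImN|exact: Im_le_normc].
  exact.
have cvgh x : exists l, ccvg (h ^~ x) l.
  have [Ax|nAx] := pselect (A x).
    have [l lc] := cvgA x Ax; exists l.
    suff -> : h ^~ x = f ^~ x by [].
    by apply/funext => i; rewrite /h indicE mem_set// mul1r.
  exists 0; suff -> : h ^~ x = fun=> 0 by split; exact: cvg_cst.
  by apply/funext => i; rewrite /h indicE memNset// mul0r.
have [g Hg] := choice cvgh.
have sh i : sqI (h i) <= M ^+ 2 by rewrite -(ae_sqI (lf i) (lh i).1 (hf i)).
have [lg sg] := fatou_sq lh Hg (n0 := 0%N) (fun n _ => sh n).
exists g; split=> // k.
have dg i : sqI (fun x => g x - h i x) <= (4 ^+ i)^-1.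
  have [] // := @fatou_sq (fun l x => h l x - h i x) (fun x => g x - h i x) ((4 ^+ i)^-1) i.
  - by move=> l; exact: sqintB.
  - move=> x; have [c1 c2] := Hg x; split.
      rewrite cReD cReN; under eq_fun do rewrite cReD cReN.
      by apply: cvgB => //; exact: cvg_cst.
    rewrite cImD cImN; under eq_fun do rewrite cImD cImN.
    by apply: cvgB => //; exact: cvg_cst.
  - move=> l il; apply: le_trans (df i l il).
    rewrite (ae_sqI (sqintB (lf l) (lf i)) (sqintB (lh l) (lh i)).1)//.
    by apply: filterS2 (hf l) (hf i) => x -> ->.
have fh i : fourier (h i) k = if k \in fenum (nn i) then a k else 0.
  rewrite -(ae_fourier k (sqint_cintg (lf i)) (lh i).1 (hf i)).
  by rewrite fourier_trig// fenum_uniq.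
have [n1 Hn1] := fenum_exhaust [:: k].
have nn_ge i : (i <= nn i)%N.
  by elim: i => // i IH; exact: leq_ltn_trans IH (nnS i).
have small i : (n1 <= i)%N -> normc (fourier g k - a k) ^+ 2 <= (4 ^+ i)^-1.
  move=> n1i; apply: le_trans (dg i).
  have ki : k \in fenum (nn i).
    by apply: (fenum_sub (leq_trans n1i (nn_ge i))); apply: Hn1; rewrite inE.
  have := fh i; rewrite ki => <-.
  rewrite -(fourierB k (sqint_cintg lg) (sqint_cintg (lh i))).
  exact: fourier_le (sqintB lg (lh i)).
apply/eqP; rewrite -subr_eq0 -normc_eq0P -sqrf_eq0.
set y := _ ^+ 2 in small *; have y0 : 0 <= y by exact: sqr_ge0.
rewrite eq_le y0 andbT leNgt; apply/negP => yp.
pose i := maxn n1 (Num.truncn y^-1).+1.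
have := small i (leq_maxl _ _); rewrite leNgt => /negP; apply.
have p4 : 0 < 4 ^+ i :> R by rewrite exprn_gt0.
rewrite (invf_plt p4 yp).
apply: (@lt_trans _ _ i%:R); last by rewrite -natrX ltr_nat ltn_expl.
apply: lt_le_trans (truncnS_gt _) _; rewrite ler_nat; exact: leq_maxr.
Qed.

(** By uniqueness the function agrees with the one built from its coefficients. *)
Lemma sqint_of_coef f M : cintg mu f -> l2_le (fun=> 1) (fourier f) M ->
  sqint f /\ sqI f <= M ^+ 2.
Proof.
move=> cf fM; have [g [lg fg gM]] := riesz_fischer fM.
have cg := sqint_cintg lg; have mf := cintg_meas cf.
have gf : {ae mu, forall x, g x = f x}.
  have /fourier_uniqueness : forall k, fourier (fun x => g x - f x) k = 0.
    by move=> k; rewrite fourierB// fg subrr.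
  move/(_ (cintgB cg cf)); apply: filterS => x /eqP.
  by rewrite subr_eq0 => /eqP.
by split; [exact: ae_sqint gf|rewrite -(ae_sqI lg mf gf)].
Qed.

Lemma l2_le_fourier f : sqint f -> l2_le (fun=> 1) (fourier f) (Num.sqrt (sqI f)).
Proof.
move=> lf; split=> [|K uK]; first exact: sqrtr_ge0.
rewrite sqr_sqrtr ?sqI_ge0//; apply: le_trans (bessel lf uK).
by apply: ler_sum => k _; rewrite mul1r.
Qed.

(** The square of the norm of the remainder is the tail of a convergent series,
    by sqint_of_coef. *)
Lemma trig_dense f (e : R) : sqint f -> 0 < e -> exists n, forall p, (n <= p)%N ->
  sqI (fun x => f x - trig_poly (fourier f) (fenum p) x) <= e.
Proof.
move=> lf e0; have [n Hn] := sum_cvg_tail (l2_le_fourier lf) e0.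
exists n => p np; have lt := sqint_trig (fourier f) (fenum p).
have e1 : Num.sqrt e ^+ 2 = e by rewrite sqr_sqrtr// ltW.
rewrite -[leRHS]e1; have [] // := @sqint_of_coef (fun x => f x - trig_poly (fourier f) (fenum p) x) (Num.sqrt e).
  exact: sqint_cintg (sqintB lf lt).
split=> [|K uK]; first exact: sqrtr_ge0.
rewrite e1; have [q Hq] := fenum_exhaust K.
have pq : (p <= maxn p q)%N by exact: leq_maxl.
apply: le_trans (Hn _ (leq_trans np pq)).
have inc : \sum_(k <- fenum n) normc (fourier f k) ^+ 2 <= \sum_(k <- fenum p) normc (fourier f k) ^+ 2.
  apply: ler_sum_uniq_sub; [exact: fenum_uniq|exact: fenum_uniq|exact: fenum_sub np|].
  by move=> k; exact: sqr_ge0.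
rewrite lerBrDr; apply: (le_trans (lerD (lexx _) inc)) => {inc}.
pose c k : R := if k \in fenum p then normc (fourier f k) ^+ 2 else 0.
pose c' k : R := if k \in fenum p then 0 else normc (fourier f k) ^+ 2.
have -> : \sum_(k <- K) 1 * normc (fourier (fun x => f x - trig_poly (fourier f) (fenum p) x) k) ^+ 2
  = \sum_(k <- K) c' k.
  apply: eq_bigr => k _; rewrite (fourierB k (sqint_cintg lf) (sqint_cintg lt)).
  rewrite fourier_trig ?fenum_uniq// /c' mul1r.
  by case: ifP; rewrite ?subrr ?subr0// Normc.normc0 expr0n.
have h1 : \sum_(k <- K) c' k <= \sum_(k <- fenum (maxn p q)) c' k.
  apply: ler_sum_uniq_sub => //; [exact: fenum_uniq| |].
    by move=> k /Hq; apply: fenum_sub; exact: leq_maxr.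
  by move=> k; rewrite /c'; case: ifP => // _; exact: sqr_ge0.
have h2 : \sum_(k <- fenum p) normc (fourier f k) ^+ 2 <= \sum_(k <- fenum (maxn p q)) c k.
  have -> : \sum_(k <- fenum p) normc (fourier f k) ^+ 2 = \sum_(k <- fenum p) c k.
    by rewrite big_seq [RHS]big_seq; apply: eq_bigr => k; rewrite /c => ->.
  apply: ler_sum_uniq_sub; [exact: fenum_uniq|exact: fenum_uniq|exact: fenum_sub pq|].
  by move=> k; rewrite /c; case: ifP => // _; exact: sqr_ge0.
apply: (le_trans (lerD h1 h2)); rewrite -big_split; apply: ler_sum => k _ /=.
by rewrite /c /c'; case: ifP; rewrite ?add0r ?addr0.
Qed.

(** The Fourier coefficients of a product of two square integrable functions
    are the convolution of theirs: true for trigonometric polynomials, hence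
    in general by density. *)
Lemma fourierM f g k : sqint f -> sqint g ->
  fourier (fun x => f x * g x) k = fconv (fun _ _ => 1) (fourier f) (fourier g) k.
Proof.
move=> lf lg; rewrite /fconv; apply/esym.
have ab : absum (fun j => 1 * (fourier f j * fourier g (k - j))) (sqI f + sqI g).
  move=> s us; apply: (@le_trans _ _ (\sum_(j <- s) (normc (fourier f j) ^+ 2 + normc (fourier g (k - j)) ^+ 2))).
    apply: ler_sum => j _; rewrite mul1r Normc.normcM.
    move: (normc_ge0 (fourier f j)) (normc_ge0 (fourier g (k - j))).
    move: (normc _) (normc _) => a b a0 b0; have := sqr_ge0 (a - b); have := mulr_ge0 a0 b0; lra.
  rewrite big_split; apply: lerD; first exact: bessel.
  rewrite -(big_map (fun j => k - j) xpredT (fun j => normc (fourier g j) ^+ 2)).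
  by apply: bessel => //; rewrite map_inj_uniq// => i j /subrI.
apply: (csum_uniq ab) => e e0.
pose e' := e / (2 * (sqI g + 1)).
have g1 : 0 < sqI g + 1 by rewrite ltr_wpDl ?sqI_ge0.
have e'0 : 0 < e' by rewrite divr_gt0// mulr_gt0.
have [n Hn] := trig_dense lf (mulr_gt0 e'0 (divr_gt0 e0 (ltr0Sn R 1))).
exists n => p np; have lt := sqint_trig (fourier f) (fenum p).
have -> : \sum_(j <- fenum p) 1 * (fourier f j * fourier g (k - j)) =
    fourier (fun x => trig_poly (fourier f) (fenum p) x * g x) k.
  have eg j : cintg mu (fun x => ek j x * g x).
    by have := sqint_cintg (sqintMb lg (cbm_ek j)); under eq_fun do rewrite mulrC.
  transitivity (fourier (fun x => \sum_(j <- fenum p) fourier f j * (ek j x * g x)) k).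
    rewrite fourier_sum; last by move=> j; exact: cintgZ.
    by apply: eq_bigr => j _; rewrite fourierZ// fourier_ekM mul1r.
  by congr (fourier _ k); apply/funext => x; rewrite /trig_poly mulr_suml; apply: eq_bigr => j _; rewrite mulrA.
rewrite -fourierB; [|exact: cintgM|exact: cintgM].
have -> : (fun x => f x * g x - trig_poly (fourier f) (fenum p) x * g x) =
   (fun x => (f x - trig_poly (fourier f) (fenum p) x) * g x) by apply/funext => x; ring.
apply: le_trans (fourierM_le k e'0 (sqintB lf lt) lg) _.
have h1 := Hn _ np; have h2 : e'^-1 * sqI (fun x => f x - trig_poly (fourier f) (fenum p) x) <= e / 2.
  by rewrite ler_pdivrMl.
have h3 : e' * sqI g <= e / 2.
  have -> : e / 2 = e' * (sqI g + 1) by rewrite /e'; field; rewrite gt_eqF.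
  by rewrite ler_wpM2l ?ltW// ltrDl.
lra.
Qed.

End RieszFischer.

(** * Calculus of Fourier coefficients *)

Section Multipliers.
Context {R : realType} (m : R).
Hypothesis m0 : m != 0.
Local Notation mu := (haar R).
Local Notation w := (jap m).
Local Notation N34 := (l2_le (w34 m)).
Local Notation N1 := (l2_le (w1 m)).
Implicit Types (f g h u v : T3 R -> R[i]) (k j l : Z3) (a b p q : Z3 -> R[i]).

(** Square integrable functions and their coefficients together. Each operation
    in the scheme acts on this predicate, and the functions themselves are
    forgotten: Fourier multipliers are only defined up to null sets, their
    coefficients are not. *)
Definition has_coefs f a := sqint f /\ forall k, fourier f k = a k.

Lemma has_coefsP f : sqint f -> has_coefs f (fourier f). Proof. by []. Qed.

Lemma has_coefsE f a : has_coefs f a -> fourier f = a.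
Proof. by move=> [_ H]; apply/funext. Qed.

Lemma has_coefs_ext f a b : a =1 b -> has_coefs f a -> has_coefs f b.
Proof. by move=> /funext ->. Qed.

Lemma has_coefs_extf f g a : f =1 g -> has_coefs f a -> has_coefs g a.
Proof. by move=> /funext ->. Qed.

Lemma has_coefs_cintg f a : has_coefs f a -> cintg mu f.
Proof. by move=> [/sqint_cintg]. Qed.

Lemma has_coefs_ae f g a : has_coefs f a -> has_coefs g a -> {ae mu, forall x, f x = g x}.
Proof.
move=> fa ga; have cf := has_coefs_cintg fa; have cg := has_coefs_cintg ga.
have /fourier_uniqueness : forall k, fourier (fun x => f x - g x) k = 0.
  by move=> k; rewrite fourierB// fa.2 ga.2 subrr.
move/(_ (cintgB cf cg)); apply: filterS => x /eqP.
by rewrite subr_eq0 => /eqP.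
Qed.

Lemma ae_hc f g a : has_coefs f a -> cmeas g -> {ae mu, forall x, f x = g x} ->
  has_coefs g a.
Proof.
move=> fa mg fg; split; first exact: ae_sqint fa.1 mg fg.
by move=> k; rewrite -(ae_fourier k (has_coefs_cintg fa) mg fg) fa.2.
Qed.

Lemma has_coefsD f g a b : has_coefs f a -> has_coefs g b ->
  has_coefs (fun x => f x + g x) (fun k => a k + b k).
Proof.
move=> fa gb; split; first exact: sqintD fa.1 gb.1.
by move=> k; rewrite (fourierD k (has_coefs_cintg fa) (has_coefs_cintg gb)) fa.2 gb.2.
Qed.

Lemma has_coefsZ f a (c : R[i]) : has_coefs f a -> has_coefs (fun x => c * f x) (fun k => c * a k).
Proof.
move=> fa; split; first exact: sqintZ fa.1.
by move=> k; rewrite (fourierZ c k (has_coefs_cintg fa)) fa.2.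
Qed.

Lemma has_coefsB f g a b : has_coefs f a -> has_coefs g b ->
  has_coefs (fun x => f x - g x) (fun k => a k - b k).
Proof.
move=> fa gb; split; first exact: sqintB fa.1 gb.1.
by move=> k; rewrite (fourierB k (has_coefs_cintg fa) (has_coefs_cintg gb)) fa.2 gb.2.
Qed.

Lemma has_coefs_conj f a : has_coefs f a -> has_coefs (cbar f) (star a).
Proof.
move=> fa; split; first exact: sqint_conj fa.1.
by move=> k; rewrite /cbar (fourier_conj k (has_coefs_cintg fa)) fa.2.
Qed.

Lemma has_coefs_cst (c : R[i]) : has_coefs (fun=> c) (fun k => c * (k == 0)%:R).
Proof.
have h : has_coefs (fun _ : T3 R => (1 : R[i])) (fun k => (k == 0)%:R).
  split; first exact: sqint_cbm (cbm_cst _).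
  move=> k; have := @fourier_ek R 0 k; rewrite eq_sym => <-.
  by congr (fourier _ k); apply/funext => x; rewrite ek0.
by apply: has_coefs_extf (has_coefsZ c h) => x; rewrite mulr1.
Qed.

(** A constant function is known only almost everywhere when it is given by its
    coefficients, as is a function of A applied to the constant 1. *)
Lemma has_coefsMc f h a (c : R[i]) : has_coefs f a -> has_coefs h (fun k => c * (k == 0)%:R) ->
  has_coefs (fun x => f x * h x) (fun k => c * a k).
Proof.
move=> fa hc; apply: ae_hc (has_coefsZ c fa) _ _.
  by apply: cmeasM; [exact: fa.1.1|exact: hc.1.1].
by apply: filterS (has_coefs_ae hc (has_coefs_cst c)) => x ->; rewrite mulrC.
Qed.

Lemma has_coefs_hb f a : has_coefs f a -> l2_le (fun=> 1) a (Num.sqrt (sqI f)).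
Proof. by move=> fa; apply: l2_le_ext (l2_le_fourier fa.1); exact: fa.2. Qed.

Local Notation cv := (fconv (fun _ _ => 1)).

Lemma conv1_bound a b A B : N34 a A -> N34 b B -> l2_le (fun=> 1) (cv a b) (bil_cst m * (A * B)).
Proof.
move=> aA bB; have := @conv_bound _ m m0 (fun _ _ => 1) a b A B 1 aA bB.
by rewrite mul1r; apply => j l; rewrite Normc.normc1.
Qed.

(** This is where the regularity H^(3/4) of the factors is used: it makes the
    product square integrable. *)
Lemma has_coefsM f g a b A B : has_coefs f a -> has_coefs g b -> N34 a A -> N34 b B ->
  has_coefs (fun x => f x * g x) (cv a b).
Proof.
move=> fa gb aA bB.
have e k : fourier (fun x => f x * g x) k = cv a b k.
  by rewrite (fourierM k fa.1 gb.1) (has_coefsE fa) (has_coefsE gb).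
have [] // := @sqint_of_coef _ (fun x => f x * g x) _ (cintgM fa.1 gb.1)
  (l2_le_ext (fun k => esym (e k)) (conv1_bound aA bB)).
Qed.

(** The multiplier is defined by choice of a representative; the theorem of Riesz
    and Fischer provides one. *)
Lemma Fmul_coefs sigma f M : l2_le (fun=> 1) (fun k => sigma k * fourier f k) M ->
  has_coefs (Fmul sigma f) (fun k => sigma k * fourier f k).
Proof.
move=> /riesz_fischer[g [lg fg _]]; rewrite /Fmul; case: xgetP => [h _ [/L2P lh fh]|].
  by [].
by move=> /(_ g); case; split=> //; apply/L2P.
Qed.

Lemma has_coefs_Fmul sigma f a c : has_coefs f a -> (forall k, normc (sigma k) <= c) ->
  has_coefs (Fmul sigma f) (fun k => sigma k * a k).
Proof.
move=> fa sc; have c0 : 0 <= c by apply: le_trans (sc 0); exact: normc_ge0.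
rewrite -(has_coefsE fa); apply: (@Fmul_coefs _ _ (c * Num.sqrt (sqI f))).
by apply: l2_le_mul => //; rewrite (has_coefsE fa); exact: has_coefs_hb.
Qed.

Lemma has_coefs_opB f a : has_coefs f a -> has_coefs (opB m f) (fun k => (w k)^-1%:C * a k).
Proof.
move=> fa; apply: (has_coefs_Fmul (c := `|m|^-1) fa) => k.
rewrite normcR ger0_norm ?invr_ge0 ?jap_ge0// lef_pV2 ?posrE ?normr_gt0 ?jap_gt0//.
exact: jap_ge_mass.
Qed.

(** The operator A has the symbol i dA. *)
Definition dA k : R := - (2 * w k).

Lemma dA_neq0 k : dA k != 0.
Proof. by rewrite oppr_eq0 mulf_neq0// gt_eqF// jap_gt0. Qed.

Lemma symA_im tau k : tau%:C * symA m k = 'i * (tau * dA k)%:C.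
Proof. by rewrite /symA /dA !(rmorphM, rmorphN, rmorphD, rmorph1)/=; ring. Qed.

Lemma symL_im tau k : tau%:C * symL m k = 'i * (tau * w k)%:C.
Proof. by rewrite /symL rmorphM/=; ring. Qed.

Lemma has_coefs_eA tau f a : has_coefs f a ->
  has_coefs (funA m tau (@expC R) f) (fun k => cis (tau * dA k) * a k).
Proof.
move=> fa; have e k : expC (tau%:C * symA m k) = cis (tau * dA k) by rewrite symA_im expC_im.
apply: has_coefs_ext (has_coefs_Fmul (c := 1) fa _) => k; first by rewrite e.
by rewrite e normc_cis.
Qed.

Lemma has_coefs_eL tau f a : has_coefs f a ->
  has_coefs (funL m tau (@expC R) f) (fun k => cis (tau * w k) * a k).
Proof.
move=> fa; have e k : expC (tau%:C * symL m k) = cis (tau * w k) by rewrite symL_im expC_im.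
apply: has_coefs_ext (has_coefs_Fmul (c := 1) fa _) => k; first by rewrite e.
by rewrite e normc_cis.
Qed.

(** The symbol of psi(tau A). *)
Definition phA (psi : R[i] -> R[i]) tau k := psi ('i * (tau * dA k)%:C).

Lemma has_coefs_funA psi tau f a : has_coefs f a -> (forall k, normc (phA psi tau k) <= 2) ->
  has_coefs (funA m tau psi f) (fun k => phA psi tau k * a k).
Proof.
move=> fa pb; have e k : psi (tau%:C * symA m k) = phA psi tau k by rewrite symA_im.
apply: has_coefs_ext (has_coefs_Fmul (c := 2) fa _) => k; first by rewrite e.
by rewrite e.
Qed.

Lemma phA1_bound tau k : tau != 0 -> normc (phA (@phi1 R) tau k) <= 2.
Proof. by move=> t0; apply: phi1_bound; rewrite mulf_neq0// dA_neq0. Qed.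

Lemma phA2_bound tau k : tau != 0 -> normc (phA (@phi2 R) tau k) <= 2.
Proof. by move=> t0; apply: phi2_bound; rewrite mulf_neq0// dA_neq0. Qed.

Local Notation o0 := (ord0 : 'I_3).
Local Notation o1 := (lift ord0 ord0 : 'I_3).
Local Notation o2 := (lift ord0 (lift ord0 ord0) : 'I_3).

Lemma vdot_nlF u (Y : vec R) x :
  vdot (nlF u) Y x = - ('i / 4) * (u x * u x * Y o0 x + Y o1 x + 2 * (u x * Y o2 x)).
Proof. rewrite /vdot !big_ord_recl big_ord0 /nlF /vec3 /tnth /=; ring. Qed.

(** The common form of the terms B(F(u) . Y) of the scheme, with c delta, p and q
    the coefficients of the three components of Y. The product of u^2 with the
    first component is square integrable because that component is constant. *)
Lemma has_coefs_BF u a (Y : vec R) c p q A B : has_coefs u a -> N34 a A ->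
  has_coefs (Y o0) (fun k => c * (k == 0)%:R) -> has_coefs (Y o1) p ->
  has_coefs (Y o2) q -> N34 q B ->
  has_coefs (opB m (vdot (nlF u) Y))
    (fun k => beta m k * (c * cv a a k + p k + 2 * cv a q k)).
Proof.
move=> ua aA Y0 Y1 Y2 qB.
have h0 := has_coefsMc (has_coefsM ua ua aA aA) Y0; have h2 := has_coefsZ 2 (has_coefsM ua Y2 aA qB).
have h := has_coefsZ (- ('i / 4)) (has_coefsD (has_coefsD h0 Y1) h2).
apply: has_coefs_ext (has_coefs_opB (has_coefs_extf (fun x => esym (vdot_nlF u Y x)) h)) => k.
by rewrite /beta fmorphV; ring.
Qed.

End Multipliers.

(** * Separated multipliers, and differentials *)

Section SchemeCoefficients.
Context {R : realType} (m : R).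
Hypothesis m0 : m != 0.
Local Notation mu := (haar R).
Local Notation w := (jap m).
Local Notation N34 := (l2_le (w34 m)).
Local Notation N1 := (l2_le (w1 m)).
Implicit Types (f g h u v : T3 R -> R[i]) (k j l : Z3) (a b p q s : Z3 -> R[i]).
Local Notation cv := (fconv (fun _ _ => 1)).
Local Notation dA := (dA m).
Local Notation phA := (phA m).

Let W0 k : 0 <= w34 m k := ltW (w34_gt0 m0 k).

(** A multiplier that is a product of functions of the output frequency and of
    the two input frequencies acts by multiplication before and after the
    convolution. *)
Lemma conv_sep s p q a b A B c c' k : N34 a A -> N34 b B ->
  (forall k, normc (p k) <= c) -> (forall k, normc (q k) <= c') ->
  (exists N, absum (fun j => s (j + (k - j)) * (p j * q (k - j)) * (a j * b (k - j))) N) /\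
  fconv (fun j l => s (j + l) * (p j * q l)) a b k =
  s k * cv (fun k => p k * a k) (fun k => q k * b k) k.
Proof.
move=> aA bB pc qc.
have c0 : 0 <= c by apply: le_trans (pc 0); exact: normc_ge0.
have c'0 : 0 <= c' by apply: le_trans (qc 0); exact: normc_ge0.
have one j l : normc (1 : R[i]) <= 1 by rewrite Normc.normc1.
have ab := @conv_absum _ m m0 (fun _ _ => 1) _ _ _ _ 1 k (l2_le_mul W0 pc c0 aA) (l2_le_mul W0 qc c'0 bB) one.
have e j : s (j + (k - j)) * (p j * q (k - j)) * (a j * b (k - j)) =
   s k * (1 * (p j * a j * (q (k - j) * b (k - j)))) by rewrite subrKC; ring.
split; last by rewrite /fconv -(csumZ (s k) ab); exact: csum_ext.
by have := absumZ (s k) ab => H; eexists; rewrite (funext e); exact: H.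
Qed.

(** The symbol of the scheme is a sum of three such products for each of the
    three quadratic terms. *)
Lemma conv_sep3 (nu : Z3 -> Z3 -> R[i]) s1 p1 q1 s2 p2 q2 s3 p3 q3 a b A B
    c1 d1 c2 d2 c3 d3 k :
  N34 a A -> N34 b B ->
  (forall k, normc (p1 k) <= c1) -> (forall k, normc (q1 k) <= d1) ->
  (forall k, normc (p2 k) <= c2) -> (forall k, normc (q2 k) <= d2) ->
  (forall k, normc (p3 k) <= c3) -> (forall k, normc (q3 k) <= d3) ->
  (forall j l, nu j l = s1 (j + l) * (p1 j * q1 l) + s2 (j + l) * (p2 j * q2 l)
     + s3 (j + l) * (p3 j * q3 l)) ->
  fconv nu a b k = s1 k * cv (fun k => p1 k * a k) (fun k => q1 k * b k) k
    + s2 k * cv (fun k => p2 k * a k) (fun k => q2 k * b k) k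
    + s3 k * cv (fun k => p3 k * a k) (fun k => q3 k * b k) k.
Proof.
move=> aA bB pc1 qd1 pc2 qd2 pc3 qd3 nuE.
have [[n1 h1] <-] := conv_sep s1 k aA bB pc1 qd1.
have [[n2 h2] <-] := conv_sep s2 k aA bB pc2 qd2.
have [[n3 h3] <-] := conv_sep s3 k aA bB pc3 qd3.
rewrite /fconv -(csumD h1 h2) -(csumD (absumD h1 h2) h3).
by apply: csum_ext => j; rewrite nuE !mulrDl.
Qed.

(** Commutativity is read off the product of the functions. *)
Lemma cvC f g a b A B k : has_coefs f a -> has_coefs g b -> N34 a A -> N34 b B ->
  cv a b k = cv b a k.
Proof.
move=> fa gb aA bB; rewrite -((has_coefsM m0 fa gb aA bB).2 k) -((has_coefsM m0 gb fa bB aA).2 k).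
by congr (fourier _ k); apply/funext => x; rewrite mulrC.
Qed.

Lemma fourier_L2norm f k : sqint f -> ((normc (fourier f k))%:E <= L2norm f)%E.
Proof.
move=> lf; rewrite L2normE// lee_fin -[leLHS]ger0_norm ?normc_ge0// -sqrtr_sqr.
by rewrite ler_wsqrtr// fourier_le.
Qed.

(** The L^2 limit of difference quotients is determined by its coefficients,
    since each coefficient is continuous on L^2. *)
Lemma diff_at_coefs (Phi : (T3 R -> R[i]) -> T3 R -> R[i]) v h g b :
  has_coefs g b ->
  (forall e : R, sqint (fun x => (e^-1)%:C * (Phi (fun y => v y + e%:C * h y) x - Phi v x))) ->
  L2norm (fun x => (e^-1)%:C * (Phi (fun y => v y + e%:C * h y) x - Phi v x) - g x)
     @[e --> (0 : R)^'] --> 0%E ->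
  has_coefs (diff_at Phi v h) b.
Proof.
move=> gb qs lim; rewrite /diff_at; case: xgetP => [g' _ [/L2P lg' lim']|]; last first.
  by move=> /(_ g); case; split=> //; apply/L2P; exact: gb.1.
pose q (e : R) x := (e^-1)%:C * (Phi (fun y => v y + e%:C * h y) x - Phi v x).
have {}qs e : sqint (q e) by exact: qs.
split=> // k; rewrite -gb.2; apply/eqP; rewrite -subr_eq0 -normc_eq0P eq_le normc_ge0 andbT.
apply/ler_addgt0Pr => e e0; rewrite add0r -lee_fin.
have e2 : (0 < (e / 2)%:E)%E by rewrite lte_fin divr_gt0.
have near1 (g1 : T3 R -> R[i]) : L2norm (fun x => q r x - g1 x) @[r --> (0 : R)^'] --> 0%E ->
    \forall r \near (0 : R)^', (L2norm (fun x => (q r x - g1 x)%R) < (e / 2)%:E)%E.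
  have nb : nbhs (0%E : \bar R) [set y | (y < (e / 2)%:E)%E].
    by apply: open_nbhs_nbhs; split => //; exact: open_ereal_lt_ereal.
  by move=> H; exact: (H _ nb).
have [r [h1 h2]] : exists r : R, (L2norm (fun x => (q r x - g x)%R) < (e / 2)%:E)%E /\
    (L2norm (fun x => (q r x - g' x)%R) < (e / 2)%:E)%E.
  have : \forall r \near (0 : R)^', (L2norm (fun x => (q r x - g x)%R) < (e / 2)%:E)%E /\
    (L2norm (fun x => (q r x - g' x)%R) < (e / 2)%:E)%E.
    by apply: filterS2 (near1 _ lim) (near1 _ lim').
  by move=> H; exact: (@filter_ex R (0 : R)^' (Proper_dnbhs_numFieldType _) _ H).
have f1 := le_lt_trans (fourier_L2norm k (sqintB (qs r) gb.1)) h1.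
have f2 := le_lt_trans (fourier_L2norm k (sqintB (qs r) lg')) h2.
have cq := sqint_cintg (qs r).
rewrite (fourierB k cq (has_coefs_cintg gb)) in f1; rewrite (fourierB k cq (sqint_cintg lg')) in f2.
have -> : fourier g' k - fourier g k = (fourier (q r) k - fourier g k) - (fourier (q r) k - fourier g' k) by ring.
rewrite lee_fin; apply: le_trans (ler_normcB _ _) _.
by move: f1 f2; rewrite !lte_fin; lra.
Unshelve. all: by end_near. Qed.

(** The nonlinearity is quadratic in each argument, so the difference quotients
    differ from the differential by e times a fixed square integrable function. *)
Lemma dquad_coefs (Phi : (T3 R -> R[i]) -> T3 R -> R[i]) (v c h : T3 R -> R[i]) a b d A B D :
  (forall v', Phi v' = (- ('i / 4)) \*o opB m (fun x => v' x ^+ 2 + c x ^+ 2 + 2 * v' x * c x)) ->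
  has_coefs v a -> has_coefs c b -> has_coefs h d -> N34 a A -> N34 b B -> N34 d D ->
  has_coefs (diff_at Phi v h) (fun k => beta m k * (2 * (cv a d k + cv b d k))).
Proof.
move=> PhiE va cb hd aA bB dD.
pose N k := cv a a k + cv b b k + 2 * cv a b k.
pose X k := 2 * (cv a d k + cv b d k).
have hN : has_coefs (fun x => v x ^+ 2 + c x ^+ 2 + 2 * v x * c x) N.
  have H := has_coefsD (has_coefsD (has_coefsM m0 va va aA aA) (has_coefsM m0 cb cb bB bB)) (has_coefsZ 2 (has_coefsM m0 va cb aA bB)).
  by apply: has_coefs_extf H => x; ring.
have hX : has_coefs (fun x => 2 * (v x * h x + c x * h x)) X.
  exact: has_coefsZ 2 (has_coefsD (has_coefsM m0 va hd aA dD) (has_coefsM m0 cb hd bB dD)).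
have hH := has_coefsM m0 hd hd dD dD.
have hE (e : R) : has_coefs (fun x => (v x + e%:C * h x) ^+ 2 + c x ^+ 2 + 2 * (v x + e%:C * h x) * c x)
   (fun k => N k + e%:C * X k + (e%:C * e%:C) * cv d d k).
  have H := has_coefsD (has_coefsD hN (has_coefsZ e%:C hX)) (has_coefsZ (e%:C * e%:C) hH).
  by apply: has_coefs_extf H => x; ring.
have hP v' n : has_coefs (fun x => v' x ^+ 2 + c x ^+ 2 + 2 * v' x * c x) n ->
    has_coefs (Phi v') (fun k => beta m k * n k).
  move=> H; rewrite PhiE; apply: has_coefs_ext (has_coefsZ (- ('i / 4)) (has_coefs_opB m0 H)) => k.
  by rewrite /beta fmorphV; ring.
have hQ (e : R) := has_coefsZ (e^-1)%:C (has_coefsB (hP _ _ (hE e)) (hP _ _ hN)).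
have hg : has_coefs ((- ('i / 4)) \*o opB m (fun x => 2 * (v x * h x + c x * h x))) (fun k => beta m k * X k).
  by apply: has_coefs_ext (has_coefsZ (- ('i / 4)) (has_coefs_opB m0 hX)) => k; rewrite /beta fmorphV; ring.
have hG : has_coefs ((- ('i / 4)) \*o opB m (fun x => h x * h x)) (fun k => beta m k * cv d d k).
  by apply: has_coefs_ext (has_coefsZ (- ('i / 4)) (has_coefs_opB m0 hH)) => k; rewrite /beta fmorphV; ring.
apply: (diff_at_coefs hg); first by move=> e; exact: (hQ e).1.
set G := Num.sqrt (sqI ((- ('i / 4)) \*o opB m (fun x => h x * h x))).
have rem (e : R) : e != 0 ->
   L2norm (fun x => (e^-1)%:C * (Phi (fun y => v y + e%:C * h y) x - Phi v x)
      - ((- ('i / 4)) \*o opB m (fun x => 2 * (v x * h x + c x * h x))) x) = (`|e| * G)%:E.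
  move=> e0; have hR := has_coefsB (hQ e) hg.
  have hS := has_coefsZ e%:C hG.
  have e0C : e%:C != 0 :> R[i] by rewrite -normc_eq0P normcR normr_eq0.
  have hR' : has_coefs (fun x => (e^-1)%:C * (Phi (fun y => v y + e%:C * h y) x - Phi v x)
      - ((- ('i / 4)) \*o opB m (fun x => 2 * (v x * h x + c x * h x))) x)
      (fun k => e%:C * (beta m k * cv d d k)).
    by apply: has_coefs_ext hR => k; rewrite fmorphV; move: (X k) (N k) (beta m k) => ? ? ?; field.
  rewrite (L2normE hR'.1) (ae_sqI hR'.1 hS.1.1 (has_coefs_ae hR' hS)); congr EFin.
  rewrite /G -[in RHS]sqrtr_sqr -sqrtrM ?sqr_ge0//; congr Num.sqrt.
  rewrite /sqI -I_Z; last exact: hG.1.2.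
  by apply: I_ext => x; rewrite Normc.normcM exprMn normcR real_normK ?num_real.
apply: cvg_EFin.
  by near=> e; rewrite rem//; near: e; exact: nbhs_dnbhs_neq.
apply/cvgrPdist_lt => eps eps0.
have G0 : 0 < G + 1 by rewrite ltr_wpDl// sqrtr_ge0.
near=> e; have e0 : e != 0 by near: e; exact: nbhs_dnbhs_neq.
rewrite /= rem//= sub0r normrN ger0_norm ?mulr_ge0 ?sqrtr_ge0//.
have el : `|e| < eps / (G + 1) by near: e; apply: dnbhs0_lt; rewrite divr_gt0.
apply: (@le_lt_trans _ _ (`|e| * (G + 1))); first by rewrite ler_wpM2l// lerDl.
by rewrite -ltr_pdivlMr.
Unshelve. all: by end_near. Qed.

End SchemeCoefficients.

(** * One step of the scheme *)

Section Step.
Context {R : realType} (m : R).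
Hypothesis m0 : m != 0.
Local Notation mu := (haar R).
Local Notation w := (jap m).
Local Notation N34 := (l2_le (w34 m)).
Local Notation N1 := (l2_le (w1 m)).
Implicit Types (f g h u v : T3 R -> R[i]) (k j l : Z3) (a b p q s : Z3 -> R[i]).
Local Notation cv := (fconv (fun _ _ => 1)).
Local Notation dA := (dA m).
Local Notation P1 := (phA m (@phi1 R)).
Local Notation P2 := (phA m (@phi2 R)).

Let W0 k : 0 <= w34 m k := ltW (w34_gt0 m0 k).

Let one_le (k : Z3) : normc ((fun=> 1 : R[i]) k) <= 1. Proof. by rewrite Normc.normc1. Qed.
Let cis_le (f : Z3 -> R) (k : Z3) : normc (cis (f k)) <= 1. Proof. by rewrite normc_cis. Qed.

Let cisM_le tau (f : Z3 -> R) (k : Z3) : tau != 0 ->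
  normc (P2 tau k * cis (f k)) <= 2.
Proof. by move=> t0; rewrite Normc.normcM normc_cis mulr1 phA2_bound. Qed.

(** At the end of the step the antiderivatives become the functions phi1 and
    phi2 of the scheme. *)
Lemma symX_phi tau x y j l : 0 < tau ->
  symX m tau tau x y j l =
  tau%:C * phi1 ('i * (tau * domf m x y j l)%:C)
  + tau%:C * phi2 ('i * (tau * domf m x y j l)%:C) * kap m tau x y j l.
Proof.
move=> t0; have tn : tau != 0 by rewrite gt_eqF.
have d0 := domf_neq0 m0 x y j l.
rewrite /symX prim1_phi1// prim2_phi2//; congr (_ + _).
have tC : tau%:C != 0 :> R[i] by rewrite -normc_eq0P normcR normr_eq0.
by rewrite fmorphV; move: (phi2 _) (kap _ _ _ _ _ _) => p q; field.
Qed.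

Let mul1f a : (fun k => 1 * a k) = a. Proof. by apply/funext => k; rewrite mul1r. Qed.

Variables (tau : R) (u : T3 R -> R[i]) (a : Z3 -> R[i]) (A : R).
Hypotheses (t0 : 0 < tau) (ua : has_coefs u a) (aA : N1 a A).

Let tn : tau != 0. Proof. by rewrite gt_eqF. Qed.
Let b := star a.
Let a34 : N34 a (emb m * A). Proof. exact: l2_le_34_1. Qed.
Let b34 : N34 b (emb m * A). Proof. exact: l2_le_34_star. Qed.
Let ubb : has_coefs (cbar u) b. Proof. exact: has_coefs_conj. Qed.

Let L k : R[i] := cis (tau * w k).
Let Li k : R[i] := cis (- tau * w k).
Let E k : R[i] := cis (tau * dA k).
Let Ei k : R[i] := cis (- tau * dA k).

Let LLi k : L k * Li k = 1.
Proof. by rewrite /L /Li -cisD mulNr subrr cis0. Qed.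

Let EEi k : E k * Ei k = 1.
Proof. by rewrite /E /Ei -cisD mulNr subrr cis0. Qed.

(** The product u^2 in the scheme: the functions of A act on the constant
    component of G, that is at frequency zero. *)
Lemma convFF k : fconv (symX m tau tau false false) a a k =
  (tau%:C * P1 tau 0 + tau%:C * P2 tau 0 * (Ei 0 - 1) - tau%:C * P2 tau 0) * cv a a k
  + tau%:C * P2 tau 0 * Li k * cv (fun k => L k * a k) (fun k => L k * a k) k.
Proof.
rewrite (@conv_sep3 _ m m0 _
  (fun=> tau%:C * P1 tau 0 + tau%:C * P2 tau 0 * (Ei 0 - 1) - tau%:C * P2 tau 0)
  (fun=> 1) (fun=> 1)
  (fun k => tau%:C * P2 tau 0 * Li k) L L
  (fun=> 0) (fun=> 1) (fun=> 1) a a _ _ 1 1 1 1 1 1 k a34 a34)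
 ?mul1f ?mul0r ?addr0//.
- exact: cis_le.
- exact: cis_le.
move=> j l; rewrite symX_phi// /kap /bet /domf /gam /= -/(dA 0).
rewrite -[phi1 _]/(P1 tau 0) -[phi2 _]/(P2 tau 0).
have -> : cis (tau * (2 * w 0)) = Ei 0 by rewrite /Ei /dA; congr cis; ring.
have -> : cis (tau * (w j + w l - w (j + l))) = Li (j + l) * (L j * L l).
  by rewrite /Li /L -!cisD; congr cis; ring.
by move: (P1 _ _) (P2 _ _) (Li _) (L _) (L _) (Ei 0) => *; ring.
Qed.

(** The product u conj(u) in the scheme: the functions of A act on conj(u), and
    the twisted difference of G vanishes on this component because it is
    linear. *)
Lemma convFT k : fconv (symX m tau tau false true) a b k =
  tau%:C * cv a (fun k => P1 tau k * b k) k
  - tau%:C * cv a (fun k => P2 tau k * b k) k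
  + tau%:C * Li k * cv (fun k => L k * a k) (fun k => P2 tau k * L k * b k) k.
Proof.
rewrite (@conv_sep3 _ m m0 _
  (fun=> tau%:C) (fun=> 1) (P1 tau)
  (fun=> - tau%:C) (fun=> 1) (P2 tau)
  (fun k => tau%:C * Li k) L (fun k => P2 tau k * L k) a b _ _ 1 2 1 2 1 2 k a34 b34)
 ?mul1f ?mulNr//.
- by move=> i; exact: phA1_bound.
- by move=> i; exact: phA2_bound.
- exact: cis_le.
- by move=> i; exact: (cisM_le (fun i => tau * w i) i tn).
move=> j l; rewrite symX_phi// /kap /bet /domf /gam /= -/(dA l).
rewrite -[phi1 _]/(P1 tau l) -[phi2 _]/(P2 tau l) mulr0 cis0.
have -> : cis (tau * (w j + w l - w (j + l))) = Li (j + l) * (L j * L l).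
  by rewrite /Li /L -!cisD; congr cis; ring.
by move: (P1 _ _) (P2 _ _) (Li _) (L _) (L _) => *; ring.
Qed.

(** The product conj(u)^2 in the scheme: the functions of A act on the whole
    square, that is at the output frequency. *)
Lemma convTT k : fconv (symX m tau tau true true) b b k =
  (tau%:C * P1 tau k - 2 * (tau%:C * P2 tau k)) * cv b b k
  + tau%:C * P2 tau k * Ei k * cv (fun k => E k * b k) (fun k => E k * b k) k
  + tau%:C * P2 tau k * Li k * cv (fun k => L k * b k) (fun k => L k * b k) k.
Proof.
rewrite (@conv_sep3 _ m m0 _
  (fun k => tau%:C * P1 tau k - 2 * (tau%:C * P2 tau k)) (fun=> 1) (fun=> 1)
  (fun k => tau%:C * P2 tau k * Ei k) E E
  (fun k => tau%:C * P2 tau k * Li k) L L b b _ _ 1 1 1 1 1 1 k b34 b34)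
 ?mul1f//.
- exact: cis_le.
- exact: cis_le.
- exact: cis_le.
- exact: cis_le.
move=> j l; rewrite symX_phi// /kap /bet /domf /gam /= -/(dA (j + l)).
rewrite -[phi1 _]/(P1 tau (j + l)) -[phi2 _]/(P2 tau (j + l)).
have -> : cis (tau * (w j + w l - w (j + l))) = Li (j + l) * (L j * L l).
  by rewrite /Li /L -!cisD; congr cis; ring.
have -> : cis (tau * (- (2 * (w j + w l - w (j + l))))) = Ei (j + l) * (E j * E l).
  by rewrite /Ei /E /dA -!cisD; congr cis; ring.
by move: (P1 _ _) (P2 _ _) (Li _) (L _) (L _) (E _) (E _) (Ei _) => *; ring.
Qed.

Let onem_cv x y : onem x y = (fun _ _ => 1) :> (Z3 -> Z3 -> R[i]). Proof. by []. Qed.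

(** The functions u and conj(u) are square integrable with square integrable
    products, so f(u, conj u) has the coefficients given by the quadratic form. *)
Lemma nlS_coefs : has_coefs (nlf m u (cbar u)) (nonlin m a).
Proof.
have H := has_coefsD (has_coefsD (has_coefsM m0 ua ua a34 a34) (has_coefsM m0 ubb ubb b34 b34)) (has_coefsZ 2 (has_coefsM m0 ua ubb a34 b34)).
have H' : has_coefs (fun x => u x ^+ 2 + cbar u x ^+ 2 + 2 * u x * cbar u x)
   (fun k => cv a a k + cv b b k + 2 * cv a b k).
  by apply: has_coefs_extf H => x; ring.
apply: has_coefs_ext (has_coefsZ (- ('i / 4)) (has_coefs_opB m0 H')) => k.
rewrite /nonlin /quad_form /Qm !onem_cv /beta fmorphV -/b; ring.
Qed.

Let g := nonlin m a.
Let gB := l2_le_nlS m0 aA.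
Let g34 := l2_le_34_1 m0 gB.
Let sg34 := l2_le_34_star g34.

(** The sum of the two partial differentials is the differential of
    u |-> f(u, conj u), the form Dnonlin, up to commutativity of the products. *)
Lemma Dterm_coefs : has_coefs
  (D1f m u (cbar u) (nlf m u (cbar u)) \+ D2f m u (cbar u) (cbar (nlf m u (cbar u))))
  (Dnonlin m a g).
Proof.
have gc := nlS_coefs; have gbc := has_coefs_conj gc.
have H1 : has_coefs (D1f m u (cbar u) (nlf m u (cbar u)))
   (fun k => beta m k * (2 * (cv a g k + cv b g k))).
  exact: (dquad_coefs m0 (fun v' => erefl) ua ubb gc a34 b34 g34).
have H2 : has_coefs (D2f m u (cbar u) (cbar (nlf m u (cbar u))))
   (fun k => beta m k * (2 * (cv b (star g) k + cv a (star g) k))).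
  apply: (dquad_coefs m0 _ ubb ua gbc b34 a34 sg34) => v'.
  by rewrite /nlf; congr (_ \*o opB m _); apply/funext => x; ring.
apply: has_coefs_ext (has_coefsD H1 H2) => k; rewrite /Dnonlin /quad_form /Qm !onem_cv -/b.
have e1 := cvC m0 k ua gc a34 g34; have e2 := cvC m0 k ubb gc b34 g34.
have e3 := cvC m0 k ubb gbc b34 sg34.
rewrite -/g in e1 e2 e3 *; rewrite -e1 -e2 -e3.
by move: (cv a g k) (cv b g k) (cv a (star g) k) (cv b (star g) k) (beta m k) => *; ring.
Qed.

(** The four corrections of the scheme are rewritten on coefficients. The
    quadratic ones add up to the form with symbol symX, the last one is the
    Taylor term of twisted. *)
Lemma step_coefs : has_coefs (step m tau u) (stepS m tau a).
Proof.
have P1b k : normc (P1 tau k) <= 2 by exact: phA1_bound.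
have P2b k : normc (P2 tau k) <= 2 by exact: phA2_bound.
have bb := has_coefsM m0 ubb ubb b34 b34.
have E34 : N34 (fun k => E k * b k) (1 * (emb m * A)).
  by apply: l2_le_mul b34 => // k; rewrite normc_cis.
have La34 : N34 (fun k => L k * a k) (1 * (emb m * A)).
  by apply: l2_le_mul a34 => // k; rewrite normc_cis.
have Lb34 : N34 (fun k => L k * b k) (1 * (emb m * A)).
  by apply: l2_le_mul b34 => // k; rewrite normc_cis.
have sq f x : f x ^+ 2 = f x * f x :> R[i] by [].
have one := has_coefs_cst (1 : R[i]).
(* the terms of the scheme in which a function of tau A is applied to G(v) *)
have ph psi (psib : forall k, normc (phA m psi tau k) <= 2) v c C :
    has_coefs v c -> N34 c C ->
    forall u' a' A', has_coefs u' a' -> N34 a' A' ->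
    has_coefs (opB m (vdot (nlF u') (vmap (funA m tau psi) (nlG v))))
     (fun k => beta m k * (phA m psi tau 0 * cv a' a' k + phA m psi tau k * cv c c k
        + 2 * cv a' (fun k => phA m psi tau k * c k) k)).
  move=> vc cC u' a' A' ua' aA'.
  have h0 := has_coefs_funA (m := m) one psib.
  have h1 := has_coefs_funA (m := m) (has_coefsM m0 vc vc cC cC) psib.
  have h2 := has_coefs_funA (m := m) vc psib.
  have two : 0 <= 2 :> R by [].
  have h3 := l2_le_mul W0 psib two cC.
  apply: (@has_coefs_BF _ _ m0 u' a' (vmap (funA m tau psi) (nlG v)) _ _ _ _ _ ua' aA' _ h1 h2 h3).
  by apply: has_coefs_ext h0 => k; case: eqP => [->|_]; rewrite ?mulr0 ?mulr1 ?mul1r.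
have T1 := has_coefs_eL m tau (ph _ P1b _ _ _ ubb b34 _ _ _ ua a34).
have T3b := has_coefs_eL m tau (ph _ P2b _ _ _ ubb b34 _ _ _ ua a34).
have T3a := ph _ P2b _ _ _ (has_coefs_eL m tau ubb) Lb34 _ _ _ (has_coefs_eL m tau ua) La34.
have T2 : has_coefs (opB m (vdot (nlF u) (vmap (funA m tau (@phi2 R))
    (vsub (vmap (funA m (- tau) (@expC R)) (nlG (funA m tau (@expC R) (cbar u)))) (nlG (cbar u))))))
  (fun k => beta m k * (P2 tau 0 * (Ei 0 - 1) * cv a a k
      + P2 tau k * (Ei k * cv (fun k => E k * b k) (fun k => E k * b k) k - cv b b k)
      + 2 * cv a (fun=> 0) k)).
  have Eu := has_coefs_eA m tau ubb.
  have h0 := has_coefs_funA (m := m) (has_coefsB (has_coefs_eA m (- tau) one) one) P2b.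
  have h1 := has_coefs_funA (m := m) (has_coefsB (has_coefs_eA m (- tau) (has_coefsM m0 Eu Eu E34 E34)) bb) P2b.
  have h2 := has_coefs_funA (m := m) (has_coefsB (has_coefs_eA m (- tau) Eu) ubb) P2b.
  apply: (@has_coefs_BF _ _ m0 u a (vmap (funA m tau (@phi2 R))
    (vsub (vmap (funA m (- tau) (@expC R)) (nlG (funA m tau (@expC R) (cbar u)))) (nlG (cbar u))))
    _ _ _ _ _ ua a34 _ h1 _ (l2_le0 _)).
    by apply: has_coefs_ext h0 => k; case: eqP => [->|_]; rewrite ?mulr0 ?mulr1 ?mul1r ?subrr ?mulr0.
  apply: has_coefs_ext h2 => k; rewrite mulrA -[X in X * _ - _]/(Ei k * E k).
  by rewrite [Ei k * _]mulrC EEi mul1r subrr mulr0.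
have {}T2 := has_coefs_eL m tau T2.
have TD := has_coefsZ (tau ^+ 2 / 2)%:C (has_coefs_eL m tau Dterm_coefs).
have cv0 k : cv a (fun=> 0) k = 0.
  have := conv1_bound m0 a34 (l2_le0 (w34 m)); rewrite !mulr0 => -[_ /(_ [:: k] isT)].
  by rewrite big_seq1 mul1r expr0n /= exprn_even_le0//= => h; apply/eqP; rewrite -normc_eq0P.
have T := has_coefsD (has_coefsD (has_coefsD (has_coefsD (has_coefs_eL m tau ua) (has_coefsZ tau%:C T1)) (has_coefsZ tau%:C T2))
   (has_coefsZ tau%:C (has_coefsB T3a T3b))) TD.
apply: has_coefs_ext T => k; rewrite cv0 /stepS /twisted /quad_form /Qm -/b.
rewrite convFF convFT convTT -/(L k).
move: (Dnonlin m a g k) (LLi k) => D.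
have -> : (fun k => P2 tau k * (cis (tau * w k) * b k)) = (fun k => P2 tau k * L k * b k).
  by apply/funext => i; rewrite mulrA.
move: (cv _ _ k) (cv _ _ k) (cv _ _ k) (cv _ _ k) (cv _ _ k) (cv _ _ k) (cv _ _ k) (cv _ _ k).
move: (P1 _ _) (P1 _ _) (P2 _ _) (P2 _ _) (Li k) (L k) (Ei k) (Ei 0) (beta m k) (a k).
move=> p1 p2 p3 p4 li l ei e0 be ak c1 c2 c3 c4 c5 c6 c7 c8 ll.
(* the first of these terms carries no transport by the free flow *)
have -> : be * (p4 * c4 + p3 * c3 + 2 * c2) = l * li * (be * (p4 * c4 + p3 * c3 + 2 * c2)).
  by rewrite ll mul1r.
ring.
Qed.

End Step.

(** * Sobolev weights *)

Section SobolevWeights.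
Context {R : realType}.
Local Notation mu := (haar R).
Implicit Types (f g : T3 R -> R[i]) (k : Z3) (a : Z3 -> R[i]) (s : R).

(** The weights that define the Sobolev norms. *)
Definition ws s k : R := (1 + sqnorm3 R k) `^ s.

Let y_ge1 k : 1 <= 1 + sqnorm3 R k.
Proof. by rewrite lerDl sqnorm3_ge0. Qed.

Let y_ge0 k : 0 <= 1 + sqnorm3 R k. Proof. exact: le_trans ler01 (y_ge1 k). Qed.

Lemma ws_ge0 s k : 0 <= ws s k. Proof. exact: powR_ge0. Qed.

Lemma ws_ge1 s k : 0 <= s -> 1 <= ws s k.
Proof. by move=> s0; have := ge0_ler_powR s0 _ _ (y_ge1 k); rewrite powR1; apply; rewrite nnegrE. Qed.

Lemma esum_uniqP (w : Z3 -> R) (B : R) : (forall k, 0 <= w k) ->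
  (\esum_(k in [set: Z3]) (w k)%:E <= B%:E)%E <->
  forall K, uniq K -> \sum_(k <- K) w k <= B.
Proof.
move=> w0; split=> [H K uK|H].
  rewrite -lee_fin -sumEFin; apply: le_trans H; apply: esum_ge.
  exists [set` K]; first by split => //; exact: finite_seq.
  by rewrite fsbig_seq.
apply: ge_ereal_sup => _ [A [fA _] <-].
rewrite (fsbig_finite _ _ fA) sumEFin lee_fin; apply: H; exact: finmap.fset_uniq.
Qed.

(** An extended sum over all frequencies is the supremum of its finite parts. *)
Lemma Hnorm_l2_le s f B : 0 <= B ->
  (Hnorm s f <= B%:E)%E <-> sqint f /\ l2_le (ws s) (fourier f) B.
Proof.
move=> B0; rewrite /Hnorm; case: asboolP => [/L2P lf|nf]; last first.
  by split=> [|[/L2P]]//; rewrite leye_eq.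
have t0 k : 0 <= ws s k * normc (fourier f k) ^+ 2 by rewrite mulr_ge0 ?ws_ge0 ?sqr_ge0.
have -> : l2_le (ws s) (fourier f) B <-> (\esum_(k in [set: Z3]) (ws s k * normc (fourier f k) ^+ 2)%:E <= (B ^+ 2)%:E)%E.
  by rewrite esum_uniqP//; split=> [[]//|H]; split.
have : (0 <= \esum_(k in [set: Z3]) (ws s k * normc (fourier f k) ^+ 2)%:E)%E.
  by apply: esum_ge0 => k _; rewrite lee_fin.
rewrite -/(ws s); case: (esum _ _) => [r| |]//.
  rewrite lee_fin poweR_EFin !lee_fin => r0; rewrite powR12_sqrt//.
  rewrite -{1}[B]ger0_norm// -sqrtr_sqr ler_sqrt ?sqr_ge0//.
  by split=> [|[]].
by move=> _; rewrite poweRyr ?invr_eq0 ?pnatr_eq0//; split=> [|[_]]; rewrite leye_eq.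
Qed.

Lemma Hnorm_ge0 s f : (0 <= Hnorm s f)%E.
Proof. by rewrite /Hnorm; case: ifP => // _; exact: poweR_ge0. Qed.

Lemma HsP s f : Hs s f -> Hnorm s f = (fine (Hnorm s f))%:E.
Proof. by rewrite /Hs => H; rewrite fineK// ge0_fin_numE// Hnorm_ge0. Qed.

Lemma Hs_l2_le s f : Hs s f -> sqint f /\ l2_le (ws s) (fourier f) (fine (Hnorm s f)).
Proof.
by move=> H; apply/Hnorm_l2_le; [rewrite fine_ge0// Hnorm_ge0|rewrite -HsP].
Qed.

Lemma l2_le_coef s a A k : 0 <= s -> l2_le (ws s) a A -> normc (a k) <= A.
Proof.
move=> s0 [A0 /(_ [:: k] isT)]; rewrite big_seq1 => H.
rewrite -(ler_pXn2r (ltn0Sn 1)) ?nnegrE ?normc_ge0//; apply: le_trans H.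
by rewrite -[leLHS]mul1r ler_wpM2r ?sqr_ge0// ws_ge1.
Qed.

Variable m : R.
Hypothesis m0 : m != 0.
Local Notation w := (jap m).

(** A constant for the comparison of 1 + |k|^2 with |k|^2 + m^2 in both
    directions. *)
Definition cw : R := 1 + m ^+ 2 + (m ^+ 2)^-1.

Let m2 : 0 < m ^+ 2. Proof. by rewrite exprn_even_gt0. Qed.
Let m2i : 0 < (m ^+ 2)^-1. Proof. by rewrite invr_gt0. Qed.

Lemma cw_ge1 : 1 <= cw.
Proof. by rewrite /cw -addrA lerDl addr_ge0 ?ltW. Qed.
Lemma cw_ge0 : 0 <= cw. Proof. exact: le_trans ler01 cw_ge1. Qed.

Let jap_le k : w k ^+ 2 <= cw * (1 + sqnorm3 R k).
Proof.
rewrite sqr_jap; have := @sqnorm3_ge0 R k; move: (sqnorm3 R k) => y y0.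
have h1 : 0 <= m ^+ 2 * y by rewrite mulr_ge0// ltW.
have h2 : 0 <= (m ^+ 2)^-1 * y by rewrite mulr_ge0// ltW.
rewrite /cw; move: h1 h2 (ltW m2) (ltW m2i).
move: (m ^+ 2) (m ^+ 2)^-1 => x xi; lra.
Qed.

Let le_jap k : 1 + sqnorm3 R k <= cw * w k ^+ 2.
Proof.
rewrite sqr_jap; have := @sqnorm3_ge0 R k; move: (sqnorm3 R k) => y y0.
have h1 : 0 <= m ^+ 2 * y by rewrite mulr_ge0// ltW.
have h2 : 0 <= (m ^+ 2)^-1 * y by rewrite mulr_ge0// ltW.
have h3 : (m ^+ 2)^-1 * m ^+ 2 = 1 by rewrite mulVf// gt_eqF.
have h4 : 0 <= m ^+ 2 * m ^+ 2 by rewrite mulr_ge0 ?ltW.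
rewrite /cw; move: h1 h2 h3 h4 (ltW m2).
move: (m ^+ 2) (m ^+ 2)^-1 => x xi h1 h2 h3 h4 h5.
have -> : (1 + x + xi) * (y + x) = y + x + x * y + x * x + xi * y + xi * x by ring.
by rewrite h3; lra.
Qed.

Let q := Num.sqrt (Num.sqrt cw).
Let q4 : q ^+ 4 = cw.
Proof. by rewrite (exprM _ 2 2) sqr_sqrtr ?sqrtr_ge0// sqr_sqrtr// cw_ge0. Qed.
Let q1 : 1 <= q.
Proof.
have h x : 1 <= x -> 1 <= Num.sqrt x :> R by move=> x1; rewrite -[leLHS]sqrtr1 ler_wsqrtr.
by apply: (h); apply: (h); exact: cw_ge1.
Qed.

Lemma ws34E k : ws (3 / 4) k = Num.sqrt (Num.sqrt (1 + sqnorm3 R k)) ^+ 3.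
Proof.
have -> : 3 / 4 = 2^-1 * (2^-1 * 3) :> R by field.
by rewrite /ws powRrM powRrM !powR12_sqrt ?sqrtr_ge0// (powR_mulrn 3)// sqrtr_ge0.
Qed.

Lemma ws74E k : ws (7 / 4) k = ws (3 / 4) k * (1 + sqnorm3 R k).
Proof.
have -> : 7 / 4 = 3 / 4 + 1 :> R by field.
by rewrite /ws powRD ?powRr1//; apply/implyP => _; rewrite gt_eqF// (lt_le_trans _ (y_ge1 k)).
Qed.

Let w34_le k : w34 m k <= q ^+ 3 * ws (3 / 4) k.
Proof.
rewrite ws34E -exprMn lerXn2r ?nnegrE ?mulr_ge0 ?sqrtr_ge0//.
rewrite -!sqrtrM ?sqrtr_ge0 ?cw_ge0// ler_wsqrtr//.
by rewrite -[leLHS]ger0_norm ?jap_ge0// -sqrtr_sqr ler_wsqrtr.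
Qed.

Lemma l2_le_w34 a A : l2_le (ws (3 / 4)) a A -> l2_le (w34 m) a (cw * A).
Proof.
apply: l2_le_weight => [||k]; [exact: cw_ge0|exact: ws_ge0|].
rewrite [leRHS]mulrA; apply: ler_wpM2r; first exact: sqr_ge0.
apply: le_trans (w34_le k) _; apply: ler_wpM2r; first exact: ws_ge0.
by rewrite -q4 -exprM ler_weXn2l.
Qed.

Lemma l2_le_w74 a A : l2_le (ws (7 / 4)) a A -> l2_le (w74 m) a (cw * A).
Proof.
apply: l2_le_weight => [||k]; [exact: cw_ge0|exact: ws_ge0|].
rewrite [leRHS]mulrA; apply: ler_wpM2r; first exact: sqr_ge0.
apply: (@le_trans _ _ ((q ^+ 3 * ws (3 / 4) k) * (cw * (1 + sqnorm3 R k)))).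
  by apply: ler_pM; [exact: ltW (w34_gt0 m0 k)|exact: sqr_ge0|exact: w34_le|exact: jap_le].
rewrite ws74E mulrACA; apply: ler_wpM2r; first by rewrite mulr_ge0// ws_ge0.
by rewrite -q4 -exprD -exprM ler_weXn2l.
Qed.

Lemma l2_le_ws1 a A : l2_le (w1 m) a A -> l2_le (ws 1) a (cw * A).
Proof.
apply: l2_le_weight => [||k]; [exact: cw_ge0|exact: w1_ge0|].
rewrite [leRHS]mulrA; apply: ler_wpM2r; first exact: sqr_ge0.
rewrite /ws powRr1//; apply: le_trans (le_jap k) _.
apply: ler_wpM2r; first exact: sqr_ge0.
by rewrite expr2 ler_peMr ?cw_ge0 ?cw_ge1.
Qed.

End SobolevWeights.

(** * Continuous paths in Sobolev spaces *)

Section Paths.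
Context {R : realType}.
Local Notation mu := (haar R).
Implicit Types (f g : T3 R -> R[i]) (k : Z3) (a : Z3 -> R[i]) (s t T : R)
  (z : R -> T3 R -> R).

Definition coefs z t : Z3 -> R[i] := fourier (toC (z t)).

Lemma Hnorm_near (F : set_system R) {FF : Filter F} s (f : R -> T3 R -> R[i]) :
  Hnorm s (f r) @[r --> F] --> 0%E ->
  forall e : R, 0 < e -> \forall r \near F, (Hnorm s (f r) <= e%:E)%E.
Proof.
move=> H e e0.
have nb : nbhs (0%E : \bar R) [set y | (y < e%:E)%E].
  by apply: open_nbhs_nbhs; split; [exact: open_ereal_lt_ereal|rewrite /= lte_fin].
by apply: (@filterS _ F FF _ _ _ (H _ nb)) => r; exact: ltW.
Qed.

Variables (T s : R) (z : R -> T3 R -> R).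
Hypotheses (T0 : 0 < T) (s0 : 0 <= s) (cz : contH T s z).

Lemma contH_sqint t : 0 <= t <= T -> sqint (toC (z t)).
Proof. by move=> tT; have [] := cz (t := t); rewrite ?in_itv// => /Hs_l2_le[]. Qed.

Let phi t := fine (Hnorm s (toC (z t))).

Let phi_hb t : 0 <= t <= T -> l2_le (ws s) (coefs z t) (phi t).
Proof. by move=> tT; have [] := cz (t := t); rewrite ?in_itv// => /Hs_l2_le[]. Qed.

Let phi_le t B : 0 <= t <= T -> l2_le (ws s) (coefs z t) B -> phi t <= B.
Proof.
move=> tT tB; have [] := cz (t := t); rewrite ?in_itv// => /HsP H _.
rewrite -lee_fin -H; apply/Hnorm_l2_le; first exact: l2_le_ge0 tB.
by split=> //; exact: contH_sqint.
Qed.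

Lemma contH_near t e : 0 <= t <= T -> 0 < e ->
  \forall r \near within `[0, T] (nbhs t),
    0 <= r <= T /\ l2_le (ws s) (fun k => coefs z r k - coefs z t k) e.
Proof.
move=> tT e0; have [] := cz (t := t); rewrite ?in_itv// => _ H.
apply: filterS2 (withinT `[0, T] (nbhs_filter t)) (Hnorm_near H e0) => r rT H1.
have rT' : 0 <= r <= T by move: rT; rewrite /= in_itv.
split=> //; have /(Hnorm_l2_le _ _ (ltW e0)) := H1; move=> [_].
apply: l2_le_ext => k; rewrite -(fourierB k (sqint_cintg (contH_sqint rT')) (sqint_cintg (contH_sqint tT))).
by congr (fourier _ k); apply/funext => x; rewrite /toC rmorphB.
Qed.

(** The norm along the path is a continuous real function on the segment. *)
Lemma contH_bound : exists M, forall t, 0 <= t <= T -> l2_le (ws s) (coefs z t) M.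
Proof.
have cphi : {within `[0, T], continuous phi}.
  apply/subspace_continuousP => t; rewrite /= in_itv => tT.
  apply/cvgrPdist_le => e e0.
  apply: filterS (contH_near tT e0) => r [rT H].
  have h1 : phi r <= e + phi t.
    apply: phi_le => //; apply: l2_le_ext (l2_leD (ws_ge0 s) H (phi_hb tT)) => k.
    by rewrite subrK.
  have h2 : phi t <= phi r + e.
    apply: phi_le => //; apply: l2_le_ext (l2_leB (ws_ge0 s) (phi_hb rT) H) => k.
    by rewrite subKr.
  change (`|phi t - phi r| <= e); rewrite ler_distl; move: h1 h2; move: (phi r) (phi t) => x y h1 h2.
  by apply/andP; split; lra.
have [c _ Hc] := EVT_max (ltW T0) cphi.
exists (phi c) => t tT; apply: l2_le_monoM (phi_hb tT).
by apply: Hc; rewrite in_itv.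
Qed.

Lemma contH_ccont k : ccont T (fun t => coefs z t k).
Proof.
split; apply/subspace_continuousP => t; rewrite /= in_itv => tT;
  apply/cvgrPdist_le => e e0; apply: filterS (contH_near tT e0) => r [_ /(l2_le_coef k s0)]; apply: le_trans.
  change (`|Re (coefs z t k) - Re (coefs z r k)| <= normc (coefs z r k - coefs z t k)).
  by rewrite distrC; have := Re_le_normc (coefs z r k - coefs z t k); rewrite cReD cReN.
change (`|Im (coefs z t k) - Im (coefs z r k)| <= normc (coefs z r k - coefs z t k)).
by rewrite distrC; have := Im_le_normc (coefs z r k - coefs z t k); rewrite cImD cImN.
Qed.

Lemma is_derive_near (f : R -> R) t (l : R) :
  (forall e, 0 < e -> \forall r \near t^', `|(r - t)^-1 * (f r - f t) - l| <= e) ->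
  is_derive t (1 : R) f l.
Proof.
move=> H; apply/is_derive1_caratheodory.
exists (fun r => if r == t then l else (f r - f t) / (r - t)); split.
- move=> r; case: eqP => [->|/eqP rt]; first by rewrite !subrr mulr0.
  by rewrite -mulrA mulVf ?mulr1// subr_eq0.
- apply/cvgrPdist_le => e e0; rewrite eqxx.
  have N : \forall r \near nbhs t, r != t -> `|(r - t)^-1 * (f r - f t) - l| <= e := H e e0.
  near=> r; case: eqP => [_|/eqP rt]; first by rewrite subrr normr0 ltW.
  by rewrite distrC mulrC; move: rt; near: r.
- by rewrite eqxx.
Unshelve. all: by end_near. Qed.

End Paths.

(** Coefficients are bounded by the norm, so that limits in a Sobolev space are
    limits of each coefficient. *)
Lemma derivH_cder {R : realType} T s s' (z zt : R -> T3 R -> R) k t :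
  0 <= s' -> contH T s z -> contH T s' zt -> derivH T s' z zt -> 0 < t < T ->
  cder (fun r => coefs z r k) t (coefs zt t k).
Proof.
move=> s'0 cz czt dz /andP[t0 tT].
have tT' : 0 <= t <= T by rewrite !ltW.
have in_t : t \in `[0, T] by rewrite in_itv.
have near e : 0 < e -> \forall r \near t^',
    normc ((r - t)^-1%:C * (coefs z r k - coefs z t k) - coefs zt t k) <= e.
  move=> e0.
  have H : \forall r \near t^', r \in `[0, T] ->
      (Hnorm s' (toC (fun x => ((r - t)^-1 * (z r x - z t x) - zt t x)%R)) <= e%:E)%E.
    exact: Hnorm_near (dz t in_t) _ e0.
  have near_in : \forall r \near t^', 0 <= r <= T.
    apply: nbhs_dnbhs; have : t \in `]0, T[ by rewrite in_itv /= t0 tT.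
    by move=> /near_in_itvoo; apply: filterS => r; rewrite in_itv => /andP[/ltW -> /ltW ->].
  apply: filterS2 near_in H => r rT Hr0.
  have {Hr0}Hr := Hr0 ltac:(by rewrite in_itv).
  have /(Hnorm_l2_le _ _ (ltW e0))[_ /(l2_le_coef k s'0)] := Hr.
  have lr := sqint_cintg (contH_sqint cz rT); have lt := sqint_cintg (contH_sqint cz tT').
  have lzt := sqint_cintg (contH_sqint czt tT').
  rewrite /coefs -(fourierB k lr lt) -(fourierZ _ k (cintgB lr lt)).
  rewrite -(fourierB k (cintgZ _ (cintgB lr lt)) lzt); congr (normc (fourier _ k) <= _).
  by apply/funext => x; rewrite /toC !(rmorphB, rmorphM).
split; apply: is_derive_near => e e0; apply: filterS (near e e0) => r; apply: le_trans.
  have -> : (r - t)^-1 * (Re (coefs z r k) - Re (coefs z t k)) - Re (coefs zt t k)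
     = Re ((r - t)^-1%:C * (coefs z r k - coefs z t k) - coefs zt t k).
    by move: (coefs z r k) (coefs z t k) (coefs zt t k) => [a1 a2] [b1 b2] [c1 c2] /=; ring.
  exact: Re_le_normc.
have -> : (r - t)^-1 * (Im (coefs z r k) - Im (coefs z t k)) - Im (coefs zt t k)
   = Im ((r - t)^-1%:C * (coefs z r k - coefs z t k) - coefs zt t k).
  by move: (coefs z r k) (coefs z t k) (coefs zt t k) => [a1 a2] [b1 b2] [c1 c2] /=; ring.
exact: Im_le_normc.
Qed.

(** * The solution and the error *)

Section Solution.
Context {R : realType} (m : R).
Hypothesis m0 : m != 0.
Local Notation mu := (haar R).
Local Notation w := (jap m).
Local Notation N1 := (l2_le (w1 m)).
Local Notation cv := (fconv (fun _ _ => 1)).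
Implicit Types (f g u v : T3 R -> R[i]) (k : Z3) (a b c : Z3 -> R[i]).

Lemma has_coefs_real (f : T3 R -> R) : sqint (toC f) -> star (fourier (toC f)) = fourier (toC f).
Proof.
move=> lf; apply/funext => k; rewrite -(has_coefs_conj (has_coefsP lf)).2.
by congr (fourier _ k); apply/funext => x; rewrite /cbar /toC conjc_real.
Qed.

Lemma l2_le_w1_1 a A : N1 a A -> l2_le (fun=> 1) (fun k => (w k)%:C * a k) A.
Proof.
move=> [A0 H]; split=> // K uK; apply: le_trans (H _ uK).
by apply: ler_sum => k _; rewrite Normc.normcM normcR ger0_norm ?jap_ge0// exprMn mul1r.
Qed.

Lemma posn_half v x : 2^-1 * (v x + cbar v x) = posn v x.
Proof.
have -> : v x + cbar v x = 2 * posn v x.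
  rewrite mulr_natl mulr2n /posn /toC /cbar.
  by apply: complexP; case: (v x) => p q /=; rewrite ?subrr ?addr0.
by rewrite mulKf// pnatr_eq0.
Qed.

Lemma imag_half v x : (2 * 'i)^-1 * (v x - cbar v x) = toC (fun x => Im (v x)) x.
Proof.
have i0 : 2 * 'i != 0 :> R[i].
  by rewrite mulf_neq0 ?pnatr_eq0// -normc_eq0P normci oner_eq0.
have -> : v x - cbar v x = 2 * 'i * toC (fun x => Im (v x)) x.
  rewrite -mulrA mulr_natl mulr2n /toC /cbar.
  by apply: complexP; case: (v x) => p q /=; ring.
by rewrite mulKf.
Qed.

(** With z = Re u, the quadratic form of the first order system is z^2. Both
    sides are coefficients of the square of u + conj u. *)
Lemma square_coefs u f a c k : has_coefs u a -> has_coefs f c ->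
  (forall k, a k + star a k = 2 * c k) ->
  cv a a k + 2 * cv a (star a) k + cv (star a) (star a) k = 4 * fourier (fun x => f x * f x) k.
Proof.
move=> ua fc ac; have ub := has_coefs_conj ua.
have uu := has_coefsD ua ub; have ff := has_coefsZ 2 fc.
have i1 := cintgM ua.1 ua.1; have i2 := cintgM ua.1 ub.1; have i3 := cintgM ub.1 ub.1.
rewrite -(fourierZ 4 k (cintgM fc.1 fc.1)).
transitivity (fourier (fun x => (u x + cbar u x) * (u x + cbar u x)) k).
  have <- : (fun x => u x * u x + 2 * (u x * cbar u x) + cbar u x * cbar u x) =
     fun x => (u x + cbar u x) * (u x + cbar u x) by apply/funext => x; ring.
  rewrite (fourierD k (cintgD i1 (cintgZ 2 i2)) i3) (fourierD k i1 (cintgZ 2 i2)).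
  rewrite (fourierZ 2 k i2) (fourierM k ua.1 ua.1) (fourierM k ua.1 ub.1) (fourierM k ub.1 ub.1).
  by rewrite (has_coefsE ua) (has_coefsE ub).
have -> : (fun x => 4 * (f x * f x)) = fun x => 2 * f x * (2 * f x) by apply/funext => x; ring.
rewrite (fourierM k uu.1 uu.1) (fourierM k ff.1 ff.1) (has_coefsE uu) (has_coefsE ff).
by have -> : (fun k => a k + star a k) = (fun k => 2 * c k) by exact/funext.
Qed.

Variables (T : R) (z zt : R -> T3 R -> R).
Hypotheses (T0 : 0 < T) (cz : contH T (7 / 4) z) (dz : derivH T (3 / 4) z zt)
  (czt : contH T (3 / 4) zt) (eq_z : wave_eq m T z zt).

(** The coefficients of u = z - i <nabla>^(-1) z_t. *)
Definition sol t k : R[i] := coefs z t k - 'i * ((w k)^-1%:C * coefs zt t k).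

Let s74 : 0 <= 7 / 4 :> R. Proof. by rewrite divr_ge0. Qed.
Let s34 : 0 <= 3 / 4 :> R. Proof. by rewrite divr_ge0. Qed.

Let lz t : 0 <= t <= T -> has_coefs (toC (z t)) (coefs z t).
Proof. by move=> tT; exact: has_coefsP (contH_sqint cz tT). Qed.

Let lzt t : 0 <= t <= T -> has_coefs (toC (zt t)) (coefs zt t).
Proof. by move=> tT; exact: has_coefsP (contH_sqint czt tT). Qed.

Lemma sol_coefs t : 0 <= t <= T ->
  has_coefs (fun x => toC (z t) x - 'i * opB m (toC (zt t)) x) (sol t).
Proof. by move=> tT; exact: has_coefsB (lz tT) (has_coefsZ 'i (has_coefs_opB m0 (lzt tT))). Qed.

Lemma star_sol t k : 0 <= t <= T ->
  star (sol t) k = coefs z t k + 'i * ((w k)^-1%:C * coefs zt t k).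
Proof.
move=> tT; have := congr1 (fun a : Z3 -> R[i] => a k) (has_coefs_real (lz tT).1).
have := congr1 (fun a : Z3 -> R[i] => a k) (has_coefs_real (lzt tT).1); rewrite /star /coefs => e1 e2.
rewrite /sol conjcB !conjcM conjc_real japN e1 e2.
have -> : conjc ('i : R[i]) = - 'i by apply: complexP => /=; rewrite ?oppr0.
by rewrite mulNr opprK.
Qed.

Lemma sol_plus t k : 0 <= t <= T -> sol t k + star (sol t) k = 2 * coefs z t k.
Proof. by move=> tT; rewrite star_sol// /sol; ring. Qed.

Let wC k : (w k)%:C != 0 :> R[i].
Proof. by rewrite -normc_eq0P normcR normr_eq0 gt_eqF// jap_gt0. Qed.

Lemma sol_minus t k : 0 <= t <= T ->
  coefs zt t k = - ((w k)%:C * ((sol t k - star (sol t) k) / (2 * 'i))).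
Proof.
move=> tT; rewrite star_sol// /sol fmorphV; have wk := wC k.
have i0 : 'i != 0 :> R[i] by rewrite -normc_eq0P normci oner_eq0.
by field; rewrite i0 wk.
Qed.

Lemma sol_bound : exists M, forall t, 0 <= t <= T -> l2_le (w74 m) (sol t) M.
Proof.
have [M1 H1] := contH_bound T0 cz; have [M2 H2] := contH_bound T0 czt.
exists (cw m * M1 + 1 * (cw m * M2)) => t tT.
apply: l2_leB; [exact: w74_ge0|exact: l2_le_w74 (H1 t tT)|].
apply: l2_le_weight (l2_le_w34 m0 (H2 t tT)) => // k; first exact: ltW (w34_gt0 m0 k).
rewrite expr1n mul1r !Normc.normcM normci mul1r exprMn normcR real_normK ?num_real//.
by rewrite /w74 exprVn mulrA mulfK// expf_neq0// gt_eqF// jap_gt0.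
Qed.

Lemma sol_ccont k : ccont T (fun t => sol t k).
Proof.
apply: ccontB; first exact: contH_ccont s74 cz k.
have cst (d : R[i]) : ccont T (fun=> d) by split=> x; exact: cvg_cst.
by apply: ccontM => //; apply: ccontM => //; exact: contH_ccont s34 czt k.
Qed.

(** The wave equation as a first order system: the second derivative of z
    contributes - <nabla>^2 z, which combines with the derivative of z to
    i <nabla> u. *)
Lemma sol_cder t k : 0 < t < T ->
  cder (fun r => sol r k) t ('i * (w k)%:C * sol t k + nonlin m (sol t) k).
Proof.
move=> tT; have tT' : 0 <= t <= T by case/andP: tT => /ltW -> /ltW ->.
have d1 := derivH_cder k s34 cz czt dz tT.
have d2 : cder (fun r => coefs zt r k) t
  (fourier (toC (fun x => z t x ^+ 2)) k - (sqnorm3 R k + m ^+ 2)%:C * coefs z t k).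
  exact: eq_z.
have := cderB d1 (cderZ (Num.imaginary : R[i]) (cderZ (w k)^-1%:C d2)); congr (cder _ _ _).
rewrite /nonlin /quad_form /Qm (square_coefs k (sol_coefs tT') (lz tT') (fun k => sol_plus k tT')).
have -> : (fun x => toC (z t) x * toC (z t) x) = toC (fun x => z t x ^+ 2).
  by apply/funext => x; rewrite /toC expr2 rmorphM.
rewrite -sqr_jap rmorphXn /= /beta /sol fmorphV /=; have wk := wC k.
have i2 : 'i * 'i = -1 :> R[i] by rewrite -expr2 sqr_i.
move: (fourier _ k) (coefs z t k) (coefs zt t k) (w k)%:C wk => F Z V W W0.
apply/eqP; rewrite -subr_eq0; apply/eqP; transitivity (V * (1 + 'i * 'i)); last first.
  by rewrite i2 subrr mulr0.
by field.
Qed.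

(** Each iterate stays in H^1, so that the products and the differentials in the
    next step are defined. *)
Lemma scheme_coefs (u0 u1 : T3 R -> R) (tau : R) n : sqint (toC u0) -> sqint (toC u1) ->
  {ae mu, forall x, z 0 x = u0 x} -> {ae mu, forall x, zt 0 x = u1 x} -> 0 < tau ->
  has_coefs (scheme m tau u0 u1 n) (iter n (stepS m tau) (sol 0)) /\
  H1 m (iter n (stepS m tau) (sol 0)).
Proof.
move=> l0 l1 z0 zt0 t0; have T00 : 0 <= (0 : R) <= T by rewrite lexx ltW.
elim: n => [|n [IH [A hA]]]; last first.
  rewrite iterS; split.
    by rewrite /scheme iterS; exact: (step_coefs m0 t0 IH hA).
  have tt : 0 < tau <= tau by rewrite t0 lexx.
  by have h := l2_le_stepS m0 tt hA; exists (A + 10 * tau * (Tcst m * (A * A)) + tau ^+ 2 * (Tcst m * (A * (Tcst m * (A * A))))).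
split; last first.
  by have [M HM] := sol_bound; exists (emb m * M); apply: l2_le_1_74 => //; exact: HM.
have h0 : has_coefs (toC u0) (coefs z 0).
  by apply: ae_hc (lz T00) l0.1 _; apply: filterS z0 => x; rewrite /toC => ->.
have h1 : has_coefs (toC u1) (coefs zt 0).
  by apply: ae_hc (lzt T00) l1.1 _; apply: filterS zt0 => x; rewrite /toC => ->.
exact: has_coefsB h0 (has_coefsZ 'i (has_coefs_opB m0 h1)).
Qed.

(** The errors of z and z_t are the real part of u - v and - <nabla> times its
    imaginary part, so both are controlled by the H^1 norm of u - v. *)
Lemma error_bound t v b D : 0 <= t <= T -> has_coefs v b -> H1 m b -> N1 (fun k => sol t k - b k) D ->
  (Hnorm 1 (toC (z t) \- posn v)%R + L2norm (toC (zt t) \- veloc m v)%R <= ((cw m + 1) * D)%:E)%E.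
Proof.
move=> tT vb [B bB] dD; have D0 := l2_le_ge0 dD.
pose d k := sol t k - b k; have sdD : N1 (star d) D by apply: l2_le_star dD; exact: w1N.
have d12 : N1 (fun k => 2^-1 * (d k + star d k)) D.
  have := l2_leZ 2^-1 (@w1_ge0 _ m) (l2_leD (@w1_ge0 _ m) dD sdD).
  apply: l2_le_monoM; rewrite Normc.normcV normc2; lra.
have i2 : normc (2 * 'i : R[i])^-1 = 2^-1 by rewrite Normc.normcV Normc.normcM normc2 normci mulr1.
have e12 : N1 (fun k => (2 * 'i)^-1 * (d k - star d k)) D.
  have := l2_leZ (2 * 'i)^-1 (@w1_ge0 _ m) (l2_leB (@w1_ge0 _ m) dD sdD).
  apply: l2_le_monoM; rewrite i2; lra.
have vbb := has_coefs_conj vb.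
have dE k : star d k = star (sol t) k - star b k by rewrite /star conjcB.
have hp : has_coefs (posn v) (fun k => 2^-1 * (b k + star b k)).
  apply: has_coefs_extf (has_coefsZ 2^-1 (has_coefsD vb vbb)) => x; rewrite posn_half//.
have hq : has_coefs (toC (fun x => Im (v x))) (fun k => (2 * 'i)^-1 * (b k - star b k)).
  by apply: has_coefs_extf (has_coefsZ (2 * 'i)^-1 (has_coefsB vb vbb)) => x; rewrite imag_half.
have B1 : N1 (fun k => (2 * 'i)^-1 * (b k - star b k)) B.
  have := l2_leZ (2 * 'i)^-1 (@w1_ge0 _ m) (l2_leB (@w1_ge0 _ m) bB (l2_le_star (@w1N _ m) bB)).
  apply: l2_le_monoM; rewrite i2; lra.
have hj : has_coefs (japD m (toC (fun x => Im (v x)))) (fun k => (w k)%:C * ((2 * 'i)^-1 * (b k - star b k))).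
  have h : l2_le (fun=> 1) (fun k => (w k)%:C * fourier (toC (fun x => Im (v x))) k) B.
    by rewrite (has_coefsE hq); exact: l2_le_w1_1.
  by have := Fmul_coefs h; rewrite (has_coefsE hq).
have E1 : has_coefs (toC (z t) \- posn v) (fun k => 2^-1 * (d k + star d k)).
  apply: has_coefs_ext (has_coefsB (lz tT) hp) => k.
  have -> : coefs z t k = 2^-1 * (sol t k + star (sol t) k).
    by rewrite sol_plus// mulKf// pnatr_eq0.
  by rewrite dE /d; ring.
have E2 : has_coefs (toC (zt t) \- veloc m v) (fun k => -1 * ((w k)%:C * ((2 * 'i)^-1 * (d k - star d k)))).
  apply: has_coefs_ext (has_coefs_extf _ (has_coefsD (lzt tT) hj)) => [k|x]; last by rewrite /veloc /= opprK.
  by rewrite (sol_minus k tT) dE /d; ring.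
have N2 : l2_le (fun=> 1) (fourier (toC (zt t) \- veloc m v)) D.
  rewrite (has_coefsE E2); have := l2_leZ (-1) (fun _ => ler01) (l2_le_w1_1 e12).
  by rewrite normcN Normc.normc1 mul1r.
have [_ S2] := sqint_of_coef (has_coefs_cintg E2) N2.
rewrite mulrDl mul1r EFinD; apply: leeD.
  apply/Hnorm_l2_le; first by rewrite mulr_ge0 ?cw_ge0.
  by split; [exact: E1.1|rewrite (has_coefsE E1); exact: l2_le_ws1].
rewrite (L2normE E2.1) lee_fin -[leRHS]ger0_norm// -sqrtr_sqr.
by rewrite ler_wsqrtr.
Qed.

End Solution.

Theorem corollary26 (R : realType) (m : R) (u0 u1 : T3 R -> R) (T : R)
    (z zt : R -> T3 R -> R) :
  m != 0 ->
  Hs (7 / 4) (toC u0) ->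
  Hs (3 / 4) (toC u1) ->
  0 < T ->
  contH T (7 / 4) z ->
  derivH T (3 / 4) z zt ->
  contH T (3 / 4) zt ->
  wave_eq m T z zt ->
  {ae haar R, forall x, z 0 x = u0 x} ->
  {ae haar R, forall x, zt 0 x = u1 x} ->
  exists C : R, 0 < C /\
    forall (tau : R) (n : nat), 0 < tau -> n%:R * tau <= T ->
      let t := n%:R * tau in
      let un := scheme m tau u0 u1 n in
      let err := toC (z t) \- posn un in
      let err' := toC (zt t) \- veloc m un in
      (Hnorm 1 err + L2norm err' <= (C * tau ^+ 2)%:E)%E.
Proof.
move=> m0 h0 h1 T0 cz dz czt eqz z0 zt0.
have [M HM] := sol_bound m0 T0 cz czt.
have [C [C0 HC]] := global_error m0 T0 HM (sol_ccont m cz czt)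
  (fun t k => @sol_cder _ _ m0 _ _ _ cz dz czt eqz t k).
have c1 : 0 < cw m + 1 by rewrite ltr_wpDl ?cw_ge0.
exists ((cw m + 1) * C); split; first exact: mulr_gt0.
move=> tau n t0 nT.
have tT : 0 <= n%:R * tau <= T by rewrite nT andbT mulr_ge0// ltW.
have [uc uH1] := scheme_coefs m0 T0 cz czt n (Hs_l2_le h0).1 (Hs_l2_le h1).1 z0 zt0 t0.
have := error_bound m0 cz czt tT uc uH1 (HC tau n t0 nT).
by rewrite mulrA.
Qed.
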